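(* Let $\varepsilon>0$. In almost every $n$-vertex random graph process $\{G_M\}_{M\geq 0}$, the following holds for each $0\leq M\leq \binom{n}{2}$: if $\delta(G_M)\geq 2$, then $G_M$ is $(1/2-\varepsilon)$-resiliently Hamiltonian, but not $(1/2+\varepsilon)$-resiliently Hamiltonian.
   Context: The $n$-vertex random graph process $\{G_M\}_{M\geq 0}$: $G_0$ is the empty graph on vertex set $[n]$, and for $1\le M\le\binom n2$, $G_M$ is obtained from $G_{M-1}$ by adding an edge chosen uniformly at random among the non-edges, until the complete graph is reached. ''In almost every random graph process'' means with probability tending to $1$ as $n\to\infty$. $\delta(G)$ denotes minimum degree. A graph $G$ is $\alpha$-resiliently Hamiltonian if for every subgraph $H\subset G$ with $d_H(v)\le \alpha d_G(v)$ for every $v\in V(G)$, the graph $G-H$ (same vertex set, edge set $E(G)\setminus E(H)$) is Hamiltonian. *)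

(* Defs.v *)
From mathcomp Require Import all_boot all_order all_algebra.
From mathcomp Require Import all_classical all_reals all_analysis.
Set Implicit Arguments.
Unset Strict Implicit.
Unset Printing Implicit Defensive.
Import Order.TTheory GRing.Theory Num.Theory.
Import numFieldNormedType.Exports.
Local Open Scope ring_scope.
Local Open Scope classical_set_scope.

Definition edge (V : finType) : finType := {e : {set V} | #|e| == 2%N}.

(* A simple graph on V is its edge set, so that the subgraph relation, G - H,
   the set of non-edges and the addition of an edge are the corresponding
   operations of finset. *)
Notation graph V := {set edge V}.

Section Graphs.
Variable V : finType.

Definition adj (G : graph V) : rel V :=
  [rel x y | [exists e : edge V, (e \in G) && (val e == [set x; y]%SET)]].

Definition degree (G : graph V) (v : V) : nat :=
  #|[set e : edge V | (e \in G) && (v \in val e)]%SET|.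

(* The default value #|V| exceeds every degree, hence only matters if V is
   empty. *)
Definition min_degree (G : graph V) : nat :=
  \big[minn/#|V|]_(v : V) degree G v.

(* In K_2 the sequence of the two vertices is a cycle of adj, whence the bound
   on the size. *)
Definition hamiltonian (G : graph V) : Prop :=
  exists c : seq V,
    [/\ (3 <= size c)%N, uniq c, cycle (adj G) c & forall v : V, v \in c].

Definition resiliently_hamiltonian (R : realType) (alpha : R) (G : graph V) :
    Prop :=
  forall H : graph V, H \subset G ->
    (forall v : V, (degree H v)%:R <= alpha * (degree G v)%:R) ->
    hamiltonian (G :\: H)%SET.

End Graphs.

Notation trajectory n := {ffun 'I_('C(n, 2)).+1 -> graph 'I_n}.

Section RandomGraphProcess.
Variable (R : realType) (n : nat).

Definition step_prob (G G' : graph 'I_n) : R :=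
  if [exists e : edge 'I_n, (e \notin G) && (G' == (e |: G)%SET)]
  then (#|(~: G)%SET|%:R)^-1 else 0.

(* The law of the Markov chain G_0, ..., G_N, where N = 'C(n, 2), as a
   probability mass function on its trajectories. *)
Definition trajectory_prob (w : trajectory n) : R :=
  (w ord0 == finset.set0)%:R *
  \prod_(M < 'C(n, 2)) step_prob (w (widen_ord (leqnSn _) M)) (w (lift ord0 M)).

Definition process_prob (A : trajectory n -> Prop) : R :=
  \sum_(w : trajectory n | `[< A w >]) trajectory_prob w.

End RandomGraphProcess.

Definition almost_every_process (R : realType)
    (A : forall n : nat, trajectory n -> Prop) : Prop :=
  process_prob R (A n) @[n --> \oo] --> (1 : R).

(* Main.v *)
(* Write D = G - H, so that every vertex keeps more than half of its edges in D, and let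
   P be a longest path of D.  Let Ga be P together with a sparse expanding subgraph of D.
   By Posa rotations inside Ga there is, for linearly many starting vertices x, a set
   S_x of linearly many end vertices s of longest paths Q_{x,s} from x to s.  If T is a
   set of fewer than (1/2 + eps/2) n vertices, let W_s be the set of predecessors on
   Q_{x,s} of the vertices of T.  The sets S_x and W_s are functions of Ga, x and T, and
   it has probability exp(-c n log n) that a proportion 1/2 + eps of the G-edges at almost
   all s in S_x lead to W_s, whereas there are only exp(gamma n log n) choices for
   (Ga, x, T).  Hence D has many edges from s in S_x to the complement of W_s, each of
   which rotates Q_{x,s} to a path that ends outside T.  A greedily chosen set of O(n) such
   edges serves all x and T simultaneously; after adding it to Ga there are more than
   (1/2 + eps/2) n possible ends for linearly many x, and the same union bound yields an
   edge of D that closes a longest path to a cycle, which is spanning as D is connected.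

   Vertices of low degree are pairwise far apart from the time when isolated vertices
   still exist onwards, hence do not spoil the expansion if the minimum degree is 2.

   For the converse, deleting the edges inside the two classes of a maximum cut leaves a
   bipartite graph and removes at most half of the edges at each vertex; if the classes
   have equal size, one typical vertex is moved to the other class.

   All estimates are made for independently labelled edges and transferred to the
   process, which is a uniformly random order of the edges. *)

Require Import Defs.
From mathcomp Require Import all_boot all_order all_algebra all_fingroup.
From mathcomp Require Import boolp reals sequences exp.
From mathcomp Require Import zify ring lra.
Set Implicit Arguments.
Unset Strict Implicit.
Unset Printing Implicit Defensive.
Import Order.TTheory GRing.Theory Num.Theory.

(** * Simple graphs *)

(** Two obstacles shape the proof. The graph H is chosen after the random graph, and there are too
    many D for a union bound. Every random property is therefore stated for G alone and quantified
    over sparse subgraphs Ga only. It passes to all D at once because D keeps a proportion theta of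
    the G-edges at each vertex, while on average a proportion smaller by a constant leads to the
    sets to be avoided ([spread_boundary]).

    The second obstacle is that the transfer from independent labels must work for all M
    simultaneously. Failure probabilities of order exp(-7 log n) survive both the factor N + 1 lost
    by conditioning on exactly M edges and the union over M. The existence of isolated vertices and
    the separation of low-degree vertices, however, are only shown to fail with probability O(1 /
    log n). They are reduced to monotone statements about two fixed times [M0] and [M1], for which
    the transfer costs a constant factor. After [M1] there are no low-degree vertices, with high
    probability. *)

Lemma leq_card_bigcup (I T : finType) (S : {set I}) (F : I -> {set T}) :
  #|\bigcup_(i in S) F i| <= \sum_(i in S) #|F i|.
Proof.
elim/big_ind2: _ => [|a A b B hA hB|//]; first by rewrite cards0.
by rewrite (leq_trans (leq_card_setU A B)) ?leq_add.
Qed.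

Section GraphBasics.
Variable V : finType.
Implicit Types (G H D : graph V) (e : edge V) (x y u v w : V) (S U : {set V}).

Definition nb G v : {set V} := [set u | adj G v u].

Definition nbs G S : {set V} := \bigcup_(v in S) nb G v.

(* Empty if [x = y]. *)
Definition pe x y : {set edge V} := [set e | val e == [set x; y]].

Lemma edgeE e v u : (val e == [set v; u]) = (v \in val e) && (u \in val e :\ v).
Proof.
have ce : #|val e| = 2 by apply/eqP; exact: valP e.
apply/eqP/idP => [he|/andP[hv]].
  rewrite he !inE !eqxx orbT andbT /=; apply/eqP => huv.
  by move: ce; rewrite he huv setUid cards1.
rewrite !inE => /andP[huv hu]; apply/esym/eqP.
rewrite eqEcard ce cards2 eq_sym huv andbT.
by apply/fintype.subsetP => z; rewrite !inE => /orP[]/eqP->.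
Qed.

Lemma card_edgeD1 e v : v \in val e -> #|val e :\ v| = 1.
Proof.
by move=> hv; have := cardsD1 v (val e); rewrite hv (eqP (valP e)) add1n => -[].
Qed.

Lemma card_pe x y : #|pe x y| = (x != y).
Proof.
case: eqVneq => [->|hxy] /=.
  apply/eqP; rewrite cards_eq0; apply/eqP/setP => e; rewrite !inE edgeE !inE eqxx.
  by rewrite andbF.
have c2 : #|[set x; y]| == 2 by rewrite cards2 hxy.
have -> : pe x y = [set (exist (fun s : {set V} => #|s| == 2) _ c2 : edge V)].
  by apply/setP => e; rewrite !inE -val_eqE.
by rewrite cards1.
Qed.

Lemma card_peI G x y : #|pe x y :&: G| = adj G x y.
Proof.
have h1 : #|pe x y :&: G| <= 1.
  by rewrite (leq_trans (subset_leq_card (subsetIl _ _))) // card_pe leq_b1.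
have -> : adj G x y = (0 < #|pe x y :&: G|).
  apply/existsP/card_gt0P => -[e]; first by case/andP=> he hv; exists e; rewrite !inE hv.
  by rewrite !inE => /andP[hv he]; exists e; rewrite he.
by case: #|_| h1 => [|[]].
Qed.

Lemma adjP G x y : reflect (exists2 e, e \in G & val e = [set x; y]) (adj G x y).
Proof.
apply: (iffP existsP) => [[e /andP[he /eqP hv]]|[e he hv]]; exists e => //.
by rewrite he hv eqxx.
Qed.

Lemma adjC G x y : adj G x y = adj G y x.
Proof. by rewrite /adj /=; under eq_existsb do rewrite setUC. Qed.

Lemma adjxx G x : adj G x x = false.
Proof.
by apply/negbTE/adjP => -[e _ /eqP]; rewrite edgeE !inE eqxx andbF.
Qed.

Lemma adj_neq G x y : adj G x y -> x != y.
Proof. by apply: contraTneq => ->; rewrite adjxx. Qed.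

Lemma adj_sub G H x y : G \subset H -> adj G x y -> adj H x y.
Proof.
by move=> /fintype.subsetP sGH /adjP[e he hv]; apply/adjP; exists e => //; exact: sGH.
Qed.

Lemma adjD G H x y : adj (G :\: H) x y = adj G x y && ~~ adj H x y.
Proof.
apply/adjP/andP => [[e]|[/adjP[e he hv] nH]].
  rewrite inE => /andP[nH hG] hv; split; first by apply/adjP; exists e.
  apply/adjP => -[e' he' hv']; case/negP: nH.
  by rewrite (_ : e = e') //; apply: val_inj; rewrite hv hv'.
exists e => //; rewrite inE he andbT; apply: contra nH => heH.
by apply/adjP; exists e.
Qed.

Lemma adj_pe_sub G x y : adj G x y -> pe x y \subset G.
Proof.
move=> /adjP[e he hv]; apply/fintype.subsetP => e'; rewrite inE => /eqP hv'.
by rewrite (_ : e' = e) //; apply: val_inj; rewrite hv hv'.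
Qed.

Lemma pe_adj G x y : x != y -> pe x y \subset G -> adj G x y.
Proof.
move=> hxy /setIidPl hI; have := card_peI G x y.
by rewrite hI card_pe hxy; case: adj.
Qed.

(** Independence is per edge, so sums over vertices and their neighbours have to be rearranged into
    sums over edges before an exponential moment can factor. *)
Lemma sum_adj (R : nmodType) G (b : V -> V -> R) :
  (\sum_s \sum_(u in nb G s) b s u =
   \sum_(e in G) \sum_s \sum_(u | val e == [set s; u]) b s u)%R.
Proof.
rewrite exchange_big /=; apply: eq_bigr => s _.
rewrite (exchange_big_dep predT) //=; rewrite big_mkcond /=; apply: eq_bigr => u _.
rewrite inE -[LHS]/(if adj G s u then b s u else 0)%R.
rewrite (eq_bigl (fun e => e \in pe s u :&: G)); last by move=> e; rewrite !inE andbC.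
by rewrite sumr_const card_peI; case: adj.
Qed.

Lemma sum_edge_ends e :
  \sum_s \sum_(u | val e == [set s; u]) 1 = 2.
Proof.
transitivity #|val e|; last exact/eqP/(valP e).
rewrite -sum1_card [RHS]big_mkcond /=; apply: eq_bigr => s _.
under eq_bigl do rewrite edgeE.
by case: ifP => hs; rewrite ?big_pred0_eq //= sum1_card card_edgeD1.
Qed.

Lemma degree_nb G v : degree G v = #|nb G v|.
Proof.
rewrite /degree -sum1_card (eq_bigl (fun e => (e \in G) && (v \in val e))); last first.
  by move=> e; rewrite inE.
rewrite big_mkcondr /= -sum1_card.
transitivity (\sum_(e in G) \sum_(u | val e == [set v; u]) 1).
  apply: eq_bigr => e _; under eq_bigl do rewrite edgeE.
  by case: ifP => hs; rewrite ?big_pred0_eq //= sum1_card card_edgeD1.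
rewrite (exchange_big_dep predT) //= [RHS]big_mkcond /=; apply: eq_bigr => u _.
rewrite (eq_bigl (fun e => e \in pe v u :&: G)); last by move=> e; rewrite !inE andbC.
by rewrite sum1_card card_peI inE; case: adj.
Qed.

Lemma card_edge : #|{: edge V}| = 'C(#|V|, 2).
Proof. by rewrite card_sig -card_draws; apply: eq_card => A; rewrite !inE. Qed.

Lemma card_edges_in U : #|[set e : edge V | val e \subset U]| = 'C(#|U|, 2).
Proof.
rewrite -cards_draws -(card_imset _ (@val_inj _ _ (edge V))); apply: eq_card => A.
rewrite inE; apply/imsetP/andP => [[e]|[hA cA]].
  by rewrite inE => he ->; split=> //; exact: valP e.
by exists (exist (fun s : {set V} => #|s| == 2) _ cA : edge V); rewrite ?inE.
Qed.

Lemma nb_sub G H v : G \subset H -> nb G v \subset nb H v.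
Proof. by move=> h; apply/fintype.subsetP => u; rewrite !inE; exact: adj_sub. Qed.

Lemma degree_setD G H v : H \subset G -> degree G v = degree H v + degree (G :\: H) v.
Proof.
move=> sHG; rewrite !degree_nb -(cardsID (nb H v)); congr (_ + _).
  by congr #|pred_of_set _|; apply/setIidPr/nb_sub.
by apply: eq_card => u; rewrite !inE adjD andbC.
Qed.

Lemma min_degree_le G v : min_degree G <= degree G v.
Proof.
rewrite /min_degree; have: v \in index_enum V by rewrite mem_index_enum.
elim: (index_enum V) => // w s IH; rewrite in_cons big_cons geq_min.
by case/orP => [/eqP->|/IH->]; rewrite ?leqnn ?orbT.
Qed.

Lemma card_bigcup_pe S (C : V -> {set V}) :
  #|\bigcup_(v in S) \bigcup_(u in C v) pe v u| <= \sum_(v in S) #|C v|.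
Proof.
apply: leq_trans (leq_card_bigcup _ _) _; apply: leq_sum => v _.
apply: leq_trans (leq_card_bigcup _ _) _; rewrite -sum1_card; apply: leq_sum => u _.
by rewrite card_pe leq_b1.
Qed.

End GraphBasics.

(** * Longest paths and rotations *)

Section Paths.
Variable V : finType.
Implicit Types (G H D : graph V) (p q a b : seq V) (x y t u v w : V).

Definition is_path G p := uniq p && sorted (adj G) p.

Definition maxlen G : nat :=
  \max_(k < #|V|.+1 | [exists p : k.-tuple V, is_path G p]) k.

Definition longest G p := is_path G p && (size p == maxlen G).

(** The default [x] of [head] and [last] is harmless: since a vertex exists, longest paths are
    non-empty by [maxlen_gt0]. *)
Definition ends G x : {set V} :=
  [set t | [exists p : (maxlen G).-tuple V,
     [&& longest G p, head x p == x & last x p == t]]].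

Lemma is_path_size G p : is_path G p -> size p <= #|V|.
Proof. by case/andP => /card_uniqP <- _; exact: max_card. Qed.

Lemma is_path_maxlen G p : is_path G p -> size p <= maxlen G.
Proof.
move=> hp; have hs := is_path_size hp.
rewrite /maxlen (bigD1 (Ordinal (hs : size p < #|V|.+1))) /= ?leq_maxl //.
by apply/existsP; exists (in_tuple p).
Qed.

Lemma ex_longest G : exists p, longest G p.
Proof.
have h0 : [exists p : (@ord0 #|V|).-tuple V, is_path G p] by apply/existsP; exists [tuple].
have := @eq_bigmax_cond _ (fun k : 'I_#|V|.+1 => [exists p : k.-tuple V, is_path G p])
  (fun k => k : nat).
case=> [|k]; first by apply/card_gt0P; exists ord0.
rewrite unfold_in => /existsP[p hp] hk; exists p.
by rewrite /longest hp size_tuple /maxlen hk eqxx.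
Qed.

Lemma endsP G x t :
  reflect (exists p, [/\ longest G p, head x p = x & last x p = t]) (t \in ends G x).
Proof.
rewrite inE; apply: (iffP existsP) => [[p /and3P[h1 /eqP h2 /eqP h3]]|[p [h1 h2 h3]]].
  by exists p.
have hs : size p == maxlen G by case/andP: h1.
by exists (Tuple hs); rewrite /= h1 h2 h3 !eqxx.
Qed.

Lemma is_path_sub G H p : G \subset H -> is_path G p -> is_path H p.
Proof.
move=> sGH /andP[up sp]; rewrite /is_path up /=.
by apply: sub_sorted sp => x y; exact: adj_sub.
Qed.

Lemma maxlen_sub G H : G \subset H -> maxlen G <= maxlen H.
Proof.
move=> sGH; have [p /andP[hp /eqP <-]] := ex_longest G.
exact/is_path_maxlen/(is_path_sub sGH).
Qed.

Lemma maxlen_gt0 G x : 0 < maxlen G.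
Proof. by apply: (@is_path_maxlen G [:: x]). Qed.

Lemma longest_gt0 G p x : longest G p -> 0 < size p.
Proof. by case/andP => _ /eqP->; exact: maxlen_gt0 x. Qed.

Lemma sorted_cat_cons (e : rel V) a w b :
  sorted e (a ++ w :: b) = sorted e (rcons a w) && path e w b.
Proof. by case: a => [//|z a] /=; rewrite cat_path rcons_path /= andbA. Qed.

Lemma rev_is_path G p : is_path G (rev p) = is_path G p.
Proof.
rewrite /is_path rev_uniq rev_sorted; congr (_ && _).
by apply: eq_sorted => x y; rewrite adjC.
Qed.

Lemma rev_longest G p : longest G (rev p) = longest G p.
Proof. by rewrite /longest rev_is_path size_rev. Qed.

Lemma head_rev (T : Type) (z : T) s : head z (rev s) = last z s.
Proof. by case/lastP: s => [//|s y]; rewrite rev_rcons last_rcons. Qed.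

Lemma last_rev (T : Type) (z : T) s : last z (rev s) = head z s.
Proof. by rewrite -head_rev revK. Qed.

Lemma path_rev_rot G w b :
  adj G (last w b) w -> path (adj G) w b -> path (adj G) w (rev b).
Proof.
case/lastP: b => [//|b z]; rewrite last_rcons rev_rcons /= adjC => -> hp /=.
rewrite -[path _ _ _]/(sorted (adj G) (z :: rev b)) -rev_rcons rev_sorted.
by apply: sub_sorted (path_sorted hp) => u v; rewrite adjC.
Qed.

Lemma longest_rot G a w b : adj G (last w b) w ->
  longest G (a ++ w :: b) -> longest G (a ++ w :: rev b).
Proof.
move=> hadj /andP[/andP[up sp] sz]; apply/andP; split; last first.
  by move: sz; rewrite !size_cat /= size_rev.
have pe : perm_eq (a ++ w :: rev b) (a ++ w :: b).
  by rewrite perm_cat2l perm_cons perm_rev.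
rewrite /is_path (perm_uniq pe) up /=.
by move: sp; rewrite !sorted_cat_cons => /andP[-> /=]; exact: path_rev_rot.
Qed.

(** Otherwise appending [w] would give a path of [H] longer than [maxlen H]. Two graphs are needed
    because edges are added to the sparse graph after it already contains a longest path of D. *)
Lemma longest_mem G H p z w : G \subset H -> maxlen G = maxlen H -> longest G p ->
  adj H (last z p) w -> 0 < size p -> w \in p.
Proof.
move=> sGH hm /andP[hp /eqP hs] hadj p0; case: (boolP (w \in p)) => // hw.
have /andP[up sp] := is_path_sub sGH hp.
have : is_path H (rcons p w).
  rewrite /is_path rcons_uniq hw up /=.
  by case: p hadj sp {hp hs up hw} p0 => [//|y p] /= hadj sp _; rewrite rcons_path sp.
by move/is_path_maxlen; rewrite size_rcons hs hm ltnn.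
Qed.

(** Short for consecutive: [t] is the immediate successor of [u] on [p]. On a duplicate-free
    sequence this is a partial injection, on which all counting along paths rests. *)
Fixpoint csc p u t : bool :=
  if p is x :: s then
    if s is y :: _ then ((u == x) && (t == y)) || csc s u t else false
  else false.

Lemma csc_cons2 x y p u t :
  csc (x :: y :: p) u t = ((u == x) && (t == y)) || csc (y :: p) u t.
Proof. by []. Qed.

Lemma csc_cat a w b u t : csc (a ++ w :: b) u t = csc (rcons a w) u t || csc (w :: b) u t.
Proof.
elim: a => [//|z [|z' a] IH] /=; first by rewrite orbF.
by rewrite -orbA; congr (_ || _); exact: IH.
Qed.

Lemma csc_rev b u t : csc (rev b) u t = csc b t u.
Proof.
elim: b => [//|x [//|y b] IH].
rewrite -[RHS]/((t == x) && (u == y) || csc (y :: b) t u) -IH.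
rewrite !rev_cons -[rcons (rcons _ _) _]cats1 cat_rcons csc_cat /= orbF orbC.
by rewrite andbC.
Qed.

Lemma csc_mem p u t : csc p u t -> (u \in p) && (t \in p).
Proof.
elim: p => [//|x [//|y p] IH] /orP[/andP[/eqP-> /eqP->]|/IH/andP[hu ht]].
  by rewrite !inE !eqxx orbT.
by rewrite !(in_cons x) hu ht !orbT.
Qed.

Lemma csc_funl p u u' t : uniq p -> csc p u t -> csc p u' t -> u = u'.
Proof.
elim: p => [//|x [//|y p] IH] /andP[hx hu]; have /andP[hy _] := hu.
have ny s v : csc (y :: s) v y -> y \in s.
  case: s => [//|z s]; rewrite csc_cons2 => /orP[/andP[_ /eqP->]|/csc_mem/andP[]//].
  exact: mem_head.
rewrite !csc_cons2; case/orP => [/andP[/eqP-> /eqP->]|h1]; case/orP => [/andP[/eqP-> /eqP ht]|h2] //.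
- by move/ny: h2; rewrite (negbTE hy).
- by move: h1; rewrite ht => /ny; rewrite (negbTE hy).
- exact: IH.
Qed.

Lemma csc_funr p u t t' : uniq p -> csc p u t -> csc p u t' -> t = t'.
Proof. by move=> hp h1 h2; apply: (@csc_funl (rev p) _ _ u); rewrite ?rev_uniq ?csc_rev. Qed.

Lemma csc_last z p t : uniq p -> csc p (last z p) t = false.
Proof.
move=> up; apply/negP; elim: p z up => [//|x [//|y p] IH] z /andP[hx hu].
rewrite csc_cons2; case/orP => [/andP[/eqP hl _]|]; last exact: (IH x).
by move: hx; rewrite -hl /= mem_last.
Qed.

Section Posa.
Variables (G : graph V) (p : seq V) (x : V).
Hypotheses (hlong : longest G p) (hx : head x p = x).

Inductive rotations : seq V -> Prop :=
| rotations0 : rotations p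
| rotationsS a w b : rotations (a ++ w :: b) -> adj G (last w b) w ->
    rotations (a ++ w :: rev b).

Definition rot_ends : {set V} := [set t | `[< exists2 q, rotations q & last x q = t >]].

Lemma rotations_longest q : rotations q -> longest G q /\ head x q = x.
Proof.
elim=> [//|a w b _ [hl hd] hadj]; split; first exact: longest_rot hl.
by case: a hd {hl}.
Qed.

Lemma rot_endsP t : reflect (exists2 q, rotations q & last x q = t) (t \in rot_ends).
Proof. by rewrite inE; exact: asboolP. Qed.

Lemma rot_ends_sub : rot_ends \subset ends G x.
Proof.
apply/fintype.subsetP => t /rot_endsP[q /rotations_longest[h1 h2] h3].
by apply/endsP; exists q.
Qed.

Definition path_nb q u t := csc q u t || csc q t u.

(* Whenever a rotation destroys a path edge at a vertex [u], the other end of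
   that edge becomes the last vertex of the new path. *)
Lemma rotations_nb u : u \notin rot_ends ->
  (forall t, t \in rot_ends -> ~~ path_nb p u t) ->
  forall q, rotations q -> forall t, path_nb q u t -> path_nb p u t.
Proof.
move=> huS hnb q; elim=> [//|a w b hq IH hadj t].
case: b hq IH hadj => [|y b] hq IH hadj; first by rewrite adjxx in hadj.
have hq' : rotations (a ++ w :: rev (y :: b)) by exact: rotationsS.
have hy : y \in rot_ends.
  by apply/rot_endsP; exists (a ++ w :: rev (y :: b)); rewrite // last_cat /= last_rev.
have hz : last y b \in rot_ends.
  by apply/rot_endsP; exists (a ++ w :: y :: b); rewrite // last_cat.
have huz : u != last y b by apply: contraNneq huS => ->.
have huw : u != w.
  apply/eqP => hw; have := hnb _ hy; rewrite IH // hw /path_nb csc_cat /= !eqxx.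
  by rewrite !orbT.
have IH' := IH t.
have key v v' : csc (w :: rev (y :: b)) v v' ->
    (v = w /\ v' = last y b) \/ csc (y :: b) v' v.
  case hr: (rev (y :: b)) => [|z r]; first by move/(congr1 size): hr; rewrite size_rev.
  have hlz : z = last y b by rewrite -[z]/(head y (z :: r)) -hr head_rev.
  rewrite csc_cons2 => /orP[/andP[/eqP-> /eqP->]|h]; first by left; rewrite hlz.
  by right; rewrite -csc_rev hr.
move=> hu; apply: IH'; move: hu; rewrite /path_nb !csc_cat.
have sub v v' : csc (y :: b) v v' -> csc (w :: y :: b) v v' by move=> h; apply/orP; right.
case/orP => /orP[->//|/key]; rewrite ?orbT //.
- case=> [[hw _]|/sub->]; last by rewrite !orbT.
  by rewrite hw eqxx in huw.
- case=> [[_ hz']|/sub->]; last by rewrite !orbT.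
  by rewrite hz' eqxx in huz.
Qed.

(** A rotation at [u] turns the successor [y] of [u] on [q] into an end. If no end were next to [u]
    on [p], then [rotations_nb] would show that [u] and [y] are already neighbours on [p], a
    contradiction. *)
Lemma nbs_rot_ends u : u \in nbs G rot_ends -> u \notin rot_ends ->
  exists2 t, t \in rot_ends & path_nb p u t.
Proof.
case/bigcupP => s /rot_endsP[q hq hs]; rewrite inE => hadj huS.
have [//|hno] := pselect (exists2 t, t \in rot_ends & path_nb p u t).
have [hlq hdq] := rotations_longest hq.
have huq : u \in q.
  apply: (@longest_mem G G q x) => //; first by rewrite hs; exact: hadj.
  exact: longest_gt0 x hlq.
have hinv := @rotations_nb u huS.
move: hs hq hlq hdq; case/splitPr: huq => a b; rewrite last_cat => /= hs hq hlq hdq.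
case: b hs hq hlq hdq => [|y b] /= hs hq hlq hdq; first by rewrite hs adjxx in hadj.
have hy : y \in rot_ends.
  apply/rot_endsP; exists (a ++ u :: rev (y :: b)); last by rewrite last_cat /= last_rev.
  by apply: rotationsS => //=; rewrite hs.
exists y => //; apply: hinv hq _ _; last first.
  by rewrite /path_nb csc_cat /= !eqxx !orbT.
by move=> t ht; apply/negP => hp; case: hno; exists t.
Qed.

(* The last vertex of [p] has only one neighbour on [p], hence the strict inequality. *)
Lemma card_nbs_rot_ends : #|nbs G rot_ends :\: rot_ends| < 2 * #|rot_ends|.
Proof.
have up : uniq p by case/andP: hlong => /andP[].
have hl : last x p \in rot_ends by apply/rot_endsP; exists p => //; exact: rotations0.
set S := rot_ends.
have le1 (A : {set V}) : {in A &, forall u v, u = v} -> #|A| <= 1.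
  by move=> hA; apply/card_le1P => u hu v; rewrite inE; apply/idP/eqP => [hv|->//]; exact: hA.
pose A1 := \bigcup_(t in S) [set u | csc p u t].
pose A2 := \bigcup_(t in S :\ last x p) [set u | csc p t u].
have c1 : #|A1| <= #|S|.
  apply: leq_trans (leq_card_bigcup _ _) _; rewrite -[X in _ <= X]sum1_card.
  apply: leq_sum => t _; apply: le1 => u v; rewrite !inE; exact: csc_funl.
have c2 : #|A2| < #|S|.
  rewrite (cardsD1 (last x p) S) hl ltnS.
  apply: leq_trans (leq_card_bigcup _ _) _; rewrite -[X in _ <= X]sum1_card.
  apply: leq_sum => t _; apply: le1 => u v; rewrite !inE; exact: csc_funr.
suff hsub : nbs G S :\: S \subset A1 :|: A2.
  apply: leq_ltn_trans (subset_leq_card hsub) _.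
  apply: leq_ltn_trans (leq_card_setU _ _) _; lia.
apply/fintype.subsetP => u /setDP[hu huS]; have [t ht] := nbs_rot_ends hu huS.
rewrite inE; case/orP => h; apply/orP; [left|right]; apply/bigcupP.
  by exists t; last rewrite inE.
exists t; last by rewrite inE.
by rewrite in_setD1 ht andbT; apply: contraTneq h => ->; rewrite csc_last.
Qed.

End Posa.

Definition expands G (k : nat) := forall S : {set V}, S != set0 -> #|S| <= k ->
  2 * #|S| <= #|nbs G S :\: S|.

(** By [card_nbs_rot_ends] the ends reached by rotations violate the expansion inequality, so they
    must be too many for it to apply. *)
Lemma posa G k p x : expands G k -> longest G p -> head x p = x -> k < #|ends G x|.
Proof.
move=> hexp hp hx; apply: (@leq_trans #|rot_ends G p x|); last first.
  exact/subset_leq_card/rot_ends_sub.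
rewrite ltnNge; apply/negP => hk.
have hS : rot_ends G p x != set0.
  apply/set0Pn; exists (last x p); apply/rot_endsP; exists p => //; exact: rotations0.
by have := hexp _ hS hk; rewrite leqNgt card_nbs_rot_ends.
Qed.

(** The ends of longest paths with one fixed start are, by reversal, themselves starts of longest
    paths, and [posa] applies to each of them. *)
Lemma posa_starts G k x0 : expands G k -> k < #|[set x | k < #|ends G x|]|.
Proof.
move=> hexp; have [p hp] := ex_longest G.
have hx : head (head x0 p) p = head x0 p.
  by case: p hp => [|y p] // /(longest_gt0 x0).
have /leq_trans := posa hexp hp hx; apply; apply/subset_leq_card/fintype.subsetP => x.
case/endsP => q [hq hq1 hq2]; rewrite inE.
apply: (@posa G k (rev q)); rewrite ?rev_longest // head_rev -[RHS]hq2.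
by case: q hq {hq1 hq2} => [|y q] // /(longest_gt0 x0).
Qed.

End Paths.

Lemma ex_subset_card (T : finType) (A : {set T}) k : k <= #|A| ->
  exists2 B : {set T}, B \subset A & #|B| = k.
Proof.
move=> hk; exists [set x in take k (enum A)].
  by apply/fintype.subsetP => x; rewrite inE => /mem_take; rewrite mem_enum.
have hu : uniq (take k (enum A)) by rewrite take_uniq // enum_uniq.
rewrite cardsE (card_uniqP hu) size_take -cardE.
by case: ltnP => // h; apply/eqP; rewrite eqn_leq h hk.
Qed.

(* Greedy choice: some element of [E] lies in a [kappa]-fraction of the sets that are
   not hit yet. *)
Lemma hitting_set (R : realFieldType) (T I : finType) (A : {set I}) (E : {set T})
    (F : I -> {set T}) (kappa : R) (k : nat) :
  (0 < #|E|)%N -> (0 <= kappa <= 1)%R ->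
  (forall i, i \in A -> F i \subset E) ->
  (forall i, i \in A -> kappa * #|E|%:R <= #|F i|%:R)%R ->
  (#|A|%:R * (1 - kappa) ^+ k < 1)%R ->
  exists h : {set T}, [/\ h \subset E, #|h| <= k &
    forall i, i \in A -> F i :&: h != set0].
Proof.
move=> E0 /andP[k0 k1] sub big small.
suff [h [h1 h2 h3]] : exists h : {set T}, [/\ h \subset E, #|h| <= k &
    (#|[set i in A | F i :&: h == set0]|%:R <= #|A|%:R * (1 - kappa) ^+ k)%R].
  exists h; split=> // i hi; apply/negP => hi0.
  have := le_lt_trans h3 small; rewrite ltrn1 ltnS leqn0 cards_eq0 => /eqP/setP/(_ i).
  by rewrite !inE hi hi0.
elim: k {small} => [|k [h [h1 h2 h3]]].
  exists set0; rewrite sub0set cards0 expr0 mulr1 ler_nat; split=> //.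
  by apply/subset_leq_card/fintype.subsetP => i; rewrite inE => /andP[].
set U := [set i in A | F i :&: h == set0] in h3.
pose cnt e := #|[set i in U | e \in F i]|.
have [e he hc] : exists2 e, e \in E & (kappa * #|U|%:R <= (cnt e)%:R)%R.
  have [//|hno] := pselect (exists2 e, e \in E & (kappa * #|U|%:R <= (cnt e)%:R)%R).
  have : (\sum_(e in E) (cnt e)%:R < \sum_(e in E) kappa * #|U|%:R)%R.
    apply: ltr_sum.
      by case/card_gt0P: E0 => e he; apply/hasP; exists e; rewrite ?mem_index_enum.
    by move=> e he; rewrite ltNge; apply/negP => hc; case: hno; exists e.
  rewrite sumr_const ltNge -natr_sum.
  have -> : \sum_(e in E) cnt e = \sum_(i in U) #|F i|.
    transitivity (\sum_(e in E) \sum_(i in U | e \in F i) 1).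
      apply: eq_bigr => e _; rewrite /cnt -sum1_card; apply: eq_bigl => i.
      by rewrite [LHS]in_set.
    rewrite (exchange_big_dep (fun i => i \in U)) /=; last by move=> e i _ /andP[].
    apply: eq_bigr => i hi; rewrite -sum1_card; apply: eq_bigl => e.
    rewrite hi /=; apply/andP/idP => [[]//|hF]; split=> //.
    apply: (fintype.subsetP (sub i _)) hF; by move: hi; rewrite inE => /andP[].
  rewrite natr_sum; suff -> : (kappa * #|U|%:R *+ #|E| <= \sum_(i in U) #|F i|%:R)%R by [].
  rewrite -mulr_natr mulrAC mulr_natr -sumr_const; apply: ler_sum => i hi; apply: big.
  by move: hi; rewrite inE => /andP[].
exists (e |: h); split.
- by rewrite subUset sub1set he.
- by rewrite (leq_trans (leq_card_setU _ _)) // cards1 add1n ltnS.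
have hsub : [set i in A | F i :&: (e |: h) == set0] \subset U :\: [set i in U | e \in F i].
  apply/fintype.subsetP => i; rewrite in_setD in_set => /andP[hA hi].
  have hi0 z : z \in F i -> z \in e |: h -> False.
    by move=> hz1 hz2; move/eqP/setP/(_ z): hi; rewrite in_setI hz1 hz2 inE.
  have hU : i \in U.
    rewrite inE hA; apply/eqP/setP => z; rewrite in_setI in_set0; apply/negP => /andP[z1 z2].
    by apply: (hi0 z); rewrite // in_setU1 z2 orbT.
  rewrite hU andbT in_set hU; apply/negP => heF; apply: (hi0 e heF).
  by rewrite in_setU1 eqxx.
have hle := subset_leq_card hsub; rewrite -(ler_nat R) in hle; apply: le_trans hle _.
have -> : #|U :\: [set i in U | e \in F i]| = #|U| - cnt e.
  rewrite cardsD /cnt; congr (_ - _); apply: eq_card => i; rewrite !inE.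
  by case: (i \in A); rewrite //= andbA andbb.
have hcU : cnt e <= #|U|.
  by apply/subset_leq_card/fintype.subsetP => i; rewrite inE => /andP[].
rewrite natrB //; apply: (@le_trans _ _ ((1 - kappa) * #|U|%:R)%R).
  by rewrite mulrBl mul1r lerD2l lerN2.
by rewrite exprS mulrCA ler_wpM2l // subr_ge0.
Qed.

(** * Closing a longest path, and rotations by newly added edges *)

Section Cycles.
Variable V : finType.
Implicit Types (G H D : graph V) (p q a b : seq V) (x y t u v w : V).

(** Phrased by neighbour-closed sets because expansion excludes these directly. *)
Definition connected D := forall C : {set V}, C != set0 -> nbs D C \subset C -> C = setT.

(** If the cycle misses a vertex, connectedness gives an edge from some [y] on it to some [z] off
    it; opening the cycle at [y] and prepending [z] yields a longer path. *)
Lemma longest_close D p x : connected D -> 2 < #|V| ->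
  longest D p -> head x p = x -> adj D (last x p) x -> hamiltonian D.
Proof.
move=> hconn n3 hl hx hadj; have p0 := longest_gt0 x hl.
have /andP[/andP[up sp] /eqP sz] := hl.
have hc : path.cycle (adj D) p.
  by case: p p0 hx hadj sp {hl up sz} => [//|y s] /= _ -> hadj sp; rewrite rcons_path sp.
have [hall|/forallPn [z0 hz0]] := boolP [forall v, v \in p].
  exists p; split=> //; last exact/forallP.
  rewrite -(card_uniqP up) (leq_trans n3) // subset_leq_card //.
  by apply/fintype.subsetP => v _; exact: (forallP hall).
have [hsub|] := boolP (nbs D [set v in p] \subset [set v in p]).
  have hne : [set v in p] != set0.
    by apply/set0Pn; exists (head x p); rewrite inE; case: p p0 {hl hx hadj up sp sz hc hz0 hsub} => //= *; exact: mem_head.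
  by have /setP/(_ z0) := hconn _ hne hsub; rewrite !inE (negbTE hz0).
case/fintype.subsetPn => z /bigcupP[y]; rewrite !inE => hy hyz hz.
have : is_path D (z :: rot (index y p) p).
  rewrite /is_path /= mem_rot hz rot_uniq up /=.
  move: hc; rewrite -(rot_cycle (index y p)) (rot_index hy) /= adjC hyz /=.
  by rewrite rcons_path => /andP[].
by move/is_path_maxlen; rewrite /= size_rot sz ltnn.
Qed.

(** One path is fixed for each triple, so that [pre_ends] is a function of [G], [x], [s] and [T] and
    the union bound need not range over paths. *)
Definition chosen_path G x s : seq V :=
  if [pick p : (maxlen G).-tuple V | [&& longest G p, head x p == x & last x p == s]]
  is Some p then p else [::].

Definition pre_ends G x s (T : {set V}) : {set V} :=
  [set w | [exists t in T, csc (chosen_path G x s) w t]].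

Lemma chosen_pathP G x s : s \in ends G x ->
  [/\ longest G (chosen_path G x s), head x (chosen_path G x s) = x &
      last x (chosen_path G x s) = s].
Proof.
rewrite inE => /existsP[p hp]; rewrite /chosen_path.
by case: pickP => [q /and3P[? /eqP ? /eqP ?]//|/(_ p)]; rewrite hp.
Qed.

Lemma card_pre_ends G x s T : #|pre_ends G x s T| <= #|T|.
Proof.
have uQ : uniq (chosen_path G x s).
  by rewrite /chosen_path; case: pickP => // q /and3P[/andP[/andP[]]].
apply: (@leq_trans #|\bigcup_(t in T) [set w | csc (chosen_path G x s) w t]|).
  apply/subset_leq_card/fintype.subsetP => w; rewrite inE => /existsP[t /andP[ht hc]].
  by apply/bigcupP; exists t; rewrite ?inE.
apply: leq_trans (leq_card_bigcup _ _) _; rewrite -sum1_card; apply: leq_sum => t _.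
apply/card_le1P => u; rewrite inE => hu v; rewrite !inE; apply/idP/eqP => [hv|->//].
exact: csc_funl uQ hv hu.
Qed.

(** Rotating the chosen path by the edge from [s] to [w] makes the successor of [w] an end in [H].
    It is used in the contrapositive: an edge of [H] from [s] to the complement of
    [pre_ends G x s T] produces an end outside [T]. *)
Lemma pre_ends_mem G H x s w : G \subset H -> maxlen G = maxlen H ->
  s \in ends G x -> adj H s w -> w \in pre_ends G x s (ends H x).
Proof.
move=> sGH hm hs hadj; have [hl hh hlast] := chosen_pathP hs.
have hlH : longest H (chosen_path G x s).
  by case/andP: hl => h1 h2; rewrite /longest (is_path_sub sGH h1) -hm.
have hw : w \in chosen_path G x s.
  by apply: (@longest_mem _ G H _ x) => //; rewrite ?hlast //; exact: longest_gt0 x hl.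
rewrite inE; move: hl hh hlast hlH; case/splitPr: hw => a b hl hh hlast hlH.
case: b hlast hl hh hlH => [|y b]; rewrite last_cat /= => hlast hl hh hlH.
  by rewrite hlast adjxx in hadj.
apply/existsP; exists y; rewrite csc_cat csc_cons2 !eqxx !orbT andbT.
apply/endsP; exists (a ++ w :: rev (y :: b)); split.
- by apply: longest_rot => //=; rewrite hlast.
- by case: a hh {hl hlH hlast}.
- by rewrite last_cat /= last_rev.
Qed.

Definition path_edges p : graph V :=
  \bigcup_(u in [set: V]) \bigcup_(t in [set t | csc p u t]) pe u t.

Lemma csc_sorted (e : rel V) p :
  (forall u t, csc p u t -> e u t) -> sorted e p.
Proof.
elim: p => [//|x [//|y p] IH] h /=; rewrite h ?csc_cons2 ?eqxx //=.
by apply: IH => u t hut; apply: h; rewrite csc_cons2 hut orbT.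
Qed.

Lemma sorted_csc (e : rel V) p u t : sorted e p -> csc p u t -> e u t.
Proof.
elim: p => [//|x [//|y p] IH] /= /andP[hxy hp].
rewrite -/(csc (x :: y :: p) u t) csc_cons2 => /orP[/andP[/eqP-> /eqP->]//|]; exact: IH.
Qed.

Lemma path_edgesP D p : is_path D p ->
  [/\ path_edges p \subset D, is_path (path_edges p) p & #|path_edges p| <= #|V|].
Proof.
case/andP => up sp; split.
- apply/bigcupsP => u _; apply/bigcupsP => t; rewrite inE => h.
  exact/adj_pe_sub/(sorted_csc sp).
- rewrite /is_path up /=; apply: csc_sorted => u t h; apply: pe_adj.
    exact: adj_neq (sorted_csc sp h).
  apply: (bigcup_max u) => //.
  by apply: (bigcup_max t); rewrite ?inE.
- apply: leq_trans (card_bigcup_pe _ _) _; rewrite -cardsT -[X in _ <= X]sum1_card.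
  apply: leq_sum => u _; apply/card_le1P => t; rewrite inE => ht t'; rewrite !inE.
  by apply/idP/eqP => [ht'|->//]; exact: csc_funr up ht' ht.
Qed.

End Cycles.

(** * Expansion *)

Section Expansion.
Variable V : finType.
Implicit Types (G H D Ga : graph V) (x y t u v w : V) (S U L : {set V}).

Definition edges_in G U : graph V := [set e in G | val e \subset U].

(** [L] will be the set of vertices of large degree. Length 4 is what [separated_near] needs: two
    vertices outside [L] whose closed neighbourhoods have a common neighbour [w] are joined by a
    walk of at most 4 steps through [w]. *)
Definition separated G L := forall x y (s : seq V), x \notin L -> y \notin L -> x != y ->
  size s <= 4 -> path (adj G) x s -> last x s = y -> False.

(** Probabilities are estimated for self-avoiding paths, whose edges are distinct and hence
    independent; the expansion argument produces walks. *)
Lemma separated_uniq G L :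
  (forall x y (s : seq V), x \notin L -> y \notin L -> size s <= 4 ->
    path (adj G) x s -> uniq (x :: s) -> 0 < size s -> last x s = y -> False) ->
  separated G L.
Proof.
move=> h x y s hx hy hxy hs hp hl; move: hxy; rewrite -hl.
case/shortenP: hp hl => s' hp' us' sub hl hne; apply: (h x y s') => //.
  apply: leq_trans hs; case/andP: us' => _ us'; exact: uniq_leq_size.
by case: s' hne {hp' us' sub hl} => //=; rewrite eqxx.
Qed.

Lemma separated_near G L v v' w y y' : separated G L -> v \notin L -> v' \notin L ->
  y = v \/ adj G v y -> y' = v' \/ adj G v' y' -> adj G w y -> adj G w y' -> v = v'.
Proof.
move=> hsep hv hv' hy hy' hwy hwy'; have [//|hne] := eqVneq v v'; exfalso.
case: hy hwy => [->|hy] hwy; case: hy' hwy' => [->|hy'] hwy'.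
- by apply: (hsep v v' [:: w; v']) => //=; rewrite adjC hwy hwy'.
- by apply: (hsep v v' [:: w; y'; v']) => //=; rewrite adjC hwy hwy' adjC hy'.
- by apply: (hsep v v' [:: y; w; v']) => //=; rewrite hy adjC hwy hwy'.
- by apply: (hsep v v' [:: y; w; y'; v']) => //=; rewrite hy adjC hwy hwy' adjC hy'.
Qed.

(** Each edge of [B] is counted at most once from either of its ends. *)
Lemma sum_nb_edges G (B : graph V) S (C : V -> {set V}) :
  (forall v, v \in S -> C v \subset nb G v) ->
  (forall e s u, e \in G -> s \in S -> u \in C s -> val e = [set s; u] -> e \in B) ->
  \sum_(v in S) #|C v| <= 2 * #|B|.
Proof.
move=> hC hB; pose b s u : nat := (s \in S) && (u \in C s).
have -> : \sum_(v in S) #|C v| = \sum_s \sum_(u in nb G s) b s u.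
  rewrite big_mkcond; apply: eq_bigr => s _; case: ifP => hs; last first.
    by rewrite big1 // => u _; rewrite /b hs.
  rewrite -sum1_card big_mkcond [RHS]big_mkcond; apply: eq_bigr => u _.
  rewrite /b hs /=; case hu: (u \in C s); last by case: ifP.
  by rewrite (fintype.subsetP (hC s hs) _ hu).
have := @sum_adj V nat G b => ->.
rewrite mulnC -sum_nat_const big_mkcond [X in _ <= X]big_mkcond.
apply: leq_sum => e _; case: ifP => heG; last by case: ifP.
case: ifP => he.
  apply: leq_trans (eq_leq (sum_edge_ends e)).
  by apply: leq_sum => s _; apply: leq_sum => u _; exact: leq_b1.
rewrite leqn0; apply/eqP/big1 => s _; apply: big1 => u hsu; rewrite /b.
case: (boolP (s \in S)) => hs //=; case: (boolP (u \in C s)) => hu //=.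
by rewrite (hB e s u) ?(eqP hsu) in he.
Qed.

(** [S2] consists of the large vertices of [S] and [S1] of the small ones. Sparsity gives [S2] at
    least 6 |S2| outside neighbours. At most 3 |S2| of them interfere with the small vertices and
    their chosen pairs, and [S2] covers at most |S2| vertices of these pairs; hence 2 |S1| + (6 - 3
    - 1) |S2| = 2 |S| remain. *)
Lemma expansion_small G Ga L (C : V -> {set V}) k m :
  Ga \subset G -> separated G L ->
  (forall v u, u \in C v -> adj Ga v u) ->
  (forall v, v \in L -> #|C v| = k) -> (forall v, v \notin L -> #|C v| = 2) ->
  (forall U, U != set0 -> #|U| <= 7 * m -> 14 * #|edges_in G U| < k * #|U|) ->
  expands Ga m.
Proof.
move=> sG hsep hC hk h2 hsparse S S0 hS.
pose S1 := S :\: L; pose S2 := S :&: L.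
have cS : #|S| = #|S2| + #|S1| by rewrite -(cardsID L S).
have hS1 v : v \in S1 -> v \notin L by rewrite inE => /andP[].
(* Otherwise [U] has fewer than 7 |S2| vertices and spans at least k |S2| / 2 edges, against the
   bound 14 e(U) < k |U|. *)
have large : 6 * #|S2| <= #|nbs Ga S2 :\: S2|.
  rewrite leqNgt; apply/negP => hlt.
  pose U := S2 :|: nbs Ga S2.
  have cU : #|U| < 7 * #|S2|.
    have -> : U = S2 :|: (nbs Ga S2 :\: S2).
      by apply/setP => z; rewrite !inE; case: (z \in S); case: (z \in L); rewrite ?orbT.
    apply: leq_ltn_trans (leq_card_setU _ _) _; lia.
  have hU0 : U != set0.
    apply: contraTneq hlt => hU; have : S2 \subset set0 by rewrite -hU subsetUl.
    by rewrite subset0 => /eqP->; rewrite cards0 muln0.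
  have hUm : #|U| <= 7 * m by lia.
  have hsum : \sum_(v in S2) #|C v| <= 2 * #|edges_in G U|.
    apply: (@sum_nb_edges G) => [v hv|e v u he hv hu hvu].
      by apply/fintype.subsetP => u hu; rewrite inE; apply: adj_sub sG _; exact: hC.
    rewrite inE he /= hvu subUset !sub1set; apply/andP; split.
      by rewrite /U in_setU hv.
    rewrite /U in_setU; apply/orP; right.
    by apply/bigcupP; exists v => //; rewrite inE; exact: hC.
  have hsk : \sum_(v in S2) #|C v| = #|S2| * k.
    by rewrite -sum_nat_const; apply: eq_bigr => v; rewrite inE => /andP[_ /hk].
  have := hsparse U hU0 hUm; rewrite hsk in hsum; nia.
pose Q := \bigcup_(v in S1) C v.
have cQ : 2 * #|S1| <= #|Q|.
  have -> : 2 * #|S1| = \sum_(v in S1) #|C v|.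
    by rewrite mulnC -sum_nat_const; apply: eq_bigr => v /hS1/h2.
  have -> : \sum_(v in S1) #|C v| = \sum_(v in S1) \sum_(u in C v) 1.
    by apply: eq_bigr => v _; rewrite sum1_card.
  rewrite (exchange_big_dep (fun u => u \in Q)) /=; last first.
    by move=> v u hv hu; apply/bigcupP; exists v.
  rewrite -sum1_card; apply: leq_sum => u _.
  rewrite sum1dep_card; apply/card_le1P => v; rewrite inE => /andP[hv hu] v'.
  rewrite !inE; apply/idP/eqP => [/andP[hv' hu']|->]; last by rewrite hu andbT -in_setD.
  have hvu := adj_sub sG (hC _ _ hu); have hvu' := adj_sub sG (hC _ _ hu').
  have [//|hne] := eqVneq v' v; exfalso.
  apply: (hsep v' v [:: u; v]) => //=; rewrite ?hS1 ?hvu' //=; last by rewrite adjC hvu.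
  by rewrite !inE.
have QS1 u : u \in Q -> u \notin S1.
  case/bigcupP => v hv hu; apply/negP => hu1; have hvu := adj_sub sG (hC _ _ hu).
  by apply: (hsep v u [:: u]); rewrite ?hS1 ?(adj_neq hvu) //= hvu.
have hQS2 : 2 * #|S1| <= #|Q :\: S2| + #|S2|.
  by rewrite cardsD; have := subset_leq_card (subsetIr Q S2); lia.
(* A vertex [w] is near at most one vertex [v0] of [S1], so it sees at most [v0] and its two chosen
   neighbours. *)
have hN3 : #|nbs Ga S2 :&: (Q :|: S1)| <= 3 * #|S2|.
  rewrite /nbs; apply: (@leq_trans #|\bigcup_(w in S2) (nb Ga w :&: (Q :|: S1))|).
    apply/subset_leq_card/fintype.subsetP => y /setIP[/bigcupP[w hw hy] hyQ].
    by apply/bigcupP; exists w => //; rewrite inE hy.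
  apply: leq_trans (leq_card_bigcup _ _) _; rewrite mulnC -sum_nat_const.
  apply: leq_sum => w hw.
  have near y : y \in Q :|: S1 -> exists2 v, v \in S1 & (y = v \/ adj G v y) /\ y \in v |: C v.
    rewrite inE => /orP[/bigcupP[v hv hy]|hy].
      exists v => //; split; last by rewrite !inE hy orbT.
      by right; apply: adj_sub sG _; exact: hC.
    by exists y => //; split; [left|rewrite !inE eqxx].
  have [->|/set0Pn[y0 /setIP[hy0 hyQ0]]] := eqVneq (nb Ga w :&: (Q :|: S1)) set0.
    by rewrite cards0.
  have [v0 hv0 [hn0 _]] := near _ hyQ0.
  apply: (@leq_trans #|v0 |: C v0|).
    apply/subset_leq_card/fintype.subsetP => y /setIP[hy hyQ].
    have [v hv [hn hvy]] := near _ hyQ.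
    rewrite inE in hy0; rewrite inE in hy.
    suff -> : v0 = v by [].
    by apply: (separated_near hsep (hS1 _ hv0) (hS1 _ hv) hn0 hn (adj_sub sG hy0)); exact: adj_sub sG hy.
  by rewrite (leq_trans (leq_card_setU _ _)) // cards1 h2 // hS1.
pose A := nbs Ga S2 :\: S2 :\: (Q :|: S1).
have cA : 3 * #|S2| <= #|A|.
  have hI : #|(nbs Ga S2 :\: S2) :&: (Q :|: S1)| <= 3 * #|S2|.
    apply: leq_trans hN3; apply/subset_leq_card; apply: setSI; exact: subsetDl.
  rewrite /A cardsD; lia.
have hsub : (Q :\: S2) :|: A \subset nbs Ga S :\: S.
  apply/fintype.subsetP => y /setUP[/setDP[hyQ hy2]|/setDP[/setDP[hyN hy2]]].
    rewrite inE; apply/andP; split.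
      move: (QS1 _ hyQ) hy2; rewrite !inE; by case: (y \in S); case: (y \in L).
    case/bigcupP: hyQ => v hv hy; apply/bigcupP; exists v; first by move: hv; rewrite inE => /andP[].
    by rewrite inE hC.
  rewrite inE negb_or => /andP[_ hy1]; rewrite inE; apply/andP; split.
    by move: hy1 hy2; rewrite !inE; case: (y \in S); case: (y \in L).
  case/bigcupP: hyN => v hv hy; apply/bigcupP; exists v => //.
  by move: hv; rewrite inE => /andP[].
apply: leq_trans (subset_leq_card hsub).
have hdis : [disjoint Q :\: S2 & A].
  rewrite disjoint_sym disjoints_subset /A; apply/fintype.subsetP => y.
  by rewrite !in_setD in_setC in_setD !in_setU negb_or => /andP[/andP[/negbTE-> _] _]; rewrite andbF.
rewrite cardsU (disjoint_setI0 hdis) cards0 subn0; lia.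
Qed.

Definition joins Ga m := forall S T : {set V}, m < #|S| -> 2 * #|T| <= #|V| ->
  exists s w, [/\ s \in S, w \notin T & adj Ga s w].

Lemma joins_nbs Ga m S : joins Ga m -> m < #|S| -> #|V| < 2 * #|nbs Ga S|.
Proof.
move=> hj hS; rewrite ltnNge; apply/negP => hT.
have [s [w [hs hw hadj]]] := hj S _ hS hT.
by case/negP: hw; apply/bigcupP; exists s; rewrite ?inE.
Qed.

(** A set of more than [m] vertices has more than n / 2 neighbours; removing at most n / 6 vertices
    leaves n / 3, which is twice n / 6. *)
Lemma expands_joins Ga m k : expands Ga m -> joins Ga m -> 6 * k <= #|V| -> expands Ga k.
Proof.
move=> hexp hj hk S S0 hS; have [hm|hm] := leqP #|S| m; first exact: hexp.
have := joins_nbs hj hm; rewrite cardsD; have := subset_leq_card (subsetIr (nbs Ga S) S); lia.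
Qed.

(** A non-empty neighbour-closed set has more than n / 2 vertices, and the complement of a
    neighbour-closed set is neighbour-closed as well. *)
Lemma expands_connected D Ga m : Ga \subset D -> expands Ga m -> joins Ga m -> connected D.
Proof.
move=> sD hexp hj.
have big C : C != set0 -> nbs D C \subset C -> #|V| < 2 * #|C|.
  move=> hC hsub.
  have hsubG : nbs Ga C \subset C.
    apply: subset_trans hsub; apply/bigcupsP => v hv; apply: (bigcup_max v) => //.
    exact: nb_sub.
  have [hm|hm] := leqP #|C| m; last first.
    by have := joins_nbs hj hm; have := subset_leq_card hsubG; lia.
  have := hexp C hC hm; move: hsubG; rewrite -setD_eq0 => /eqP->.
  by rewrite cards0 leqn0 muln_eq0 /= cards_eq0 (negbTE hC).
move=> C hC hsub; apply/eqP; rewrite -[_ == _]negbK; apply/negP => hT.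
have hC' : ~: C != set0 by apply: contra hT => /eqP h; rewrite -(setCK C) h setC0.
have := big C hC hsub; have := cardsC C.
suff /(big _ hC') : nbs D (~: C) \subset ~: C by lia.
apply/bigcupsP => v; rewrite inE => hv; apply/fintype.subsetP => u; rewrite !inE => hadj.
apply: contra hv => hu; apply: (fintype.subsetP hsub); apply/bigcupP; exists u => //.
by rewrite inE adjC.
Qed.

End Expansion.

(** * The deterministic part of the proof *)

Section Core.
Variables (R : realType) (V : finType).
Implicit Types (G H D Ga : graph V) (x y t u v w : V) (S U L : {set V}).

(* [dat] assigns to a sparse graph a set [S] of vertices and a set [W s] for each
   [s] in [S]; on average, the vertices [s] of [S] have a proportion of at most
   [theta] - const of their neighbours in [W s]. *)
Definition spread (I : finType) (dat : graph V -> I -> {set V} * (V -> {set V}))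
    (theta omega c gamma kappa : R) G := forall Ga i,
  let S := (dat Ga i).1 in let W := (dat Ga i).2 in
  Ga \subset G -> (#|Ga|%:R <= gamma * #|G|%:R)%R ->
  (c * #|V|%:R <= #|S|%:R)%R ->
  (forall s, s \in S -> #|W s|%:R <= omega * #|V|%:R)%R ->
  (kappa * #|G|%:R <=
   \sum_(s in S) (theta * #|nb G s|%:R - #|nb G s :&: W s|%:R))%R.

Definition dat_pre (Ga : graph V) (i : V * {set V}) :=
  (ends Ga i.1, fun s => pre_ends Ga i.1 s i.2).

(** For the closing edge: an edge of D from [x] to the complement of this [W x] joins the two ends
    of a longest path. *)
Definition dat_ends (omega : R) (Ga : graph V) (_ : unit) :=
  ([set x | omega * #|V|%:R < #|ends Ga x|%:R]%R, fun x => ~: ends Ga x).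

(** For [joins] and for the maximum cut. As [Ga] is ignored, it is used with [gamma] = 0, which
    leaves only the empty [Ga]. *)
Definition dat_sets (Ga : graph V) (i : {set V} * {set V}) :=
  (i.1, fun _ : V => i.2).

Definition boundary D S (W : V -> {set V}) : graph V :=
  [set e in D | [exists s in S, [exists w, (w \notin W s) && (val e == [set s; w])]]].

Lemma boundaryP D S W e : e \in boundary D S W ->
  exists s w, [/\ e \in D, s \in S, w \notin W s & val e = [set s; w]].
Proof.
rewrite inE => /andP[he /existsP[s /andP[hs /existsP[w /andP[hw /eqP hv]]]]].
by exists s, w.
Qed.

(** At each [s], the edges of D that avoid [W s] number at least theta deg_G(s) minus the G-edges
    into [W s], whatever H is. The factor 2 accounts for edges counted from both ends. *)
Lemma spread_boundary theta D G S W (X : R) : D \subset G ->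
  (forall v, theta * #|nb G v|%:R <= #|nb D v|%:R)%R ->
  (X <= \sum_(s in S) (theta * #|nb G s|%:R - #|nb G s :&: W s|%:R))%R ->
  (X <= 2 * #|boundary D S W|%:R)%R.
Proof.
move=> sDG hD hX; apply: (le_trans hX).
have h : \sum_(s in S) #|nb D s :\: W s| <= 2 * #|boundary D S W|.
  apply: (@sum_nb_edges _ D) => [v hv|e s u he hs hu hv]; first exact: subsetDl.
  rewrite inE he; apply/existsP; exists s; rewrite hs; apply/existsP; exists u.
  by move: hu; rewrite inE hv eqxx andbT => /andP[].
apply: (@le_trans _ _ ((\sum_(s in S) #|nb D s :\: W s|)%:R)%R); last first.
  by rewrite -(natrM _ 2) ler_nat.
rewrite natr_sum; apply: ler_sum => s _; rewrite cardsD natrB ?subset_leq_card ?subsetIl //.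
apply: lerB => //; rewrite ler_nat; apply/subset_leq_card/setSI; exact: nb_sub.
Qed.

Theorem resilient_core G D (theta omega gamma kappa kappa' c : R) L (k m K K' : nat) :
  2 < #|V| -> D \subset G ->
  (forall v, theta * #|nb G v|%:R <= #|nb D v|%:R)%R ->
  (1 / 2 <= omega)%R -> (0 < kappa <= 1)%R -> (0 < kappa' <= 1)%R ->
  (c * #|V|%:R <= m.+1%:R)%R -> (0 < k)%N ->
  spread dat_pre theta omega (1 / 6) gamma kappa G ->
  spread (dat_ends omega) theta omega (1 / 6) gamma kappa G ->
  spread dat_sets theta omega c 0 kappa' G ->
  separated G L ->
  (forall v, v \in L -> k <= #|nb D v|) -> (forall v, v \notin L -> 2 <= #|nb D v|) ->
  (forall U, U != set0 -> #|U| <= 7 * m -> 14 * #|edges_in G U| < k * #|U|) ->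
  ((#|V| * (k + 2) + K' + #|V| + K)%:R <= gamma * #|G|%:R)%R ->
  (#|{: V * {set V}}|%:R * (1 - kappa / 2) ^+ K < 1)%R ->
  (#|{: {set V} * {set V}}|%:R * (1 - kappa' / 2) ^+ K' < 1)%R ->
  hamiltonian D.
Proof.
move=> n3 sDG hD hom /andP[ka0 ka1] /andP[kb0 kb1] hc k0 sp1 sp2 sp3 hsep hL hnL hsparse.
move=> hsize hK hK'.
have [x0 _] : exists x : V, x \in [set: V] by apply/card_gt0P; rewrite cardsT; exact: ltn_trans n3.
have D0 : 0 < #|D|.
  have : 0 < #|nb D x0|.
    by case: (boolP (x0 \in L)) => h; [apply: leq_trans (hL _ h)|apply: leq_trans (hnL _ h)].
  by case/card_gt0P => y; rewrite inE => /adjP[e he _]; apply/card_gt0P; exists e.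
have DG : (#|D|%:R <= #|G|%:R :> R)%R by rewrite ler_nat subset_leq_card.
have G0 : (0 < #|G|%:R :> R)%R by apply: lt_le_trans DG; rewrite ltr0n.
have choiceC v : exists B : {set V}, (B \subset nb D v) /\ #|B| = if v \in L then k else 2.
  have [|B h1 h2] := @ex_subset_card _ (nb D v) (if v \in L then k else 2); last by exists B.
  by case: ifPn => h; [exact: hL|exact: hnL].
have [C hC] := choice choiceC.
pose Ga0 : graph V := \bigcup_(v in [set: V]) \bigcup_(u in C v) pe v u.
have hCD v u : u \in C v -> adj D v u.
  by move=> hu; have := fintype.subsetP (hC v).1 _ hu; rewrite inE.
have Ga0D : Ga0 \subset D.
  by apply/bigcupsP => v _; apply/bigcupsP => u hu; exact/adj_pe_sub/hCD.
have hC0 v u : u \in C v -> adj Ga0 v u.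
  move=> hu; apply: pe_adj; first exact: adj_neq (hCD _ _ hu).
  by apply: (bigcup_max v) => //; apply: (bigcup_max u).
have cGa0 : #|Ga0| <= #|V| * (k + 2).
  apply: leq_trans (card_bigcup_pe _ _) _; rewrite -cardsT -sum_nat_const.
  by apply: leq_sum => v _; rewrite (hC v).2; case: ifP => _; rewrite ?leq_addr ?leq_addl.
pose A3 := [set i : {set V} * {set V} | (m < #|i.1|) && (2 * #|i.2| <= #|V|)].
have bd3 i : i \in A3 -> (kappa' * #|G|%:R <= 2 * #|boundary D i.1 (fun=> i.2)|%:R)%R.
  rewrite inE => /andP[hS hT]; apply: (spread_boundary sDG hD).
  apply: (sp3 set0 i); rewrite ?sub0set ?cards0 ?mul0r //=.
    by apply: le_trans hc _; rewrite ler_nat.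
  move=> s _; have : ((2 * #|i.2|)%:R <= #|V|%:R :> R)%R by rewrite ler_nat.
  have : (0 <= #|V|%:R :> R)%R by rewrite ler0n.
  rewrite natrM; nra.
(* Each boundary contains a proportion of at least [kappa' / 2] of the edges of D, because D has at
   most as many edges as G. *)
have [h3 [h3D ch3 hit3]] : exists h : {set edge V}, [/\ h \subset D, #|h| <= K' &
    forall i, i \in A3 -> boundary D i.1 (fun=> i.2) :&: h != set0].
  apply: (@hitting_set R _ _ A3 D _ (kappa' / 2) K') => //.
  - by apply/andP; split; lra.
  - by move=> i _; apply/fintype.subsetP => e; rewrite inE => /andP[].
  - move=> i /bd3; have : (0 <= kappa' * (#|G|%:R - #|D|%:R))%R by apply: mulr_ge0; lra.
    lra.
  - apply: le_lt_trans hK'; apply: ler_wpM2r; first by apply: exprn_ge0; lra.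
    by rewrite ler_nat max_card.
pose Ga1 := Ga0 :|: h3.
have Ga1D : Ga1 \subset D by rewrite subUset Ga0D.
have joins1 : joins Ga1 m.
  move=> S T hS hT; have /set0Pn[e /setIP[heb heh]] : boundary D S (fun=> T) :&: h3 != set0.
    by apply: (hit3 (S, T)); rewrite inE hS.
  have [s [w [_ hs hw hv]]] := boundaryP heb; exists s, w; split=> //.
  by apply/adjP; exists e; rewrite // inE heh orbT.
have exp1m : expands Ga1 m.
  apply: (expansion_small (subset_trans Ga1D sDG) hsep (C := C) (k := k)) => //.
  - by move=> v u hu; apply: adj_sub (subsetUl _ _) _; exact: hC0.
  - by move=> v hv; rewrite (hC v).2 hv.
  - by move=> v hv; rewrite (hC v).2 (negbTE hv).
have conn : connected D by exact: expands_connected Ga1D exp1m joins1.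
pose k6 := #|V| %/ 6.
have exp1 : expands Ga1 k6 by apply: (expands_joins exp1m joins1); rewrite mulnC leq_trunc_div.
have [p0 hp0] := ex_longest D.
have /andP[pp0 /eqP sp0] := hp0.
have [peD pep cpe] := path_edgesP pp0.
(* With a longest path of D inside, [Ga2] has the same [maxlen] as D. From here on, an edge of D
   cannot leave a longest path of the sparse graph at its end. *)
pose Ga2 := Ga1 :|: path_edges p0.
have Ga2D : Ga2 \subset D by rewrite subUset Ga1D.
have max2 : maxlen Ga2 = maxlen D.
  apply/eqP; rewrite eqn_leq maxlen_sub //= -sp0; apply: is_path_maxlen.
  by apply: is_path_sub pep; exact: subsetUr.
have exp2 : expands Ga2 k6.
  move=> S S0 hS; apply: leq_trans (exp1 S S0 hS) _; apply/subset_leq_card/setSD.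
  apply/bigcupsP => v hv; apply: (bigcup_max v) => //; apply: nb_sub; exact: subsetUl.
have c2 : #|Ga2| <= #|V| * (k + 2) + K' + #|V|.
  apply: leq_trans (leq_card_setU _ _) _; apply: leq_add => //.
  by apply: leq_trans (leq_card_setU _ _) _; apply: leq_add.
have k6R (A : {set V}) : k6 < #|A| -> (1 / 6 * #|V|%:R <= #|A|%:R :> R)%R.
  move=> hA; have : #|V| <= 6 * #|A|.
    by rewrite mulnC; apply: ltnW; apply: leq_trans (ltn_ceil _ (isT : 0 < 6)) _; rewrite leq_mul2r.
  by rewrite -(ler_nat R) natrM; lra.
(* The set [T] of interest is [ends Ga3 x], which depends on the edges [h1] still to be chosen;
   hence [h1] has to serve all sets [T] that are not too large. *)
pose A1 := [set i : V * {set V} |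
  (k6 < #|ends Ga2 i.1|) && (#|i.2|%:R <= omega * #|V|%:R)%R].
have bd1 i : i \in A1 -> (kappa * #|G|%:R <=
    2 * #|boundary D (ends Ga2 i.1) (fun s => pre_ends Ga2 i.1 s i.2)|%:R)%R.
  rewrite inE => /andP[hS hT]; apply: (spread_boundary sDG hD).
  apply: (sp1 Ga2 i); rewrite ?(subset_trans Ga2D) //=.
  - by apply: le_trans hsize; rewrite ler_nat; apply: leq_trans c2 _; exact: leq_addr.
  - exact: k6R.
  - by move=> s _; apply: le_trans hT; rewrite ler_nat card_pre_ends.
have [h1 [h1D ch1 hit1]] : exists h : {set edge V}, [/\ h \subset D, #|h| <= K &
    forall i, i \in A1 ->
      boundary D (ends Ga2 i.1) (fun s => pre_ends Ga2 i.1 s i.2) :&: h != set0].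
  apply: (@hitting_set R _ _ A1 D _ (kappa / 2) K) => //.
  - by apply/andP; split; lra.
  - by move=> i _; apply/fintype.subsetP => e; rewrite inE => /andP[].
  - move=> i /bd1; have : (0 <= kappa * (#|G|%:R - #|D|%:R))%R by apply: mulr_ge0; lra.
    lra.
  - apply: le_lt_trans hK; apply: ler_wpM2r; first by apply: exprn_ge0; lra.
    by rewrite ler_nat max_card.
pose Ga3 := Ga2 :|: h1.
have Ga3D : Ga3 \subset D by rewrite subUset Ga2D.
have sub23 : Ga2 \subset Ga3 by exact: subsetUl.
have max3 : maxlen Ga3 = maxlen D.
  apply/eqP; rewrite eqn_leq maxlen_sub //= -max2; exact: maxlen_sub.
(* If [ends Ga3 x] were small, [h1] would contain an edge from some [s] to a vertex outside its
   [pre_ends], and rotating by it would give an end in [Ga3] that is not in [ends Ga3 x]. *)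
have big3 x : k6 < #|ends Ga2 x| -> (omega * #|V|%:R < #|ends Ga3 x|%:R)%R.
  move=> hx; rewrite ltNge; apply/negP => hT.
  have /set0Pn[e /setIP[heb heh]] : boundary D (ends Ga2 x)
      (fun s => pre_ends Ga2 x s (ends Ga3 x)) :&: h1 != set0.
    by apply: (hit1 (x, ends Ga3 x)); rewrite inE hx.
  have [s [w [_ hs /negP hw hv]]] := boundaryP heb; apply: hw.
  apply: pre_ends_mem => //; first by rewrite max2 max3.
  by apply/adjP; exists e; rewrite // inE heh orbT.
have hbd : (kappa * #|G|%:R <= 2 * #|boundary D (dat_ends omega Ga3 tt).1
    (dat_ends omega Ga3 tt).2|%:R)%R.
  apply: (spread_boundary sDG hD); apply: (sp2 Ga3 tt); rewrite ?(subset_trans Ga3D) //=.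
  - apply: le_trans hsize; rewrite ler_nat; apply: leq_trans (leq_card_setU _ _) _.
    exact: leq_add.
  - apply: k6R; apply: leq_trans (posa_starts x0 exp2) _.
    by apply/subset_leq_card/fintype.subsetP => x; rewrite !inE; exact: big3.
  - move=> x; rewrite inE => hx; have := cardsC (ends Ga3 x).
    move/(congr1 (fun z : nat => z%:R%R : R)); rewrite natrD.
    have : (0 <= (omega - 1 / 2) * #|V|%:R)%R by apply: mulr_ge0; rewrite ?ler0n // subr_ge0.
    lra.
have : 0 < #|boundary D (dat_ends omega Ga3 tt).1 (dat_ends omega Ga3 tt).2|.
  rewrite -(ltr0n R); have : (0 < kappa * #|G|%:R)%R by apply: mulr_gt0.
  lra.
case/card_gt0P => e /boundaryP[x [t [he /= _]]]; rewrite inE negbK => ht hv.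
have hxt : adj D x t by apply/adjP; exists e.
case/endsP: ht => p [/andP[hp /eqP hsz] hhd hlast].
apply: (@longest_close _ D p x) => //; last by rewrite hlast adjC.
by rewrite /longest (is_path_sub Ga3D hp) hsz max3 /=.
Qed.

End Core.

(** * Maximum cuts *)

Section MaxCut.
Variables (V : finType).
Implicit Types (G H D Ga : graph V) (x y t u v w : V) (S U L A B : {set V}).

Lemma adj_filter G (P : pred {set V}) x y :
  adj [set e in G | P (val e)] x y = adj G x y && P [set x; y].
Proof.
apply/adjP/andP => [[e]|[/adjP[e he hv] hP]].
  by rewrite inE => /andP[he hP] hv; split; [apply/adjP; exists e|rewrite -hv].
by exists e; rewrite // inE he hv.
Qed.

Definition cross G A x y : nat := adj G x y && ((x \in A) (+) (y \in A)).

Definition cut_size G A := \sum_x \sum_y cross G A x y.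

Definition flip A v : {set V} := [set x | (x \in A) (+) (x == v)].

Lemma crossC G A x y : cross G A x y = cross G A y x.
Proof. by rewrite /cross adjC addbC. Qed.

(** Isolates the pairs at [v], the only ones affected by flipping [v]; the factor 2 arises because
    [cut_size] runs over ordered pairs. *)
Lemma cut_size_split G A v : cut_size G A =
  2 * (\sum_y cross G A v y) + \sum_(x | x != v) \sum_(y | y != v) cross G A x y.
Proof.
have hv : cross G A v v = 0 by rewrite /cross adjxx.
rewrite /cut_size (bigD1 v) //= mulSn mul1n -addnA; congr (_ + _).
under eq_bigr do rewrite (bigD1 v) //=.
rewrite big_split /=; congr (_ + _); rewrite [RHS](bigD1 v) //= hv add0n.
by apply: eq_bigr => x _; rewrite crossC.
Qed.

Lemma ex_max_cut G : exists A, forall v,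
  #|nb G v :&: [set u | (u \in A) == (v \in A)]| <=
  #|nb G v :&: [set u | (u \in A) != (v \in A)]|.
Proof.
case: (@arg_maxnP _ set0 predT (cut_size G) isT) => A _ hA; exists A => v.
have : cut_size G (flip A v) <= cut_size G A by exact: hA.
rewrite (cut_size_split G (flip A v) v) (cut_size_split G A v).
have -> : \sum_(x | x != v) \sum_(y | y != v) cross G (flip A v) x y =
          \sum_(x | x != v) \sum_(y | y != v) cross G A x y.
  apply: eq_bigr => x hx; apply: eq_bigr => y hy.
  by rewrite /cross !inE (negbTE hx) (negbTE hy) !addbF.
rewrite leq_add2r leq_pmul2l //.
have sumE (P : pred V) (f : V -> nat) : (forall u, f u = adj G v u && P u :> nat) ->
    \sum_u f u = #|nb G v :&: [set u | P u]|.
  move=> hf; rewrite -sum1_card [RHS]big_mkcond; apply: eq_bigr => u _.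
  by rewrite hf !inE; case: (_ && _).
rewrite (sumE (fun u => (u \in A) == (v \in A))); last first.
  move=> u; rewrite /cross !inE eqxx addbT; case: (eqVneq u v) => [->|huv].
    by rewrite adjxx.
  by rewrite addbF; case: (u \in A); case: (v \in A).
rewrite (sumE (fun u => (u \in A) != (v \in A))) //.
by move=> u; rewrite /cross; case: (u \in A); case: (v \in A).
Qed.

(** Ensures that a Hamilton cycle does not traverse the exceptional edge of [hamiltonian_card] in
    both directions. *)
Lemma next_next (c : seq V) x : uniq c -> 2 < size c -> x \in c -> next c (next c x) != x.
Proof.
move=> uc sc xc; rewrite -!(next_rot (index x c) uc) (rot_index xc).
have : uniq (rot (index x c) c) by rewrite rot_uniq.
have : 2 < size (rot (index x c) c) by rewrite size_rot.
rewrite (rot_index xc); case: (drop _ _ ++ _) => [//|y [//|z s]] _.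
rewrite /= !inE !negb_or => /andP[/and3P[hxy hxz hxs] _].
have hyx : (y == x) = false by rewrite eq_sym; exact/negbTE.
by rewrite !eqxx ?hyx ?eqxx /= eq_sym hxz.
Qed.

(* Along a Hamilton cycle the successor maps all of [B], except for at most one of the
   ends of the edge [b0 b1], injectively into the complement of [B]. *)
Lemma hamiltonian_card D B b0 b1 : hamiltonian D ->
  (forall x y, x \in B -> y \in B -> adj D x y -> (x, y) = (b0, b1) \/ (x, y) = (b1, b0)) ->
  #|B| <= #|~: B| + 1.
Proof.
case=> c [c3 uc cc hall] hB; pose f := next c.
have fadj x : adj D x (f x) by exact: next_cycle.
have finj : injective f by exact: can_inj (prev_next uc).
have ff x : f (f x) != x by exact: next_next.
pose Z := [set x in B | f x \in B].
have cZ : #|Z| <= 1.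
  apply/card_le1P => x; rewrite inE => /andP[hx hfx] y; rewrite !inE.
  apply/idP/eqP => [/andP[hy hfy]|->]; last by rewrite hx hfx.
  have [[hx1 hx2]|[hx1 hx2]] := hB _ _ hx hfx (fadj x);
    have [[hy1 hy2]|[hy1 hy2]] := hB _ _ hy hfy (fadj y);
    rewrite ?hx1 ?hy1 //.
  - by have := ff x; rewrite hx2 -hy1 hy2 hx1 eqxx.
  - by have := ff x; rewrite hx2 -hy1 hy2 hx1 eqxx.
have : #|f @: (B :\: Z)| <= #|~: B|.
  apply/subset_leq_card/fintype.subsetP => y /imsetP[x hx ->]; rewrite inE.
  by move: hx; rewrite !inE; case: (x \in B) => //=; rewrite andbT.
rewrite (card_imset _ finj) cardsD.
have := subset_leq_card (subsetIr B Z); lia.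
Qed.

Lemma hamiltonian_card_indep D B : hamiltonian D ->
  (forall x y, x \in B -> y \in B -> ~~ adj D x y) -> #|B| <= #|~: B|.
Proof.
case=> c [c3 uc cc hall] hB; rewrite -(card_imset B (can_inj (prev_next uc))).
apply/subset_leq_card/fintype.subsetP => y /imsetP[x hx ->]; rewrite inE.
by apply/negP => hy; have := hB _ _ hx hy; rewrite (next_cycle cc).
Qed.

Lemma set2_sub S x y : ([set x; y] \subset S) = (x \in S) && (y \in S).
Proof. by rewrite subUset !sub1set. Qed.

End MaxCut.

(** * The upper bound on resilience *)

Section NotResilient.
Variables (R : realType) (V : finType).
Implicit Types (G H D Ga : graph V) (x y t u v w : V) (S U L A B : {set V}).

Theorem not_resilient_core G (eps omega kappa c : R) L : (0 < eps)%R ->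
  (1 / 2 <= omega)%R -> (0 < kappa)%R -> (c <= 1 / 2)%R -> (0 < #|G|)%N ->
  spread (@dat_sets V) (1 / 2 + eps) omega c 0 kappa G ->
  separated G L ->
  (forall v, v \in L -> 1 <= eps * (degree G v)%:R)%R ->
  ~ resiliently_hamiltonian (1 / 2 + eps)%R G.
Proof.
move=> eps0 hom ka0 hc G0 hsp hsep hL hres.
have [A hA] := ex_max_cut G.
have half v (X : {set V}) (z : nat) : #|X| <= #|nb G v :&: [set u | (u \in A) == (v \in A)]| + z ->
    (#|X|%:R <= 1 / 2 * (degree G v)%:R + z%:R :> R)%R.
  have hd : degree G v = #|nb G v :&: [set u | (u \in A) == (v \in A)]| +
       #|nb G v :&: [set u | (u \in A) != (v \in A)]|.
    rewrite degree_nb -(cardsID [set u | (u \in A) == (v \in A)]); congr (_ + _).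
    by apply: eq_card => u; rewrite !inE andbC.
  move=> hX; have : 2 * #|X| <= degree G v + 2 * z by have := hA v; lia.
  rewrite -(ler_nat R) natrD !natrM; lra.
have deg0 v : (0 <= eps * (degree G v)%:R)%R by apply: mulr_ge0; [exact: ltW|rewrite ler0n].
have [hbal|hunb] := eqVneq #|A| #|~: A|; last first.
  pose H : graph V := [set e in G | (val e \subset A) || (val e \subset ~: A)].
  have hadj x y : adj H x y = adj G x y && ((x \in A) == (y \in A)).
    rewrite (adj_filter G (fun s => (s \subset A) || (s \subset ~: A))) !set2_sub !inE.
    by case: (x \in A); case: (y \in A).
  have ham : hamiltonian (G :\: H).
    apply: hres => [|v]; first by apply/fintype.subsetP => e; rewrite inE => /andP[].
    rewrite [degree H v]degree_nb mulrDl; have := @half v (nb H v) 0; rewrite addr0.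
    have : #|nb H v| <= #|nb G v :&: [set u | (u \in A) == (v \in A)]| + 0.
      rewrite addn0; apply/subset_leq_card/fintype.subsetP => u; rewrite !inE hadj.
      by rewrite [(v \in A) == _]eq_sym.
    move=> h /(_ h) h1; have := deg0 v; lra.
  have h1 : #|A| <= #|~: A|.
    apply: (hamiltonian_card_indep ham) => x y hx hy.
    by rewrite adjD hadj hx hy /= andbT andbN.
  have h2 : #|~: A| <= #|A|.
    rewrite -{2}(setCK A); apply: (hamiltonian_card_indep ham) => x y hx hy.
    rewrite !inE in hx hy.
    by rewrite adjD hadj (negbTE hx) (negbTE hy) /= andbT andbN.
  by case/negP: hunb; rewrite eqn_leq h1 h2.
(* Otherwise all terms of the sum in [spread] for S = A and W = ~: A would be negative. Both classes
   have n / 2 vertices, so [spread] applies. *)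
have [v vA hv] : exists2 v, v \in A &
    (#|nb G v :&: ~: A|%:R <= (1 / 2 + eps) * (degree G v)%:R :> R)%R.
  have [//|hno] := pselect (exists2 v, v \in A &
    (#|nb G v :&: ~: A|%:R <= (1 / 2 + eps) * (degree G v)%:R :> R)%R).
  have hn : (#|V|%:R = 2 * #|A|%:R :> R)%R.
    by rewrite -(cardsC A) -hbal natrD; lra.
  have n0 : (0 <= #|V|%:R :> R)%R by rewrite ler0n.
  have hle : (kappa * #|G|%:R <= \sum_(s in A)
      ((1 / 2 + eps) * #|nb G s|%:R - #|nb G s :&: ~: A|%:R))%R.
    apply: (hsp set0 (A, ~: A)); rewrite ?sub0set ?cards0 ?mul0r //=.
      have : (0 <= (1 / 2 - c) * #|V|%:R)%R by apply: mulr_ge0; lra.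
      lra.
    move=> s _; rewrite -hbal.
    have : (0 <= (omega - 1 / 2) * #|V|%:R)%R by apply: mulr_ge0; lra.
    lra.
  have : (\sum_(s in A) ((1 / 2 + eps) * #|nb G s|%:R - #|nb G s :&: ~: A|%:R) <= 0 :> R)%R.
    apply: sumr_le0 => s hs; rewrite subr_le0 leNgt; apply/negP => hlt.
    by case: hno; exists s => //; rewrite degree_nb ltW.
  have : (0 < kappa * #|G|%:R)%R by apply: mulr_gt0; rewrite ?ltr0n.
  lra.
pose A' := A :\ v; pose B' := v |: ~: A.
(* The edges inside [A'] and [B'] are deleted, except those from [v] to vertices outside [L]: a
   vertex of low degree may be unable to afford one deletion beyond half of its degree, whereas at a
   vertex of [L] it is covered by [eps]. *)
pose P (s : {set V}) := (s \subset A') ||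
  ((s \subset B') && ~~ [exists u, (u \notin L) && (s == [set v; u])]).
pose H : graph V := [set e in G | P (val e)].
have hadj x y : adj H x y = adj G x y && P [set x; y] by exact: (adj_filter G P).
have inB x : x \in B' = (x \notin A') by rewrite !inE; case: eqVneq => //=.
have ham : hamiltonian (G :\: H).
  apply: hres => [|s]; first by apply/fintype.subsetP => e; rewrite inE => /andP[].
  rewrite [degree H s]degree_nb; case: (eqVneq s v) => [->|hsv].
    apply: le_trans hv; rewrite ler_nat; apply/subset_leq_card/fintype.subsetP => u.
    rewrite !inE hadj /P !set2_sub => /andP[huv /orP[|/andP[/andP[_ hu] _]]].
      by rewrite !inE eqxx.
    by rewrite huv /=; move: hu; rewrite !inE eq_sym (negbTE (adj_neq huv)).
  have [hsA|hsA] := boolP (s \in A).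
    rewrite mulrDl; have := @half s (nb H s) 0; rewrite addr0.
    have : #|nb H s| <= #|nb G s :&: [set u | (u \in A) == (s \in A)]| + 0.
      rewrite addn0; apply/subset_leq_card/fintype.subsetP => u; rewrite !inE hadj hsA.
      rewrite /P !set2_sub !inE (negbTE hsv) hsA /= => /andP[->].
      by case: (u \in A); rewrite ?andbF ?orbF.
    move=> h /(_ h) h1; have := deg0 s; lra.
  have [hsL|hsL] := boolP (s \in L).
    rewrite mulrDl; have := @half s (nb H s) 1.
    have : #|nb H s| <= #|nb G s :&: [set u | (u \in A) == (s \in A)]| + 1.
      apply: (@leq_trans #|(nb G s :&: [set u | (u \in A) == (s \in A)]) :|: [set v]|).
        apply/subset_leq_card/fintype.subsetP => u; rewrite !inE hadj (negbTE hsA).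
        rewrite /P !set2_sub !inE (negbTE hsv) (negbTE hsA) /= => /andP[-> /andP[h _]].
        by case/orP: h => [->|/negbTE->]; rewrite ?orbT.
      by rewrite (leq_trans (leq_card_setU _ _)) // cards1.
    move=> h /(_ h) h1; have := hL s hsL; lra.
  rewrite mulrDl; have := @half s (nb H s) 0; rewrite addr0.
  have : #|nb H s| <= #|nb G s :&: [set u | (u \in A) == (s \in A)]| + 0.
    rewrite addn0; apply/subset_leq_card/fintype.subsetP => u; rewrite !inE hadj.
    rewrite /P !set2_sub !inE (negbTE hsv) (negbTE hsA) /= => /andP[-> /andP[h hex]].
    case: (eqVneq u v) h hex => [->|] _ /=; last by move=> /negbTE->.
    by move=> /existsP[]; exists s; rewrite hsL setUC eqxx.
  move=> h /(_ h) h1; have := deg0 s; lra.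
(* Two low-degree neighbours of [v] would be at distance 2, so at most one edge inside [B']
   survives. *)
have [u0 hu0] : exists u0, forall u, u \notin L -> adj G v u -> u = u0.
  have [[u [hu huv]]|hno] := pselect (exists u, u \notin L /\ adj G v u).
    exists u => w hw hwv; have [//|hne] := eqVneq w u; exfalso.
    by apply: (hsep w u [:: v; u]) => //=; rewrite adjC hwv huv.
  by exists v => u hu huv; case: hno; exists u.
(* The classes [B'] and [A'] differ by two in size, but a single edge inside [B'] compensates only
   for one. *)
have := @hamiltonian_card _ (G :\: H) B' v u0 ham.
have -> : #|~: B'| = #|A'| by apply: eq_card => x; rewrite !inE; case: eqVneq => //=; rewrite negbK.
have -> : #|B'| = #|A| + 1 by rewrite /B' cardsU1 !inE vA hbal addnC.
have cA : #|A| = #|A'| + 1 by rewrite (cardsD1 v A) vA addnC.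
suff key : forall x y, x \in B' -> y \in B' -> adj (G :\: H) x y ->
    (x, y) = (v, u0) \/ (x, y) = (u0, v).
  by move=> /(_ key); rewrite cA; lia.
move=> x y hx hy; rewrite adjD hadj; case: (boolP (adj G x y)) => //= hxy.
rewrite /P !set2_sub hx hy negb_or /= negbK => /andP[_ /existsP[u /andP[huL /eqP hs]]].
have : x \in [set v; u] by rewrite -hs !inE eqxx.
have : y \in [set v; u] by rewrite -hs !inE eqxx orbT.
rewrite !inE => /orP[]/eqP hy' /orP[]/eqP hx'; move: hxy; rewrite hx' hy' ?adjxx //.
- by rewrite adjC => /(hu0 _ huL)->; right.
- by move=> /(hu0 _ huL)->; left.
Qed.

End NotResilient.

Local Open Scope ring_scope.
(** * Random orders and independent labels *)

Section RandomOrder.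
Variables (R : realType) (T : finType).
Implicit Types (sigma tau : {perm T}) (E : {set T}).

(** A permutation serves as an order: [e] has position [enum_rank (sigma e)]. *)
Definition first sigma (M : nat) : {set T} := [set e | (enum_rank (sigma e) < M)%N].

Definition pr (A : pred {perm T}) : R := #|[set sigma | A sigma]|%:R / #|{: {perm T}}|%:R.

Lemma card_perm_gt0 : 0 < #|{: {perm T}}|%:R :> R.
Proof. by rewrite ltr0n; apply/card_gt0P; exists 1%g. Qed.

Lemma pr_ge0 (A : pred {perm T}) : 0 <= pr A.
Proof. by rewrite divr_ge0. Qed.

Lemma pr_le (A B : pred {perm T}) : (forall s, A s -> B s) -> pr A <= pr B.
Proof.
move=> h; rewrite ler_pM2r ?invr_gt0 ?card_perm_gt0 // ler_nat; apply/subset_leq_card.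
by apply/fintype.subsetP => s; rewrite !inE; exact: h.
Qed.

Lemma pr_le1 (A : pred {perm T}) : pr A <= 1.
Proof. by rewrite ler_pdivrMr ?card_perm_gt0 // mul1r ler_nat max_card. Qed.

Lemma pr_predC (A : pred {perm T}) : pr (predC A) = 1 - pr A.
Proof.
have h : #|[set s | A s]|%:R + #|[set s | ~~ A s]|%:R = #|{: {perm T}}|%:R :> R.
  rewrite -natrD -(cardsC [set s | A s]); congr (_ + _)%:R.
  by apply: eq_card => s; rewrite !inE.
have := card_perm_gt0; rewrite /pr /= -h => hh; field; lra.
Qed.

Lemma pr_or (A B : pred {perm T}) : pr (fun s => A s || B s) <= pr A + pr B.
Proof.
rewrite -mulrDl ler_pM2r ?invr_gt0 ?card_perm_gt0 // -natrD ler_nat.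
apply: leq_trans (leq_card_setU _ _); apply: subset_leq_card.
by apply/fintype.subsetP => s; rewrite !inE.
Qed.

Lemma pr_exists (J : Type) (r : seq J) (A : J -> pred {perm T}) :
  pr (fun s => has (fun j => A j s) r) <= \sum_(j <- r) pr (A j).
Proof.
elim: r => [|j r IH] /=.
  rewrite big_nil /pr (_ : #|_| = 0%N) ?mul0r //.
  by apply/eqP; rewrite cards_eq0; apply/eqP/setP => s; rewrite !inE.
rewrite big_cons; apply: le_trans (pr_or _ _) _; exact: lerD.
Qed.

Lemma pr_mulr (A : pred {perm T}) tau : pr (fun s => A (s * tau)%g) = pr A.
Proof.
congr (_%:R / _); rewrite -(card_imset [set s | A (s * tau)%g] (mulIg tau)).
apply: eq_card => s; rewrite inE; apply/imsetP/idP => [[s']|hA].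
  by rewrite inE => hA ->.
by exists (s * tau^-1)%g; rewrite ?inE mulgKV.
Qed.

Lemma first_sub sigma M M' : (M <= M')%N -> first sigma M \subset first sigma M'.
Proof. by move=> h; apply/fintype.subsetP => e; rewrite !inE => /leq_trans; apply. Qed.

Lemma first0 sigma : first sigma 0 = set0.
Proof. by apply/setP => e; rewrite !inE. Qed.

Lemma firstS sigma M : (M < #|T|)%N ->
  exists e, e \notin first sigma M /\ first sigma M.+1 = e |: first sigma M.
Proof.
move=> hM; pose e := (sigma^-1)%g (enum_val (Ordinal hM)); exists e.
have he : enum_rank (sigma e) = M :> nat by rewrite permKV enum_valK.
split; first by rewrite inE he ltnn.
apply/setP => x; rewrite !inE ltnS leq_eqVlt; congr (_ || _).
rewrite -he; apply/eqP/eqP => [/val_inj/enum_rank_inj/perm_inj//|->//].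
Qed.

Lemma card_first sigma M : (M <= #|T|)%N -> #|first sigma M| = M.
Proof.
elim: M => [|M IH] hM; first by rewrite first0 cards0.
by have [e [he ->]] := firstS sigma hM; rewrite cardsU1 he IH ?add1n // ltnW.
Qed.

(** The order lists [E0], then the rest of [E1], then everything else. *)
Lemma ex_first E0 E1 : E0 \subset E1 ->
  exists tau, E0 = first tau #|E0| /\ E1 = first tau #|E1|.
Proof.
move=> hE; pose s := enum E0 ++ (enum (E1 :\: E0) ++ enum (~: E1)).
have us : uniq s.
  rewrite /s !cat_uniq !enum_uniq /= andbT; apply/andP; split.
    apply/hasPn => x; rewrite mem_cat !mem_enum => /orP[]; rewrite !inE; first by case/andP.
    by apply: contra => /(fintype.subsetP hE).
  by apply/hasPn => x; rewrite !mem_enum !inE negb_and => ->; rewrite orbT.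
have ms x : x \in s.
  rewrite /s !mem_cat !mem_enum !inE.
  by case: (x \in E0) => //=; case: (x \in E1).
have ss : size s = #|T|.
  by rewrite -(card_uniqP us); apply: eq_card => x; rewrite ms.
have hi x : (index x s < #|T|)%N by rewrite -ss index_mem.
pose f x := enum_val (Ordinal (hi x)).
have finj : injective f.
  move=> x y /enum_val_inj/(congr1 val)/= h.
  by rewrite -(nth_index x (ms x)) h nth_index.
exists (perm finj); split; apply/setP => x; rewrite inE permE /f enum_valK /=.
  rewrite /s index_cat mem_enum; case: ifP => h; last by rewrite -cardE ltnNge leq_addr.
  by rewrite cardE index_mem mem_enum h.
rewrite /s catA index_cat mem_cat !mem_enum.
have -> : #|E1| = size (enum E0 ++ enum (E1 :\: E0)).
  rewrite size_cat -!cardE -(cardsID E0 E1); congr (_ + _)%N.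
  by congr #|pred_of_set _|; apply/setIidPr.
rewrite !inE; case hx1: (x \in E1); case hx0: (x \in E0) => /=.
- by rewrite index_mem mem_cat mem_enum hx0.
- by rewrite index_mem mem_cat !mem_enum !inE hx1 hx0.
- by move: (fintype.subsetP hE _ hx0); rewrite hx1.
- by rewrite ltnNge leq_addr.
Qed.

(** * Independent labels and exponential moments *)

Section Labels.
Variables (K : finType) (wt : K -> R).
Hypothesis wt_ge0 : forall k, 0 <= wt k.
Implicit Types f : {ffun T -> K}.

Definition mass f : R := \prod_e wt (f e).

Definition label (k : pred K) f : {set T} := [set e | k (f e)].

Definition prl (A : pred {ffun T -> K}) : R := \sum_(f | A f) mass f.

Lemma mass_ge0 f : 0 <= mass f.
Proof. by apply: prodr_ge0. Qed.

Lemma prl_ge0 A : 0 <= prl A.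
Proof. by apply: sumr_ge0 => f _; exact: mass_ge0. Qed.

Lemma prl_le (A B : pred {ffun T -> K}) : (forall f, A f -> B f) -> prl A <= prl B.
Proof.
move=> h; rewrite /prl big_mkcond [leRHS]big_mkcond; apply: ler_sum => f _.
by case: ifP => [/h->//|_]; case: ifP => // _; exact: mass_ge0.
Qed.

Lemma prl_sum (A : pred {ffun T -> K}) : prl A = \sum_f mass f * (A f)%:R.
Proof.
rewrite /prl big_mkcond; apply: eq_bigr => f _.
by case: (A f); rewrite ?mulr1 ?mulr0.
Qed.

Lemma prl_exists (J : finType) (P : pred J) (A : J -> pred {ffun T -> K}) :
  prl (fun f => [exists j, P j && A j f]) <= \sum_(j | P j) prl (A j).
Proof.
rewrite prl_sum; under [leRHS]eq_bigr do rewrite prl_sum.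
rewrite [leRHS]exchange_big /=; apply: ler_sum => f _; rewrite -mulr_sumr.
apply: ler_wpM2l; first exact: mass_ge0.
case: existsP => [[j /andP[hj hA]]|_]; last by rewrite sumr_ge0.
by rewrite (bigD1 j) //= hA lerDl sumr_ge0.
Qed.

Lemma sum_mass_prod (g : T -> K -> R) :
  \sum_f mass f * \prod_e g e (f e) = \prod_e \sum_k wt k * g e k.
Proof.
by rewrite bigA_distr_bigA; apply: eq_bigr => f _; rewrite -big_split.
Qed.

(* The exponential moment method: [C * \prod_e g e (f e)] dominates the indicator. *)
Lemma prl_le_prod (A : pred {ffun T -> K}) (C : R) (g : T -> K -> R) :
  0 <= C -> (forall e k, 0 <= g e k) ->
  (forall f, A f -> 1 <= C * \prod_e g e (f e)) ->
  prl A <= C * \prod_e \sum_k wt k * g e k.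
Proof.
move=> C0 g0 h; rewrite prl_sum -sum_mass_prod mulr_sumr; apply: ler_sum => f _.
rewrite mulrCA; apply: ler_wpM2l; first exact: mass_ge0.
have := h f; case: (A f) => [/(_ isT)//|_]; apply: mulr_ge0 => //; exact: prodr_ge0.
Qed.

(** The law of the labels is invariant under permutations of [T], so one may average over all of
    them. If [tau] makes both label sets initial segments, their preimages under [s] are the initial
    segments of [s * tau], which is again uniform. *)
Lemma transfer (k0 k1 : pred K) (bad : {set T} -> {set T} -> bool) :
  (forall k, k0 k -> k1 k) ->
  prl (fun f => bad (label k0 f) (label k1 f)) =
  \sum_f mass f * pr (fun s => bad (first s #|label k0 f|) (first s #|label k1 f|)).
Proof.
move=> h01; rewrite prl_sum.
have hs (s : {perm T}) : \sum_f mass f * (bad (label k0 f) (label k1 f))%:R =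
    \sum_f mass f * (bad (s @^-1: label k0 f) (s @^-1: label k1 f))%:R.
  pose h (f : {ffun T -> K}) : {ffun T -> K} := [ffun e => f (s e)].
  have hbij : bijective h.
    exists (fun f : {ffun T -> K} => [ffun e => f ((s^-1)%g e)]) => f; apply/ffunP => e.
      by rewrite !ffunE permKV.
    by rewrite !ffunE permK.
  rewrite (reindex h) /=; last exact: onW_bij.
  apply: eq_bigr => f _; congr (_ * _).
    rewrite /mass [RHS](reindex_inj (@perm_inj _ s)) /=.
    by apply: eq_bigr => e _; rewrite ffunE.
  by congr (bad _ _)%:R; apply/setP => e; rewrite !inE ffunE.
have P0 := card_perm_gt0.
have -> : \sum_f mass f * (bad (label k0 f) (label k1 f))%:R =
   (\sum_(s : {perm T}) \sum_f mass f *
     (bad (s @^-1: label k0 f) (s @^-1: label k1 f))%:R) / #|{: {perm T}}|%:R.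
  rewrite [X in _ = X / _](eq_bigr (fun=> \sum_f mass f *
    (bad (label k0 f) (label k1 f))%:R)); last by move=> s _; rewrite -hs.
  by rewrite sumr_const -[X in X / _]mulr_natr mulfK // gt_eqF.
rewrite exchange_big /= mulr_suml; apply: eq_bigr => f _.
rewrite -mulr_sumr -mulrA; congr (_ * _).
have hsub : label k0 f \subset label k1 f.
  by apply/fintype.subsetP => e; rewrite !inE; exact: h01.
have [tau [h0 h1]] := ex_first hsub.
rewrite -[RHS](@pr_mulr (fun s => bad (first s #|label k0 f|) (first s #|label k1 f|)) tau).
congr (_ / _); rewrite -natr_sum; congr (_%:R).
rewrite -sum1_card [RHS]big_mkcond; apply: eq_bigr => s _; rewrite inE.
have hpre E : E = first tau #|E| -> s @^-1: E = first (s * tau)%g #|E|.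
  by move=> hE; rewrite {1}hE; apply/setP => e; rewrite !inE permM.
by rewrite (hpre _ h0) (hpre _ h1); case: (bad _ _).
Qed.

(** [bad] decreases in the first graph and increases in the second. On the event that the early set
    has at most [M0] and the late one at least [M1] elements, it is therefore implied by [bad] at
    these two times. *)
Lemma transfer_mono (k0 k1 : pred K) (bad : {set T} -> {set T} -> bool) M0 M1 :
  (forall k, k0 k -> k1 k) ->
  (forall E0 E0' E1 E1' : {set T}, E0' \subset E0 -> E1 \subset E1' -> bad E0 E1 -> bad E0' E1') ->
  pr (fun s => bad (first s M0) (first s M1)) *
    prl (fun f => (#|label k0 f| <= M0)%N && (M1 <= #|label k1 f|)%N) <=
  prl (fun f => bad (label k0 f) (label k1 f)).
Proof.
move=> h01 hmono; rewrite transfer // /prl mulr_sumr big_mkcond; apply: ler_sum => f _.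
case: ifP => [/andP[h0 h1]|_]; last by rewrite mulr_ge0 ?mass_ge0 ?pr_ge0.
rewrite mulrC; apply: ler_wpM2l; first exact: mass_ge0.
by apply: pr_le => s; apply: hmono; exact: first_sub.
Qed.

End Labels.

(** * From the binomial model to a fixed number of edges *)

Definition bern (p : R) (b : bool) : R := if b then p else 1 - p.

Lemma bern_ge0 p : 0 <= p <= 1 -> forall b, 0 <= bern p b.
Proof. by case/andP => h0 h1 []; rewrite /bern ?subr_ge0. Qed.

Lemma mass_bern p (f : {ffun T -> bool}) :
  mass (bern p) f = p ^+ #|label id f| * (1 - p) ^+ (#|T| - #|label id f|).
Proof.
rewrite /mass (bigID (fun e => f e)) /=; congr (_ * _).
  rewrite -prodr_const [RHS](eq_bigl (fun e => f e)); last by move=> e; rewrite inE.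
  by apply: eq_bigr => e ->.
have -> : (#|T| - #|label id f| = #|~: label id f|)%N by rewrite [RHS]cardsCs setCK.
rewrite -prodr_const [RHS](eq_bigl (fun e => ~~ f e)); last by move=> e; rewrite !inE.
by apply: eq_bigr => e /negbTE->.
Qed.

Lemma sum_mass_bern p : \sum_(f : {ffun T -> bool}) mass (bern p) f = 1.
Proof.
have := @sum_mass_prod _ (bern p) (fun _ _ => 1).
rewrite [RHS]big1 => [<-|e _].
  by apply: eq_bigr => f _; rewrite big1 ?mulr1.
by rewrite big_bool /bern /=; ring.
Qed.

Definition binom_term (N M k : nat) : R :=
  'C(N, k)%:R * (M%:R / N%:R) ^+ k * (1 - M%:R / N%:R) ^+ (N - k).

Lemma binom_mode N M k : (0 < N)%N -> (M <= N)%N -> (k <= N)%N ->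
  binom_term N M k <= binom_term N M M.
Proof.
move=> N0 hM hk; set p : R := M%:R / N%:R.
have N0' : 0 < N%:R :> R by rewrite ltr0n.
have p0 : 0 <= p by rewrite divr_ge0.
have q0 : 0 <= 1 - p by rewrite subr_ge0 ler_pdivrMr // mul1r ler_nat.
have pN : p * N%:R = M%:R by rewrite mulfVK // gt_eqF.
(* By [fac], the difference of consecutive terms has the sign of M - (j + 1) + p with p in [0, 1],
   so the terms increase up to M and decrease from there on. *)
have ratio j : (j < N)%N ->
    j.+1%:R * binom_term N M j.+1 - j.+1%:R * binom_term N M j =
    'C(N, j)%:R * p ^+ j * (1 - p) ^+ (N - j.+1) * ((N - j)%:R * p - j.+1%:R * (1 - p)).
  move=> hj; rewrite /binom_term -/p -[(N - j)%N]subnSK //.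
  have hbin : j.+1%:R * 'C(N, j.+1)%:R = (N - j.+1).+1%:R * 'C(N, j)%:R :> R.
    by rewrite -!natrM subnSK // mul_bin_left.
  rewrite !exprS !mulrA hbin; ring.
have fac j : (j < N)%N -> (N - j)%:R * p - j.+1%:R * (1 - p) = M%:R - j.+1%:R + p :> R.
  by move=> hj; rewrite natrB 1?ltnW // -pN -natr1; ring.
have cge0 j : 0 <= 'C(N, j)%:R * p ^+ j * (1 - p) ^+ (N - j.+1).
  by rewrite !mulr_ge0 ?exprn_ge0.
have p1 : p <= 1 by lra.
have up j : (j < M)%N -> binom_term N M j <= binom_term N M j.+1.
  move=> hj; have hjN : (j < N)%N by exact: leq_trans hM.
  rewrite -(ler_pM2l (ltr0Sn R j)) -subr_ge0 ratio // fac //.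
  by apply: mulr_ge0 => //; rewrite addr_ge0 // subr_ge0 ler_nat.
have down j : (M <= j)%N -> (j < N)%N -> binom_term N M j.+1 <= binom_term N M j.
  move=> hj hjN; rewrite -(ler_pM2l (ltr0Sn R j)) -subr_le0 ratio // fac //.
  apply: mulr_ge0_le0 => //.
  have : M%:R <= j%:R :> R by rewrite ler_nat.
  by rewrite -natr1; lra.
have [hkM|hkM] := leqP k M.
  rewrite -(subKn hkM); elim: (M - k)%N (leq_subr k M) => [|d IH] hd; first by rewrite subn0.
  apply: le_trans (IH (ltnW hd)); have := up (M - d.+1)%N; rewrite subnSK //; apply.
  exact: leq_subr.
rewrite -(subnKC (ltnW hkM)); have : (M + (k - M) <= N)%N by rewrite subnKC // ltnW.
elim: (k - M)%N => [|d IH]; rewrite ?addn0 // addnS => hd.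
apply: le_trans (IH (ltnW hd)); apply: down => //; exact: leq_addr.
Qed.

(** The mean [M] is the mode of the binomial law with N + 1 possible values, so exactly [M] edges
    occur with probability at least 1 / (N + 1). *)
Lemma transfer_binomial (bad : {set T} -> bool) M : (0 < #|T|)%N -> (M <= #|T|)%N ->
  pr (fun s => bad (first s M)) <=
  #|T|.+1%:R * prl (bern (M%:R / #|T|%:R)) (fun f => bad (label id f)).
Proof.
move=> T0 hM; set N := #|T| in T0 hM *; set p : R := M%:R / N%:R.
have N0' : 0 < N%:R :> R by rewrite ltr0n.
have p01 : 0 <= p <= 1 by rewrite divr_ge0 //= ler_pdivrMr // mul1r ler_nat.
have b0 := bern_ge0 p01.
have cls k : \sum_(f : {ffun T -> bool} | #|label id f| == k) mass (bern p) f =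
    binom_term N M k.
  rewrite (eq_bigr (fun=> p ^+ k * (1 - p) ^+ (N - k))); last first.
    by move=> f /eqP hf; rewrite mass_bern hf.
  rewrite sumr_const -mulr_natl /binom_term -/p -mulrA; congr (_%:R * _).
  rewrite -card_draws; pose h (f : {ffun T -> bool}) : {set T} := label id f.
  have hinj : injective h.
    move=> f g /setP hfg; apply/ffunP => e; have := hfg e.
    by rewrite !inE.
  rewrite -(card_imset _ hinj); apply: eq_card => A; rewrite inE.
  apply/imsetP/idP => [[f hf ->]//|hA].
  exists [ffun e => e \in A]; last by apply/setP => e; rewrite inE ffunE.
  rewrite unfold_in (_ : label id _ = A) //; by apply/setP => e; rewrite inE ffunE.
have hmode : 1 <= N.+1%:R * binom_term N M M.
  rewrite -[leLHS](sum_mass_bern p) (partition_big (fun f : {ffun T -> bool} =>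
     inord #|label id f| : 'I_N.+1) predT) //=.
  have -> : N.+1%:R * binom_term N M M = \sum_(k < N.+1) binom_term N M M.
    by rewrite sumr_const card_ord mulr_natl.
  apply: ler_sum => k _; rewrite (eq_bigl (fun f : {ffun T -> bool} => #|label id f| == k)).
    by rewrite cls; apply: binom_mode => //; rewrite -ltnS.
  by move=> f; rewrite -val_eqE /= inordK // ltnS max_card.
have htr : pr (fun s => bad (first s M)) * binom_term N M M <=
    prl (bern p) (fun f => bad (label id f)).
  have -> := @transfer _ (bern p) id id (fun E _ => bad E) (fun=> id).
  rewrite -cls mulr_sumr [leLHS]big_mkcond; apply: ler_sum => f _.
  case: eqP => [->|_]; first by rewrite mulrC.
  by rewrite mulr_ge0 ?pr_ge0 ?mass_ge0.
apply: (@le_trans _ _ (pr (fun s => bad (first s M)) * (N.+1%:R * binom_term N M M))).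
  by rewrite ler_peMr ?pr_ge0.
by rewrite mulrCA; apply: ler_wpM2l.
Qed.

End RandomOrder.

(** * The random graph process as a random order of the edges *)

Section Process.
Variables (R : realType) (n : nat).
Local Notation T := (edge 'I_n).
Local Notation N := ('C(n, 2)).

Lemma card_T : #|{: T}| = N.
Proof. by rewrite card_edge card_ord. Qed.

Definition traj (sigma : {perm T}) : trajectory n := [ffun M : 'I_N.+1 => first sigma M].

Lemma traj_inj : injective traj.
Proof.
move=> s s' /ffunP h; apply/permP => e.
have hlt (t t' : {perm T}) : (forall M : 'I_N.+1, first t M = first t' M) ->
    (enum_rank (t' e) <= enum_rank (t e))%N.
  move=> ht; have hr : (enum_rank (t e) < N)%N by rewrite -card_T.
  have := ht (Ordinal (hr : ((enum_rank (t e)).+1 < N.+1)%N)) => /setP/(_ e).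
  by rewrite !inE /= ltnSn => /esym; rewrite ltnS.
apply/enum_rank_inj/val_inj/eqP; rewrite eqn_leq !hlt // => M.
  by have := h M; rewrite !ffunE.
by have := h M; rewrite !ffunE.
Qed.

Lemma prod_sub_fact m : (\prod_(i < m) (m - i))%N = m`!.
Proof.
elim: m => [|m IH]; first by rewrite big_ord0.
by rewrite big_ord_recl subn0 factS -IH; congr (_ * _)%N; apply: eq_bigr => i _.
Qed.

Lemma trajectory_prob_traj s : trajectory_prob R (traj s) = (N`!%:R)^-1.
Proof.
rewrite /trajectory_prob ffunE first0 eqxx mul1r -prod_sub_fact natr_prod -prodfV.
apply: eq_bigr => M _; rewrite /step_prob !ffunE /=.
have hM : (M < #|{: T}|)%N by rewrite card_T.
rewrite /bump add1n; have [e [he ->]] := firstS s hM.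
case: existsP => [_|[]]; last by exists e; rewrite he eqxx.
by rewrite [X in X%:R]cardsCs setCK card_first 1?ltnW // card_T.
Qed.

Lemma trajectory_prob_neq0 w : trajectory_prob R w != 0 -> exists s, w = traj s.
Proof.
rewrite /trajectory_prob mulf_eq0 negb_or => /andP[h0 hstep].
have w0 : w ord0 = set0 by move: h0; case: (w ord0 =P set0) => //; rewrite eqxx.
have steps (M : 'I_N) : exists e, e \notin w (widen_ord (leqnSn _) M) /\
    w (lift ord0 M) = e |: w (widen_ord (leqnSn _) M).
  have /prodf_neq0/(_ M isT) := hstep; rewrite /step_prob.
  by case: existsP => [[e /andP[h1 /eqP h2]] _|]; [exists e|rewrite eqxx].
have [e he] := choice steps.
have wE (M : 'I_N.+1) : w M = [set x | [exists i : 'I_N, (i < M)%N && (x == e i)]].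
  case: M => M; elim: M => [|M IH] hM.
    rewrite (_ : Ordinal hM = ord0) ?w0; last exact: val_inj.
    by apply/setP => x; rewrite !inE; apply/esym/existsP => -[].
  have hM' : (M < N)%N by [].
  rewrite (_ : Ordinal hM = lift ord0 (Ordinal hM')); last exact: val_inj.
  rewrite (he _).2 (_ : widen_ord _ _ = Ordinal (ltnW hM)); last exact: val_inj.
  rewrite IH; apply/setP => x; rewrite !inE /=; apply/orP/existsP => [[/eqP->|]|].
  - by exists (Ordinal hM'); rewrite /= eqxx andbT.
  - by case/existsP => i /andP[hi hx]; exists i; rewrite hx andbT /bump add1n ltnS ltnW.
  - case=> i /andP[]; rewrite /bump add1n ltnS leq_eqVlt => /orP[/eqP hi|hi] hx; [left|right].
      by rewrite (eqP hx); apply/eqP; congr e; apply: val_inj.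
    by apply/existsP; exists i; rewrite hi.
have einj : injective e.
  have lt (i j : 'I_N) : (i < j)%N -> e i <> e j.
    move=> hij hEq; case/negP: (he j).1; rewrite wE inE; apply/existsP; exists i.
    by rewrite hij hEq eqxx.
  move=> i j hE; apply/val_inj/eqP; case: ltngtP => // /lt; last by rewrite hE.
  by rewrite hE.
(* [g] maps the element of rank M to the edge added in step M; its inverse gives every edge its
   arrival time as rank. *)
pose g (x : T) : T := e (cast_ord card_T (enum_rank x)).
have ginj : injective g.
  by move=> x y /einj/cast_ord_inj/enum_rank_inj.
exists ((perm ginj)^-1)%g; apply/ffunP => M; rewrite ffunE wE; apply/setP => x.
rewrite !inE; pose y := ((perm ginj)^-1)%g x; rewrite -/y.
have hx : x = g y by rewrite -(permE ginj) permKV.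
apply/existsP/idP => [[i /andP[hi]]|hy].
  by rewrite hx => /eqP/einj hy; move: hi; rewrite -hy.
by exists (cast_ord card_T (enum_rank y)); rewrite hy hx eqxx.
Qed.

Lemma process_probE (A : trajectory n -> Prop) :
  process_prob R A = pr R (fun s => `[< A (traj s) >]).
Proof.
rewrite /process_prob /pr.
have -> : #|{: {perm T}}| = N`!.
  rewrite -card_T -[X in X`!]cardsT -card_perm; apply: eq_card => s.
  by rewrite !inE; apply/esym/fintype.subsetP => x; rewrite inE.
transitivity (\sum_(w in [set traj s | s in [set s | `[< A (traj s) >]]])
    trajectory_prob R w).
  rewrite big_mkcond [RHS]big_mkcond; apply: eq_bigr => w _.
  have [->|/trajectory_prob_neq0[s ->]] := eqVneq (trajectory_prob R w) 0.
    by do 2 case: ifP.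
  by rewrite (mem_imset _ _ traj_inj) inE.
rewrite big_imset /=; last by move=> s s' _ _; exact: traj_inj.
rewrite (eq_bigr (fun=> (N`!%:R)^-1)); last by move=> s _; exact: trajectory_prob_traj.
by rewrite sumr_const mulr_natl.
Qed.

End Process.

(** * Exponential moments *)

Section Expo.
Variable R : realType.

(** From e^x <= 1 / (1 - x) and (1 - x)(1 + x + 2 x^2) = 1 + x^2 (1 - 2 x) >= 1. *)
Lemma expR_le_quad (x : R) : x <= 1 / 2 -> expR x <= 1 + x + 2 * x ^+ 2.
Proof.
move=> hx; have h1 : 1 - x <= expR (- x) by exact: expR_ge1Dx.
have h2 : 0 < 1 - x by lra.
have h3 : expR x <= (1 - x)^-1.
  by rewrite -[x in expR x]opprK expRN lef_pV2 ?posrE ?expR_gt0.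
apply: le_trans h3 _; rewrite -div1r ler_pdivrMr // expr2.
have : 0 <= x * x * (1 - 2 * x) by apply: mulr_ge0; [rewrite -expr2 sqr_ge0|lra].
lra.
Qed.

Lemma bern_expR (p x : R) : 0 <= p <= 1 -> x <= 1 / 2 ->
  1 + p * (expR x - 1) <= expR (p * (x + 2 * x ^+ 2)).
Proof.
move=> /andP[p0 p1] hx; apply: le_trans (expR_ge1Dx _); rewrite lerD2l ler_wpM2l //.
by have := expR_le_quad hx; lra.
Qed.

Lemma prod_expR (I : finType) (P : pred I) (F : I -> R) :
  \prod_(i | P i) expR (F i) = expR (\sum_(i | P i) F i).
Proof. by rewrite expR_sum. Qed.

Lemma expr_expR (x : R) k : expR x ^+ k = expR (k%:R * x).
Proof. by rewrite expRM_natl. Qed.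

End Expo.

(** * Spread *)

Section SpreadProb.
Variables (R : realType) (V I : finType).
Variable dat : graph V -> I -> {set V} * (V -> {set V}).
Local Notation n := #|V|.
Local Notation N := #|{: edge V}|.

Section OneChoice.
Variables (S : {set V}) (W : V -> {set V}) (theta : R).
Hypothesis theta01 : 0 <= theta <= 1.

Definition bwt s u : R := (s \in S)%:R * ((u \in W s)%:R - theta).

(** Summed over the edges of a graph, this is minus the sum in [spread]. It adds both orientations
    of [e], whence the bound 2 in [awt_le2]. *)
Definition awt (e : edge V) : R := \sum_s \sum_(u | val e == [set s; u]) bwt s u.

Lemma bwt_le1 s u : `|bwt s u| <= 1.
Proof.
rewrite /bwt normrM normr_nat; have /andP[h0 h1] := theta01.
case: (s \in S); rewrite ?mul0r // mul1r ler_norml.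
by case: (u \in W s) => /=; apply/andP; split; lra.
Qed.

Lemma awt_le2 e : `|awt e| <= 2.
Proof.
have h2 : \sum_s \sum_(u | val e == [set s; u]) (1 : R) = 2.
  have := sum_edge_ends e => /(congr1 (fun z : nat => z%:R : R)).
  rewrite natr_sum => <-; apply: eq_bigr => s _; by rewrite natr_sum.
rewrite -h2; apply: le_trans (ler_norm_sum _ _ _) _; apply: ler_sum => s _.
by apply: le_trans (ler_norm_sum _ _ _) _; apply: ler_sum => u _; exact: bwt_le1.
Qed.

Lemma sum_awt (E : graph V) :
  \sum_(e in E) awt e = \sum_(s in S) (#|nb E s :&: W s|%:R - theta * #|nb E s|%:R).
Proof.
rewrite -sum_adj [RHS]big_mkcond; apply: eq_bigr => s _; rewrite /bwt.
case: (s \in S); last by rewrite big1 // => u _; rewrite mul0r.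
rewrite (eq_bigr (fun u => (u \in W s)%:R - theta)); last by move=> u _; rewrite mul1r.
rewrite big_split /= sumr_const mulr_natr -mulNrn; congr (_ + _).
rewrite -natr_sum -sum1_card [in LHS]big_mkcond [in RHS]big_mkcond; congr _%:R.
by apply: eq_bigr => u _; rewrite !inE; case: adj; case: (u \in W s).
Qed.

Lemma nb_full s : nb [set: edge V] s = ~: [set s].
Proof.
apply/setP => u; rewrite !inE; apply/idP/idP => [/adj_neq|h]; first by rewrite eq_sym.
by apply: pe_adj; rewrite ?subsetT // eq_sym.
Qed.

Lemma sum_awt_full (X : R) : (forall s, s \in S -> #|W s|%:R <= X) ->
  \sum_e awt e <= #|S|%:R * (X - theta * (n%:R - 1)).
Proof.
move=> hX; rewrite (eq_bigl (fun e => e \in [set: edge V])); last by move=> e; rewrite inE.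
rewrite sum_awt mulr_natl -sumr_const; apply: ler_sum => s hs.
have -> : #|nb [set: edge V] s|%:R = n%:R - 1 :> R.
  rewrite nb_full; have := cardsC [set s]; rewrite cards1 => <-.
  by rewrite natrD addrAC subrr add0r.
rewrite lerD2r; apply: le_trans (hX s hs); rewrite ler_nat.
exact/subset_leq_card/subsetIr.
Qed.

Lemma sum_awt_sqr : \sum_e awt e ^+ 2 <= 2 * (#|S|%:R * n%:R).
Proof.
apply: (@le_trans _ _ (\sum_e 2 * `|awt e|)).
  apply: ler_sum => e _; rewrite -real_normK ?num_real // expr2.
  by apply: ler_wpM2r => //; exact: awt_le2.
rewrite -mulr_sumr ler_pM2l //.
apply: (@le_trans _ _ (\sum_(e in [set: edge V]) \sum_s \sum_(u | val e == [set s; u]) (s \in S)%:R)).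
  rewrite [leRHS](eq_bigl xpredT); last by move=> e; rewrite inE.
  apply: ler_sum => e _; apply: le_trans (ler_norm_sum _ _ _) _; apply: ler_sum => s _.
  apply: le_trans (ler_norm_sum _ _ _) _; apply: ler_sum => u _.
  rewrite /bwt; case hs: (s \in S); last by rewrite mul0r normr0.
  by have := bwt_le1 s u; rewrite /bwt hs.
rewrite -sum_adj mulr_natl -sumr_const [leRHS]big_mkcond; apply: ler_sum => s _.
rewrite sumr_const; case: (s \in S); last by rewrite mul0rn.
by rewrite ler_nat max_card.
Qed.

End OneChoice.

Lemma card_edge2 : (2 * N = n * n.-1)%N.
Proof. by rewrite card_edge -mul_bin_diag bin1. Qed.

(** The total weight [awt] has mean at most -p eps |S| n / 4. Requiring [Ga] to be present
    contributes p for each of its edges, up to a factor e; this is what pays for the choice of [Ga]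
    in [spread_prob]. *)
Lemma spread_one (Ga : graph V) (S : {set V}) (W : V -> {set V}) (eps c : R) M (p : R) :
  0 < eps <= 1 / 4 -> 4 <= eps * n%:R -> (M <= N)%N -> (0 < N)%N -> p = M%:R / N%:R -> 0 <= c ->
  c * n%:R <= #|S|%:R ->
  (forall s, s \in S -> #|W s|%:R <= (1 / 2 + eps / 2) * n%:R) ->
  prl (bern p) (fun f : {ffun edge V -> bool} =>
    (Ga \subset label id f) &&
    (\sum_(s in S) ((1 / 2 + eps) * #|nb (label id f) s|%:R - #|nb (label id f) s :&: W s|%:R)
      < c * eps / 8 * M%:R)) <=
  expR (- (c * eps ^+ 2 / 256 * M%:R)) * (expR 1 * p) ^+ #|Ga|.
Proof.
move=> /andP[e0 e1] hn hM N0 hp c0 hS hW; set theta := 1 / 2 + eps.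
have th01 : 0 <= theta <= 1 by rewrite /theta; apply/andP; split; lra.
have N0' : 0 < N%:R :> R by rewrite ltr0n.
have p01 : 0 <= p <= 1 by rewrite hp divr_ge0 //= ler_pdivrMr // mul1r ler_nat.
have /andP[p0 p1] := p01.
have pN : p * N%:R = M%:R by rewrite hp mulfVK // gt_eqF.
(* With this value the second-order term eps^2 / 256 is half of the first-order gain eps^2 / 128, in
   units of |S| n. *)
pose lam := eps / 32; pose a := awt S W theta.
have a2 e : `|a e| <= 2 := awt_le2 S W th01 e.
have la e : `|lam * a e| <= 1 / 2.
  rewrite normrM ger0_norm; last by rewrite /lam; lra.
  have := a2 e; have : lam <= 1 / 4 by rewrite /lam; lra.
  have : 0 <= lam by rewrite /lam; lra.
  nra.
(* An absent edge of [Ga] contributes 0, so the product vanishes unless [Ga] is present. *)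
pose g e (b : bool) : R := if b then expR (lam * a e) else (e \notin Ga)%:R.
apply: (@le_trans _ _ (expR (lam * (c * eps / 8 * M%:R)) *
   \prod_e \sum_b bern p b * g e b)).
  apply: (prl_le_prod (bern_ge0 p01)); first exact: expR_ge0.
    by move=> e []; rewrite /g ?expR_ge0.
  move=> f /andP[hGa hsum]; set E := label id f in hGa hsum.
  have -> : \prod_e g e (f e) = expR (lam * \sum_(e in E) a e).
    rewrite mulr_sumr -prod_expR [RHS]big_mkcond; apply: eq_bigr => e _.
    rewrite /E inE /g; case hf: (f e) => //.
    have -> : e \notin Ga; last by [].
    by apply: contraFN hf => /(fintype.subsetP hGa); rewrite inE.
  rewrite -expRD -[leLHS]expR0 ler_expR -mulrDr; apply: mulr_ge0; first by rewrite /lam; lra.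
  rewrite sum_awt; move: hsum; set s1 := \sum_(_ in _) _; set s2 := \sum_(_ in _) _.
  suff -> : s2 = - s1 by lra.
  by rewrite /s1 /s2 -sumrN; apply: eq_bigr => s _; rewrite opprB.
have hfac e : \sum_b bern p b * g e b <=
    expR (p * (lam * a e + 2 * (lam * a e) ^+ 2)) * (if e \in Ga then expR 1 * p else 1).
  have := la e; rewrite ler_norml => /andP[l1 l2].
  rewrite big_bool /bern /g; case: (e \in Ga) => /=.
    rewrite mulr0 addr0 [X in _ <= _ * X]mulrC mulrCA; apply: ler_wpM2l => //.
    rewrite -expRD ler_expR.
    have : 0 <= p * (2 * (lam * a e) ^+ 2) by apply: mulr_ge0 => //; apply: mulr_ge0 => //; exact: sqr_ge0.
    have : (1 - p) * (lam * a e) <= 1 by nra.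
    lra.
  rewrite mulr1 mulr1; apply: le_trans (bern_expR p01 l2); lra.
apply: (@le_trans _ _ (expR (lam * (c * eps / 8 * M%:R)) *
   \prod_e (expR (p * (lam * a e + 2 * (lam * a e) ^+ 2)) *
      (if e \in Ga then expR 1 * p else 1)))).
  apply: ler_wpM2l; first exact: expR_ge0.
  apply: ler_prod => e _; rewrite hfac andbT big_bool; apply: addr_ge0; apply: mulr_ge0;
    rewrite ?(bern_ge0 p01) // /g ?expR_ge0 //.
rewrite big_split /= -big_mkcond /= prodr_const [leLHS]mulrA.
apply: ler_wpM2r; first by rewrite exprn_ge0 // mulr_ge0 // expR_ge0.
rewrite prod_expR -expRD ler_expR -mulr_sumr big_split /= -mulr_sumr.
have -> : \sum_i 2 * (lam * a i) ^+ 2 = 2 * lam ^+ 2 * \sum_i a i ^+ 2.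
  by rewrite mulr_sumr; apply: eq_bigr => e _; rewrite exprMn mulrA.
have hA1 := sum_awt_full theta hW; have hA2 := sum_awt_sqr S W th01.
set A1 := \sum_e awt S W theta e in hA1; set A2 := \sum_e awt S W theta e ^+ 2 in hA2.
rewrite -/A1 -/A2.
set n' : R := n%:R in hn hS hW hA1 hA2 *; set s' : R := #|S|%:R in hS hA1 hA2.
have s0 : 0 <= s' by rewrite ler0n.
have n0 : 0 <= n' by rewrite ler0n.
have hA1' : A1 <= - (eps / 4 * (s' * n')).
  apply: le_trans hA1 _.
  have : 0 <= s' * (eps * n' / 4 - theta) by apply: mulr_ge0 => //; rewrite /theta; lra.
  rewrite /theta; lra.
have hq : lam * A1 + 2 * lam ^+ 2 * A2 <= - (eps ^+ 2 / 256 * (s' * n')).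
  have h1 : lam * A1 <= lam * - (eps / 4 * (s' * n')) by apply: ler_wpM2l => //; rewrite /lam; lra.
  have h2 : 2 * lam ^+ 2 * A2 <= 2 * lam ^+ 2 * (2 * (s' * n')).
    by apply: ler_wpM2l => //; rewrite mulr_ge0 // sqr_ge0.
  apply: le_trans (lerD h1 h2) _; rewrite /lam le_eqVlt; apply/orP; left; apply/eqP; by field.
have hpn : 2 * M%:R <= p * (n' * n').
  rewrite -pN mulrCA; apply: ler_wpM2l => //.
  rewrite /n' -!natrM ler_nat card_edge2 leq_mul2l leq_pred orbT //.
have hps : 2 * c * M%:R <= p * (s' * n').
  have : c * (2 * M%:R) <= c * (p * (n' * n')) by apply: ler_wpM2l.
  have : 0 <= p * n' * (s' - c * n') by rewrite !mulr_ge0 // subr_ge0.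
  lra.
have hpq : p * (lam * A1 + 2 * lam ^+ 2 * A2) <= p * - (eps ^+ 2 / 256 * (s' * n')).
  exact: (ler_wpM2l p0 hq).
have hfin : eps ^+ 2 / 256 * (2 * c * M%:R) <= eps ^+ 2 / 256 * (p * (s' * n')).
  by apply: ler_wpM2l => //; rewrite divr_ge0 // sqr_ge0.
have -> : lam * (c * eps / 8 * M%:R) = c * eps ^+ 2 / 256 * M%:R by rewrite /lam; field.
lra.
Qed.

Lemma sum_expr_card (T : finType) (y : R) : 0 <= y ->
  \sum_(A : {set T}) y ^+ #|A| <= expR (y * #|T|%:R).
Proof.
move=> y0; have -> : \sum_(A : {set T}) y ^+ #|A| = \prod_(e : T) (y + 1).
  rewrite bigA_distr; apply: eq_big => A //.
  by move=> _; rewrite -big_mkcond prodr_const.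
rewrite prodr_const mulrC expRM_natl lerXn2r ?nnegrE ?expR_ge0 ?addr_ge0 //.
by rewrite addrC; exact: expR_ge1Dx.
Qed.

(** [ell] is a tilt for the constraint |Ga| <= gamma M: multiplying by exp(ell (gamma M - |Ga|)) >=
    1 allows the sum to run over all graphs [Ga], and [sum_expr_card] evaluates it. The event fixes
    the number of edges to make the bound on |Ga| deterministic. *)
Lemma spread_prob (eps c gamma ell p : R) M :
  0 < eps <= 1 / 4 -> 4 <= eps * n%:R -> (M <= N)%N -> (0 < N)%N -> p = M%:R / N%:R ->
  0 <= c -> 0 <= ell -> gamma * ell + expR (1 - ell) <= c * eps ^+ 2 / 512 ->
  prl (bern p) (fun f : {ffun edge V -> bool} => (#|label id f| == M) &&
    ~~ `[< spread dat (1 / 2 + eps) (1 / 2 + eps / 2) c gamma (c * eps / 8) (label id f) >])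
  <= #|I|%:R * expR (- (c * eps ^+ 2 / 512 * M%:R)).
Proof.
move=> he hn hM N0 hp c0 l0 hgl; set kappa := c * eps / 8.
have N0' : 0 < N%:R :> R by rewrite ltr0n.
have p01 : 0 <= p <= 1 by rewrite hp divr_ge0 //= ler_pdivrMr // mul1r ler_nat.
have /andP[p0 p1] := p01.
have pN : p * N%:R = M%:R by rewrite hp mulfVK // gt_eqF.
pose P (j : graph V * I) := [&& #|j.1|%:R <= gamma * M%:R,
  c * n%:R <= #|(dat j.1 j.2).1|%:R &
  [forall s in (dat j.1 j.2).1, #|(dat j.1 j.2).2 s|%:R <= (1 / 2 + eps / 2) * n%:R]].
pose A (j : graph V * I) (f : {ffun edge V -> bool}) := (j.1 \subset label id f) &&
    (\sum_(s in (dat j.1 j.2).1) ((1 / 2 + eps) * #|nb (label id f) s|%:R -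
       #|nb (label id f) s :&: (dat j.1 j.2).2 s|%:R) < kappa * M%:R).
apply: (@le_trans _ _ (prl (bern p) (fun f => [exists j, P j && A j f]))).
  apply: (prl_le (bern_ge0 p01)) => f /andP[/eqP hf]; apply: contraR => hno.
  apply/asboolP => Ga i /= hGa hga hS hW; rewrite leNgt; apply/negP => hlt.
  case/negP: hno; apply/existsP; exists (Ga, i); rewrite /P /A /= -hf hga hS hGa hlt !andbT /=.
  by apply/forallP => s; apply/implyP; exact: hW.
apply: le_trans (prl_exists (bern_ge0 p01) _ _) _.
set X := expR (- (c * eps ^+ 2 / 256 * M%:R)).
pose y := expR 1 * p * expR (- ell).
have y0 : 0 <= y by rewrite !mulr_ge0 ?expR_ge0.
apply: (@le_trans _ _ (\sum_(j : graph V * I) X * expR (ell * (gamma * M%:R)) * y ^+ #|j.1|)).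
  rewrite big_mkcond; apply: ler_sum => j _; case: ifP => hj; last first.
    by rewrite !mulr_ge0 ?expR_ge0 ?exprn_ge0.
  case/and3P: hj => hg hS /forallP hW.
  apply: le_trans (@spread_one j.1 _ (dat j.1 j.2).2 eps c M p he hn hM N0 hp c0 hS _) _.
    by move=> s hs; have /implyP := hW s; apply.
  rewrite -/X -mulrA; apply: ler_wpM2l; first exact: expR_ge0.
  rewrite /y [in leRHS]exprMn mulrCA; apply: ler_peMr.
    by rewrite exprn_ge0 // mulr_ge0 // expR_ge0.
  rewrite expr_expR -expRD -[leLHS]expR0 ler_expR.
  have : 0 <= ell * (gamma * M%:R - #|j.1|%:R) by apply: mulr_ge0 => //; rewrite subr_ge0.
  lra.
rewrite -mulr_sumr.
have -> : \sum_(j : graph V * I) y ^+ #|j.1| = #|I|%:R * \sum_(Ga : graph V) y ^+ #|Ga|.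
  rewrite -(pair_bigA _ (fun (Ga : graph V) (i : I) => y ^+ #|Ga|)) /= mulr_sumr.
  by apply: eq_bigr => Ga _; rewrite sumr_const mulr_natl.
rewrite mulrCA; apply: ler_wpM2l; first by rewrite ler0n.
apply: (@le_trans _ _ (X * expR (ell * (gamma * M%:R)) * expR (y * N%:R))).
  by apply: ler_wpM2l; [rewrite mulr_ge0 // expR_ge0|exact: sum_expr_card].
rewrite -!expRD ler_expR.
have -> : y * N%:R = expR (1 - ell) * M%:R by rewrite /y expRD -pN; ring.
have : (gamma * ell + expR (1 - ell)) * M%:R <= c * eps ^+ 2 / 512 * M%:R.
  by apply: ler_wpM2r.
lra.
Qed.

End SpreadProb.

(** * Local structure of the binomial random graph *)

Section Tails.
Variables (R : realType) (T K : finType) (wt : K -> R).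
Hypotheses (wt_ge0 : forall k, 0 <= wt k) (wt1 : \sum_k wt k = 1).

Lemma sum_mass : \sum_(f : {ffun T -> K}) mass wt f = 1.
Proof.
have := @sum_mass_prod R T K wt (fun _ _ => 1).
rewrite [RHS]big1 => [<-|e _]; first by apply: eq_bigr => f _; rewrite big1 ?mulr1.
by under eq_bigr do rewrite mulr1.
Qed.

Lemma prl_predC (A : pred {ffun T -> K}) : prl wt (predC A) = 1 - prl wt A.
Proof. by rewrite -sum_mass [X in _ = X - _](bigID A) /= addrAC subrr add0r. Qed.

Lemma prl_or (A B : pred {ffun T -> K}) :
  prl wt (fun f => A f || B f) <= prl wt A + prl wt B.
Proof.
rewrite !prl_sum -big_split /=; apply: ler_sum => f _; rewrite -mulrDr.
apply: ler_wpM2l; first exact: mass_ge0.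
by case: (A f); case: (B f); rewrite /= ?addr0 ?add0r ?lerDl.
Qed.

(* Both tails: [b > 0] gives the upper and [b < 0] the lower one. *)
Lemma prl_card_tail (k : pred K) (b X : R) :
  prl wt (fun f : {ffun T -> K} => b * X <= b * #|label k f|%:R) <=
  expR (- (b * X) + (expR b - 1) * (\sum_(j | k j) wt j) * #|T|%:R).
Proof.
pose g (_ : T) j := if k j then expR b else 1.
apply: le_trans (@prl_le_prod R T K wt wt_ge0 _ (expR (- (b * X))) g _ _ _) _.
- exact: expR_ge0.
- by move=> e j; rewrite /g; case: ifP => // _; exact: expR_ge0.
- move=> f hf.
  have -> : \prod_e g e (f e) = expR (b * #|label k f|%:R).
    rewrite mulrC expRM_natl -prodr_const [RHS]big_mkcond; apply: eq_bigr => e _.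
    by rewrite /g inE.
  by rewrite -expRD -[leLHS]expR0 ler_expR; lra.
rewrite expRD; apply: ler_wpM2l; first exact: expR_ge0.
have -> : \prod_(e : T) \sum_j wt j * g e j =
    \prod_(e : T) \sum_j wt j * (if k j then expR b else 1) by [].
rewrite prodr_const [X in _ <= expR X]mulrC expRM_natl; apply: lerXn2r.
- by rewrite nnegrE sumr_ge0 // => j _; rewrite mulr_ge0 //; case: ifP => // _; exact: expR_ge0.
- by rewrite nnegrE expR_ge0.
apply: le_trans (expR_ge1Dx _); rewrite mulr_sumr -[X in _ <= X + _]wt1 [X in _ <= _ + X]big_mkcond.
rewrite -big_split /=; apply: ler_sum => j _; case: ifP => _; lra.
Qed.

End Tails.

Section LocalProb.
Variables (R : realType) (V : finType).
Local Notation n := #|V|.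
Local Notation N := #|{: edge V}|.
Implicit Types (f : {ffun edge V -> bool}) (v x y : V).

Lemma bern_sum1 (p : R) : \sum_b bern p b = 1.
Proof. by rewrite big_bool /bern /=; ring. Qed.

Lemma degree_full v : degree [set: edge V] v = n.-1.
Proof. by rewrite degree_nb nb_full; have := cardsC [set v]; rewrite cards1 => <-. Qed.

Section Prob.
Variables (M : nat) (p : R).
Hypotheses (n2 : (1 < n)%N) (hM : (M <= N)%N) (hp : p = M%:R / N%:R).

Let N0 : (0 < N)%N. Proof. by rewrite card_edge bin_gt0. Qed.

Lemma density01 : 0 <= p <= 1.
Proof. by rewrite hp divr_ge0 //= ler_pdivrMr ?ltr0n // mul1r ler_nat. Qed.

Lemma density_card : p * N%:R = M%:R.
Proof. by rewrite hp mulfVK // pnatr_eq0 -lt0n. Qed.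

Lemma card_edge_eq : 2 * N%:R = n%:R * (n%:R - 1) :> R.
Proof.
rewrite -(natrM _ 2) card_edge2 natrM; congr (_ * _).
by rewrite -subn1 natrB // ltnW.
Qed.

Lemma density_degree : p * (n%:R - 1) = 2 * (M%:R / n%:R).
Proof.
have n0 : n%:R != 0 :> R by rewrite pnatr_eq0 -lt0n ltnW.
have : p * (n%:R - 1) * n%:R = 2 * M%:R by rewrite -density_card mulrCA card_edge_eq; ring.
by move=> h; rewrite mulrA -h mulfK.
Qed.

(** With tilt [a], a set of u vertices has too many edges with probability at most exp(-(a - 1) beta
    r u): as u <= c2 n, the expected number of edges inside, inflated by exp(a), costs only beta r
    u. *)
Lemma sparse_prob (beta a c2 q : R) : 0 <= beta -> c2 * expR a <= beta / 2 ->
  0 <= a -> q <= (a - 1) * (beta * (M%:R / n%:R)) -> n%:R * expR (- q) <= 1 / 2 ->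
  prl (bern p) (fun f => [exists U : {set V}, [&& U != set0, #|U|%:R <= c2 * n%:R &
     beta * (M%:R / n%:R) * #|U|%:R < #|edges_in (label id f) U|%:R]]) <=
  2 * (n%:R * expR (- q)).
Proof.
move=> be0 hc2 a0 hq hsmall; have /andP[p0 p1] := density01; have b0 := bern_ge0 density01.
set r := M%:R / n%:R in hq *.
have r0 : 0 <= r by rewrite divr_ge0.
have n0 : 2 <= n%:R :> R by rewrite (ler_nat R 2).
pose P (U : {set V}) := (U != set0) && (#|U|%:R <= c2 * n%:R).
pose A (U : {set V}) f := beta * r * #|U|%:R < #|edges_in (label id f) U|%:R.
apply: (@le_trans _ _ (prl (bern p) (fun f => [exists U, P U && A U f]))).
  by apply: (prl_le b0) => f /existsP[U hU]; apply/existsP; exists U; rewrite /P /A -andbA.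
apply: le_trans (prl_exists b0 _ _) _.
have one U : P U -> prl (bern p) (A U) <= expR (- q) ^+ #|U|.
  case/andP => _ hU; pose g (e : edge V) (b : bool) := if b && (val e \subset U) then expR a else 1.
  apply: le_trans (@prl_le_prod R _ _ _ b0 _ (expR (- (a * (beta * r * #|U|%:R)))) g _ _ _) _.
  - exact: expR_ge0.
  - by move=> e b; rewrite /g; case: ifP => // _; exact: expR_ge0.
  - move=> f hf.
    have -> : \prod_e g e (f e) = expR (a * #|edges_in (label id f) U|%:R).
      rewrite mulrC expRM_natl -prodr_const [RHS]big_mkcond; apply: eq_bigr => e _.
      by rewrite /g !inE.
    rewrite -expRD -[leLHS]expR0 ler_expR addrC subr_ge0; apply: ler_wpM2l => //.
    exact: ltW.
  have hprod : \prod_e \sum_b bern p b * g e b <= expR (p * expR a * 'C(#|U|, 2)%:R).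
    rewrite mulrC expRM_natl -card_edges_in -prodr_const [leRHS]big_mkcond.
    apply: ler_prod => e _; rewrite big_bool /bern /g /= inE; case: ifP => _; last first.
      by apply/andP; split; lra.
    have ea : 0 <= expR a by exact: expR_ge0.
    have : 0 <= p * expR a by exact: mulr_ge0.
    by move=> h; apply/andP; split; [|apply: le_trans (expR_ge1Dx _)]; lra.
  apply: (@le_trans _ _ (expR (- (a * (beta * r * #|U|%:R))) * expR (p * expR a * 'C(#|U|, 2)%:R))).
    by apply: ler_wpM2l => //; exact: expR_ge0.
  rewrite -expRD expr_expR ler_expR; set u : R := #|U|%:R in hU *.
  have u0 : 0 <= u by rewrite ler0n.
  have hC : 2 * 'C(#|U|, 2)%:R <= u * u.
    by rewrite /u -(natrM _ 2) -natrM ler_nat -mul_bin_diag bin1 leq_mul2l leq_pred orbT.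
  have hpnr : p * n%:R <= 4 * r.
    have := density_degree; rewrite -/r => hpn.
    have : p * n%:R <= p * (2 * (n%:R - 1)) by apply: ler_wpM2l => //; lra.
    lra.
  have h1 : p * expR a * (2 * 'C(#|U|, 2)%:R) <= p * expR a * (u * (c2 * n%:R)).
    apply: ler_wpM2l; first by rewrite mulr_ge0 ?expR_ge0.
    by apply: le_trans hC _; apply: ler_wpM2l.
  have h2 : p * expR a * (u * (c2 * n%:R)) = p * n%:R * u * (c2 * expR a) by ring.
  have h3 : p * n%:R * u * (c2 * expR a) <= p * n%:R * u * (beta / 2).
    by apply: ler_wpM2l => //; rewrite !mulr_ge0.
  have h4 : p * n%:R * (u * (beta / 2)) <= 4 * r * (u * (beta / 2)).
    by apply: ler_wpM2r => //; apply: mulr_ge0 => //; lra.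
  have h5 : q * u <= (a - 1) * (beta * r) * u by apply: ler_wpM2r.
  lra.
(* The sum over non-empty sets is at most (1 + e^-q)^n - 1, which is of order n e^-q. *)
apply: (@le_trans _ _ (\sum_(U : {set V}) expR (- q) ^+ #|U| - 1)).
  rewrite [X in _ <= X - _](bigD1 set0) //= cards0 expr0 addrAC subrr add0r.
  rewrite [leLHS]big_mkcond [leRHS]big_mkcond; apply: ler_sum => U _.
  case: ifP => [hU|_]; first by have /andP[-> _] := hU; exact: one.
  by case: ifP => // _; rewrite exprn_ge0 // expR_ge0.
have := @sum_expr_card R V (expR (- q)) (expR_ge0 _); rewrite mulrC.
set x := n%:R * expR (- q) in hsmall *.
have x0 : 0 <= x by rewrite mulr_ge0 ?expR_ge0.
have := expR_le_quad hsmall; have : x ^+ 2 <= x * (1 / 2) by rewrite expr2; apply: ler_wpM2l.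
lra.
Qed.

Lemma mindeg_prob (delta : R) : delta <= 1 / 6 ->
  prl (bern p) (fun f => [exists v, (degree (label id f) v)%:R < delta * (M%:R / n%:R)]) <=
  n%:R * expR (- (M%:R / n%:R)).
Proof.
move=> hd; have /andP[p0 p1] := density01; have b0 := bern_ge0 density01.
set r := M%:R / n%:R.
have r0 : 0 <= r by rewrite divr_ge0.
pose A v f := (degree (label id f) v)%:R < delta * r.
apply: (@le_trans _ _ (prl (bern p) (fun f => [exists v, xpredT v && A v f]))).
  exact: (prl_le b0).
apply: le_trans (prl_exists b0 _ _) _.
rewrite mulr_natl -sumr_const; apply: ler_sum => v _.
pose g (e : edge V) (b : bool) : R := if b && (v \in val e) then expR (-2) else 1.
apply: le_trans (@prl_le_prod R _ _ _ b0 _ (expR (2 * (delta * r))) g _ _ _) _.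
- exact: expR_ge0.
- by move=> e b; rewrite /g; case: ifP => // _; exact: expR_ge0.
- move=> f hf.
  have -> : \prod_e g e (f e) = expR (-2 * (degree (label id f) v)%:R).
    rewrite mulrC expRM_natl -prodr_const [RHS]big_mkcond; apply: eq_bigr => e _.
    by rewrite /g !inE.
  rewrite -expRD -[leLHS]expR0 ler_expR; move: hf; rewrite /A; lra.
have hprod : \prod_e \sum_b bern p b * g e b <= expR (- (p * (2 / 3)) * (n%:R - 1)).
  have -> : n%:R - 1 = (degree [set: edge V] v)%:R :> R.
    by rewrite degree_full -subn1 natrB // ltnW.
  rewrite mulrC expRM_natl /degree -prodr_const [leRHS]big_mkcond.
  apply: ler_prod => e _; rewrite big_bool /bern /g /= !inE /=; case: ifP => _; last first.
    by apply/andP; split; lra.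
  have ea : 0 <= expR (-2) :> R by exact: expR_ge0.
  have ea3 : expR (-2) <= 1 / 3 :> R.
    rewrite expRN -div1r ler_pdivrMr ?expR_gt0 //.
    have := expR_ge1Dx (2 : R); lra.
  have : 0 <= p * expR (-2) by exact: mulr_ge0.
  have : p * expR (-2) <= p * (1 / 3) by exact: ler_wpM2l.
  by move=> h h'; apply/andP; split; [|apply: le_trans (expR_ge1Dx _)]; lra.
apply: (@le_trans _ _ (expR (2 * (delta * r)) * expR (- (p * (2 / 3)) * (n%:R - 1)))).
  by apply: ler_wpM2l => //; exact: expR_ge0.
rewrite -expRD ler_expR; have := density_degree; rewrite -/r => hpn.
have : delta * r <= 1 / 6 * r by apply: ler_wpM2r.
lra.
Qed.

End Prob.

End LocalProb.

(** * Edge sets of paths and of stars *)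

Section PathEdges.
Variable V : finType.
Implicit Types (x y : V) (s : seq V) (E : graph V).

Lemma mem_path_edges s (e : edge V) :
  reflect (exists u t, csc s u t /\ val e = [set u; t]) (e \in path_edges s).
Proof.
apply: (iffP bigcupP) => [[u _ /bigcupP[t]]|[u [t [h1 h2]]]].
  by rewrite !inE => h /eqP h'; exists u, t.
by exists u; rewrite ?inE //; apply/bigcupP; exists t; rewrite inE // h2.
Qed.

Lemma path_edges_cons x y s : path_edges [:: x, y & s] = pe x y :|: path_edges (y :: s).
Proof.
apply/setP => e; rewrite in_setU; apply/mem_path_edges/orP.
  case=> u [t []]; rewrite csc_cons2 => /orP[/andP[/eqP-> /eqP->] he|h he].
    by left; rewrite inE he.
  by right; apply/mem_path_edges; exists u, t.
case=> [|/mem_path_edges[u [t [h he]]]].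
  by rewrite inE => /eqP he; exists x, y; rewrite csc_cons2 !eqxx.
by exists u, t; rewrite csc_cons2 h orbT.
Qed.

Lemma card_path_edges x s : uniq (x :: s) -> #|path_edges (x :: s)| = size s.
Proof.
elim: s x => [|y s IH] x.
  move=> _; apply/eqP; rewrite cards_eq0; apply/eqP/setP => e; rewrite in_set0.
  by apply/negP => /mem_path_edges[u [t []]].
move=> us; have /andP[hx us'] := us.
rewrite path_edges_cons cardsU card_pe IH //.
have -> : pe x y :&: path_edges (y :: s) = set0.
  apply/setP => e; rewrite in_setI in_set0; apply/negP => /andP[].
  rewrite inE => /eqP he /mem_path_edges[u [t [/csc_mem/andP[hu ht] he']]].
  have : x \in val e by rewrite he !inE eqxx.
  by rewrite he' !inE => /orP[]/eqP hxu; move: hx; rewrite hxu ?hu ?ht.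
rewrite cards0 subn0 (_ : x != y) //.
by apply: contraNneq hx => ->; exact: mem_head.
Qed.

Lemma path_edges_sub E x s : path (adj E) x s -> path_edges (x :: s) \subset E.
Proof.
move=> hp; apply/fintype.subsetP => e /mem_path_edges[u [t [h he]]].
have /adjP[e' he' hv] := @sorted_csc _ (adj E) (x :: s) u t hp h.
by rewrite (_ : e = e') //; apply: val_inj; rewrite he hv.
Qed.

Definition incident (x : V) : graph V := [set e : edge V | x \in val e].

Lemma degreeE E x : degree E x = #|E :&: incident x|.
Proof. by apply: eq_card => e; rewrite !inE. Qed.

Lemma card_incident x : #|incident x| = #|V|.-1.
Proof. by rewrite -(degree_full x) degreeE setTI. Qed.

Lemma card_incident2 x y : x != y -> #|incident x :|: incident y| = (2 * #|V| - 3)%N.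
Proof.
move=> hxy; rewrite cardsU !card_incident.
have -> : incident x :&: incident y = pe x y.
  by apply/setP => e; rewrite !inE edgeE !inE [y == x]eq_sym hxy.
by rewrite card_pe hxy /=; have := max_card (mem [set x; y]); rewrite cards2 hxy; lia.
Qed.

End PathEdges.

(** * Low-degree vertices at short distance, for two times at once *)

Section TwoTimes.
Variables (R : realType) (V : finType).
Local Notation n := #|V|.
Implicit Types (f : {ffun edge V -> bool * bool}) (x y : V) (E : graph V).

(* The label of an edge tells whether it belongs to the earlier graph, and whether it
   belongs to the later graph; the label [(true, false)] has weight [0]. *)
Definition wt2 (p0 p1 : R) (k : bool * bool) : R :=
  if k.2 then (if k.1 then p0 else p1 - p0) else (if k.1 then 0 else 1 - p1).

(** The conjunction makes early imply late for every label, including the one of weight 0, as the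
    transfer requires. *)
Definition in_early (k : bool * bool) := k.1 && k.2.
Definition in_late (k : bool * bool) := k.2.

Lemma big_bool2 (F : bool * bool -> R) : \sum_k F k =
  F (true, true) + F (true, false) + (F (false, true) + F (false, false)).
Proof.
rewrite (eq_bigr (fun k => F (k.1, k.2))); last by case.
by rewrite -(pair_bigA _ (fun a b => F (a, b))) /= big_bool !big_bool.
Qed.

Lemma wt2_ge0 p0 p1 : 0 <= p0 -> p0 <= p1 -> p1 <= 1 -> forall k, 0 <= wt2 p0 p1 k.
Proof. by move=> h0 h01 h1 [[] []]; rewrite /wt2 /=; lra. Qed.

Lemma wt2_sum1 p0 p1 : \sum_k wt2 p0 p1 k = 1.
Proof. by rewrite big_bool2 /wt2 /=; ring. Qed.

Lemma wt2_early p0 p1 : \sum_(k | in_early k) wt2 p0 p1 k = p0.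
Proof. by rewrite big_mkcond big_bool2 /wt2 /in_early /=; ring. Qed.

Lemma wt2_late p0 p1 : \sum_(k | in_late k) wt2 p0 p1 k = p1.
Proof. by rewrite big_mkcond big_bool2 /wt2 /in_late /=; ring. Qed.

(** Degrees are measured in the early graph and the path lives in the late one. This makes the event
    monotone, so that excluding it for one pair of times covers all graphs in between. *)
Definition short_path (t : R) E0 E1 : bool :=
  [exists x, exists k : 'I_5, exists s : k.-tuple V,
    [&& (0 < k)%N, uniq (x :: s), path (adj E1) x s,
        (degree E0 x)%:R < t & (degree E0 (last x s))%:R < t]].

Lemma short_path_mono t (E0 E0' E1 E1' : graph V) :
  E0' \subset E0 -> E1 \subset E1' -> short_path t E0 E1 -> short_path t E0' E1'.
Proof.
move=> s0 s1 /existsP[x /existsP[k /existsP[s /and5P[h1 h2 h3 h4 h5]]]].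
apply/existsP; exists x; apply/existsP; exists k; apply/existsP; exists s.
have hd v : (degree E0' v)%:R <= (degree E0 v)%:R :> R.
  by rewrite ler_nat !degreeE; apply/subset_leq_card/setSI.
rewrite h1 h2 !(le_lt_trans (hd _)) //= !andbT.
by apply: sub_path h3 => u v; exact: adj_sub.
Qed.

Lemma short_path_one (p0 p1 a t : R) x k (s : k.-tuple V) :
  0 <= p0 -> p0 <= p1 -> p1 <= 1 -> 0 <= a -> (0 < k <= 4)%N -> uniq (x :: s) ->
  prl (wt2 p0 p1) (fun f => [&& path (adj (label in_late f)) x s,
     (degree (label in_early f) x)%:R < t & (degree (label in_early f) (last x s))%:R < t]) <=
  expR (2 * a * t) * (p1 ^+ k * expR (- (p0 * (1 - expR (- a)) * (2 * n%:R - 7)))).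
Proof.
move=> h0 h01 h1 a0 /andP[k0 k4] us; have wge0 := wt2_ge0 h0 h01 h1.
set y := last x s.
have hxy : x != y.
  rewrite /y; case: (tval s) (size_tuple s) us => [h|z s' _]; first by rewrite -h in k0.
  by case/andP => hx _; apply: contraNneq hx => hE; rewrite {1}hE /= mem_last.
pose J := path_edges (x :: s).
have cJ : #|J| = k by rewrite card_path_edges // size_tuple.
pose F := (incident x :|: incident y) :\: J.
(* There are 2 n - 3 edges at the two ends, and the path uses at most 4 of them; the rest is
   independent of the path. *)
have cF : (2 * n - 7 <= #|F|)%N.
  rewrite cardsD card_incident2 //; have := subset_leq_card (subsetIr (incident x :|: incident y) J).
  by rewrite cJ; lia.
have z01 : 0 <= expR (- a) <= 1 by rewrite expR_ge0 expR_le1 oppr_le0.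
pose g (e : edge V) (b : bool * bool) : R := if e \in J then b.2%:R else
  if (e \in F) && in_early b then expR (- a) else 1.
apply: le_trans (@prl_le_prod R _ _ _ wge0 _ (expR (2 * a * t)) g _ _ _) _.
- exact: expR_ge0.
- by move=> e b; rewrite /g; case: ifP => // _; case: ifP => // _; exact: expR_ge0.
- move=> f /and3P[hp hx hy]; have hJ := path_edges_sub hp.
  pose E0 := label in_early f.
  have -> : \prod_e g e (f e) = expR (- a * #|E0 :&: F|%:R).
    rewrite mulrC expRM_natl -prodr_const [RHS]big_mkcond; apply: eq_bigr => e _.
    rewrite /g; case: ifP => heJ.
      have := fintype.subsetP hJ _ heJ; rewrite inE /in_late => ->.
      by rewrite in_setI /F in_setD heJ andbF.
    by rewrite in_setI [e \in E0]inE andbC.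
  rewrite -expRD -[leLHS]expR0 ler_expR.
  have : #|E0 :&: F|%:R <= (degree E0 x)%:R + (degree E0 y)%:R :> R.
    rewrite -natrD ler_nat !degreeE; apply: leq_trans (leq_card_setU _ _).
    rewrite -setIUr; apply/subset_leq_card/setIS; exact: subsetDl.
  move=> hle; have : a * #|E0 :&: F|%:R <= a * (t + t).
    by apply: ler_wpM2l => //; apply: le_trans hle _; apply: lerD; exact: ltW.
  lra.
apply: ler_wpM2l; first exact: expR_ge0.
apply: (@le_trans _ _ (\prod_e ((if e \in J then p1 else 1) *
    (if e \in F then expR (- (p0 * (1 - expR (- a)))) else 1)))).
  apply: ler_prod => e _; rewrite big_bool2 /wt2 /g /in_early /=.
  have /andP[z0 z1] := z01.
  have hz : 0 <= p0 * expR (- a) by exact: mulr_ge0.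
  have hJF : e \in J -> e \in F = false by move=> h; rewrite /F in_setD h.
  case: (boolP (e \in J)) => [/hJF->|_]; first by apply/andP; split; lra.
  case: (e \in F) => /=; last by apply/andP; split; lra.
  by apply/andP; split; [|rewrite mul1r; apply: le_trans (expR_ge1Dx _)]; lra.
rewrite big_split /= -!big_mkcond /= !prodr_const cJ; apply: ler_wpM2l.
  by rewrite exprn_ge0 //; lra.
rewrite expr_expR ler_expR mulrN lerN2 mulrC; apply: ler_wpM2r.
  by rewrite mulr_ge0 // subr_ge0; case/andP: z01.
have : (2 * n)%:R - 7 <= (2 * n - 7)%:R :> R.
  have [h|h] := leqP 7 (2 * n); first by rewrite natrB.
  have : (2 * n)%:R <= 7 :> R by rewrite (ler_nat R _ 7) ltnW.
  have : 0 <= (2 * n - 7)%:R :> R by rewrite ler0n.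
  lra.
have : (2 * n - 7)%:R <= #|F|%:R :> R by rewrite ler_nat.
rewrite natrM; lra.
Qed.

Lemma short_path_prob (p0 p1 a t : R) :
  0 <= p0 -> p0 <= p1 -> p1 <= 1 -> 0 <= a -> 1 <= n%:R * p1 ->
  prl (wt2 p0 p1) (fun f => short_path t (label in_early f) (label in_late f)) <=
  5 * n%:R * (n%:R * p1) ^+ 4 *
   expR (2 * a * t - p0 * (1 - expR (- a)) * (2 * n%:R - 7)).
Proof.
move=> h0 h01 h1 a0 hnp; have wge0 := wt2_ge0 h0 h01 h1.
set Y := expR _.
pose B x (k : 'I_5) (s : k.-tuple V) f := [&& path (adj (label in_late f)) x s,
     (degree (label in_early f) x)%:R < t & (degree (label in_early f) (last x s))%:R < t].
apply: (@le_trans _ _ (prl (wt2 p0 p1) (fun f => [exists x, xpredT x &&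
    [exists k : 'I_5, (0 < k)%N && [exists s : k.-tuple V, uniq (x :: s) && B x k s f]]]))).
  apply: (prl_le wge0) => f /existsP[x /existsP[k /existsP[s /and5P[b1 b2 b3 b4 b5]]]].
  apply/existsP; exists x; apply/existsP; exists k; rewrite b1; apply/existsP; exists s.
  by rewrite b2 /B b3 b4 b5.
apply: le_trans (prl_exists wge0 _ _) _.
have -> : 5 * n%:R * (n%:R * p1) ^+ 4 * Y = \sum_(x : V) \sum_(k < 5) (n%:R * p1) ^+ 4 * Y.
  by rewrite !sumr_const card_ord -[RHS]mulr_natr -[X in _ = X * _]mulr_natr; ring.
apply: ler_sum => x _; apply: le_trans (prl_exists wge0 _ _) _.
have np0 : 0 <= n%:R * p1 by lra.
rewrite big_mkcond; apply: ler_sum => k _; case: ifP => hk; last first.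
  by rewrite mulr_ge0 ?exprn_ge0 ?expR_ge0.
apply: le_trans (prl_exists wge0 _ _) _.
have hk4 : (k <= 4)%N by rewrite -ltnS.
apply: (@le_trans _ _ (\sum_(s : k.-tuple V) p1 ^+ k * Y)).
  rewrite big_mkcond; apply: ler_sum => s _; case: ifP => hs; last first.
    by rewrite mulr_ge0 ?expR_ge0 ?exprn_ge0 //; lra.
  apply: le_trans (@short_path_one p0 p1 a t x k s h0 h01 h1 a0 _ hs) _; first by rewrite hk.
  by rewrite mulrCA /Y expRD.
rewrite sumr_const card_tuple -mulrnAl; apply: ler_wpM2r; first exact: expR_ge0.
rewrite -mulr_natl natrX -exprMn.
by apply: ler_weXn2l.
Qed.

End TwoTimes.

(** * Isolated vertices *)

Section Isolated.
Variables (R : realType) (V : finType) (p : R).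
Hypothesis p01 : 0 <= p < 1.
Local Notation n := #|V|.
Local Notation q := (1 - p).
Implicit Types (f : {ffun edge V -> bool}) (u v : V).

Let p01' : 0 <= p <= 1. Proof. by case/andP: p01 => -> /ltW->. Qed.

Lemma sum_mass_avoid (F : graph V) :
  \sum_(f : {ffun edge V -> bool}) mass (bern p) f * (label id f :&: F == set0)%:R = q ^+ #|F|.
Proof.
pose g (e : edge V) (b : bool) : R := if b && (e \in F) then 0 else 1.
rewrite (eq_bigr (fun f : {ffun edge V -> bool} => mass (bern p) f * \prod_e g e (f e))).
  rewrite sum_mass_prod -prodr_const [RHS]big_mkcond; apply: eq_bigr => e _.
  by rewrite big_bool /bern /g /=; case: (e \in F); ring.
move=> f _; congr (_ * _); have [h|/set0Pn[e]] := eqVneq.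
  rewrite big1 // => e _; rewrite /g; case: ifP => // /andP[h1 h2].
  by have /setP/(_ e) := h; rewrite !inE h1 h2.
by rewrite !inE => /andP[h1 h2]; rewrite (bigD1 e) //= /g h1 h2 mul0r.
Qed.

Definition isolated f v : R := (label id f :&: incident v == set0)%:R.

Lemma isolatedM f u v : isolated f u * isolated f v =
  (label id f :&: (incident u :|: incident v) == set0)%:R.
Proof.
rewrite /isolated setIUr setU_eq0.
by case: (_ == _); rewrite ?mul1r ?mul0r.
Qed.

(* Chebyshev's inequality for the number of isolated vertices. *)
Lemma no_isolated_prob (mu : R) : (1 < n)%N -> mu = n%:R * q ^+ n.-1 ->
  prl (bern p) (fun f => [forall v, (0 < degree (label id f) v)%N]) * mu ^+ 2 <=
  mu + mu ^+ 2 * (p / q).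
Proof.
move=> n2 hmu; have /andP[p0 p1] := p01; have b0 := bern_ge0 p01'.
have q0 : 0 < q by rewrite subr_gt0.
pose Z f := \sum_v isolated f v.
have EZ : \sum_f mass (bern p) f * Z f = mu.
  rewrite /Z; under eq_bigr do rewrite mulr_sumr.
  rewrite exchange_big /= hmu mulr_natl -sumr_const; apply: eq_bigr => v _.
  by rewrite sum_mass_avoid card_incident.
have EZ2 : \sum_f mass (bern p) f * Z f ^+ 2 <= mu + mu ^+ 2 / q.
  have -> : \sum_f mass (bern p) f * Z f ^+ 2 =
      \sum_(u : V) \sum_(v : V) q ^+ #|incident u :|: incident v|.
    rewrite (eq_bigr (fun f => \sum_u \sum_v mass (bern p) f * (isolated f u * isolated f v))).
      rewrite exchange_big /=; apply: eq_bigr => u _; rewrite exchange_big /=.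
      apply: eq_bigr => v _; rewrite -sum_mass_avoid; apply: eq_bigr => f _.
      by rewrite isolatedM.
    move=> f _; rewrite expr2 /Z mulr_suml mulr_sumr; apply: eq_bigr => u _.
    by rewrite mulr_sumr mulr_sumr.
  have -> : mu + mu ^+ 2 / q = \sum_(u : V) (q ^+ n.-1 + \sum_(v : V) q ^+ n.-1 ^+ 2 / q).
    rewrite !sumr_const -[RHS]mulr_natr -[X in _ = (_ + X) * _]mulr_natr hmu.
    by field; rewrite gt_eqF.
  apply: ler_sum => u _; rewrite (bigD1 u) //= setUid card_incident; apply: lerD => //.
  rewrite [leRHS](bigD1 u) //= ler_wpDl //.
    by rewrite divr_ge0 ?exprn_ge0 //; exact: ltW.
  apply: ler_sum => v hv; rewrite card_incident2 1?eq_sym //.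
  rewrite ler_pdivlMr // -exprSr -exprM (_ : (2 * n - 3).+1 = n.-1 * 2)%N //; lia.
have key : prl (bern p) (fun f => [forall v, (0 < degree (label id f) v)%N]) * mu ^+ 2 <=
    \sum_f mass (bern p) f * (Z f - mu) ^+ 2.
  rewrite prl_sum mulr_suml; apply: ler_sum => f _; rewrite -mulrA; apply: ler_wpM2l.
    exact: mass_ge0.
  case: forallP => [h|_]; last by rewrite mul0r sqr_ge0.
  rewrite mul1r (_ : Z f = 0) ?sub0r ?sqrrN //; apply: big1 => v _; rewrite /isolated.
  by have := h v; rewrite degreeE lt0n cards_eq0 => /negbTE->.
apply: (le_trans key).
have -> : \sum_f mass (bern p) f * (Z f - mu) ^+ 2 =
    \sum_f mass (bern p) f * Z f ^+ 2 - mu ^+ 2.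
  rewrite (eq_bigr (fun f => mass (bern p) f * Z f ^+ 2 +
     (- (2 * mu) * (mass (bern p) f * Z f) + mu ^+ 2 * mass (bern p) f))); last first.
    by move=> f _; ring.
  rewrite !big_split /= -!mulr_sumr EZ sum_mass_bern; ring.
have -> : mu + mu ^+ 2 * (p / q) = mu + mu ^+ 2 / q - mu ^+ 2.
  by field; rewrite gt_eqF.
by rewrite lerD2r.
Qed.

End Isolated.

(** * Choice of the constants *)

Section Constants.
Variables (R : realType) (eps : R).
Hypothesis heps : 0 < eps <= 1 / 4.

(** The exponent in [spread_prob] for c = 1 / 6. With ell = 2 / [c_eta], both [c_gamma] ell and
    exp(1 - ell) are at most [c_eta] / 2. *)
Definition c_eta : R := 1 / 6 * eps ^+ 2 / 512.
Definition c_gamma : R := c_eta ^+ 2 / 4.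
(** Small enough to cost little in [small_separated], yet at least 2 [c_alpha], so that vertices of
    large degree keep [k] neighbours in D. *)
Definition c_delta : R := 1 / 200 * (1 / 100).
(** As k is about [c_alpha] r, the stars use half of the edge budget [c_gamma] |G|. Further, 14
    [c_beta] = [c_alpha] / 4 stays below k / r, and ([c_a] - 1) [c_beta] = 22 gives an exponent of
    at least 8 log n from r >= 3/8 log n on. *)
Definition c_alpha : R := c_gamma / 2.
Definition c_beta : R := c_alpha / 56.
Definition c_a : R := 1 + 22 / c_beta.
Definition c_two : R := c_beta / (2 * expR c_a).
Definition c_c : R := c_two / 7.
Definition c_kappa : R := 1 / 6 * eps / 8.
Definition c_kappa' : R := c_c * eps / 8.
(** The summands ensure [c_alpha] r >= 2, that all other added edges fit into the second half of the
    budget, and eps [c_delta] r >= 1. *)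
Definition c_r0 : R :=
  2 / c_alpha + 2 / c_gamma * (7 + 4 / c_kappa + 4 / c_kappa') + 200 * 100 / eps.

Lemma c_eta_bounds : 0 < c_eta <= 1 / 500.
Proof.
have /andP[e0 e1] := heps; rewrite /c_eta.
have : 0 < eps ^+ 2 by exact: exprn_gt0.
have : eps ^+ 2 <= (1 / 4) ^+ 2 by rewrite lerXn2r ?nnegrE //; lra.
by rewrite !expr2 => h1 h2; apply/andP; split; lra.
Qed.

Lemma c_gamma_bounds : 0 < c_gamma <= 1 / 500 * (1 / 500).
Proof.
have /andP[e0 e1] := c_eta_bounds; rewrite /c_gamma.
have : 0 < c_eta ^+ 2 by exact: exprn_gt0.
have : c_eta ^+ 2 <= (1 / 500) ^+ 2 by rewrite lerXn2r ?nnegrE //; lra.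
by rewrite !expr2 => h1 h2; apply/andP; split; lra.
Qed.

Lemma c_alpha_gt0 : 0 < c_alpha.
Proof. by have /andP[h _] := c_gamma_bounds; rewrite /c_alpha; lra. Qed.

Lemma c_beta_gt0 : 0 < c_beta.
Proof. by have := c_alpha_gt0; rewrite /c_beta; lra. Qed.

Lemma c_a_ge1 : 1 <= c_a.
Proof. by rewrite /c_a lerDl divr_ge0 // ltW // c_beta_gt0. Qed.

Lemma c_two_gt0 : 0 < c_two.
Proof. by rewrite /c_two divr_gt0 ?c_beta_gt0 // mulr_gt0 ?expR_gt0. Qed.

Lemma c_two_exp : c_two * expR c_a = c_beta / 2.
Proof. by rewrite /c_two; field; rewrite gt_eqF // expR_gt0. Qed.

Lemma c_two_le : c_two <= 1 / 2.
Proof.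
have h := c_two_exp; have /andP[_ g1] := c_gamma_bounds.
have : c_two * 1 <= c_two * expR c_a.
  by apply: ler_wpM2l; [exact/ltW/c_two_gt0|have := expR_ge1Dx c_a; have := c_a_ge1; lra].
by rewrite h /c_beta /c_alpha; lra.
Qed.

Lemma c_c_bounds : 0 < c_c <= 1 / 14.
Proof. by have := c_two_gt0; have := c_two_le; rewrite /c_c => *; apply/andP; split; lra. Qed.

Lemma c_kappa_bounds : 0 < c_kappa <= 1.
Proof. by have /andP[e0 e1] := heps; rewrite /c_kappa; apply/andP; split; lra. Qed.

Lemma c_kappa'_bounds : 0 < c_kappa' <= 1.
Proof.
have /andP[e0 e1] := heps; have /andP[h0 h1] := c_c_bounds; rewrite /c_kappa'.
have : 0 < c_c * eps by exact: mulr_gt0.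
have : c_c * eps <= c_c * 1 by apply: ler_wpM2l; lra.
by move=> *; apply/andP; split; lra.
Qed.

Lemma ell_bound (eta : R) : 0 < eta -> expR (1 - 2 / eta) <= eta / 2.
Proof.
move=> h; rewrite -[1 - _]opprB expRN -[eta / 2]invf_div lef_pV2 ?posrE ?expR_gt0 ?divr_gt0 //.
have := expR_ge1Dx (2 / eta - 1); lra.
Qed.

Lemma truncn_bounds (x : R) : 0 <= x ->
  (Num.truncn x)%:R <= x /\ x < (Num.truncn x)%:R + 1.
Proof. by move=> h; have /andP[h1 h2] := truncn_itv h; rewrite natr1. Qed.

(* [4 <= e^2] *)
Lemma pow4_expR k : (4 ^ k)%:R <= expR (2 * k%:R) :> R.
Proof.
rewrite mulrC expRM_natl natrX lerXn2r ?nnegrE ?expR_ge0 //.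
have -> : 4 = 2 ^+ 2 :> R by rewrite -natrX.
rewrite -[X in expR X]mulr1 expRM_natl lerXn2r ?nnegrE ?expR_ge0 //.
have := expR_ge1Dx (1 : R); lra.
Qed.

Lemma hit_bound (A k : nat) (kappa : R) : 0 < kappa <= 1 -> (A <= 4 ^ k)%N ->
  A%:R * (1 - kappa / 2) ^+ (Num.truncn (4 * k%:R / kappa)).+1 < 1.
Proof.
move=> /andP[k0 k1] hA; set K := Num.truncn _.
have [_ hK] := @truncn_bounds (4 * k%:R / kappa) (divr_ge0 (mulr_ge0 (ler0n _ 4) (ler0n _ _)) (ltW k0)).
rewrite -/K in hK.
apply: (@le_lt_trans _ _ (expR (2 * k%:R) * expR (K.+1%:R * - (kappa / 2)))).
  apply: ler_pM => //; first by rewrite exprn_ge0 //; lra.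
    by apply: le_trans (pow4_expR k); rewrite ler_nat.
  rewrite expRM_natl lerXn2r ?nnegrE ?expR_ge0 //; first lra.
  by have := expR_ge1Dx (- (kappa / 2)); lra.
rewrite -expRD expR_lt1 -(natr1 K).
have : 4 * k%:R / kappa * kappa < (K%:R + 1) * kappa by rewrite ltr_pM2r.
by rewrite mulfVK ?gt_eqF //; lra.
Qed.

Section Good.
Variable V : finType.
Local Notation n := #|V|.

Definition sparse_sets (G : graph V) := forall U : {set V}, U != set0 ->
  #|U|%:R <= c_two * n%:R -> #|edges_in G U|%:R <= c_beta * (#|G|%:R / n%:R) * #|U|%:R.

Definition good (G : graph V) : Prop :=
  [/\ spread (@dat_pre V) (1 / 2 + eps) (1 / 2 + eps / 2) (1 / 6) c_gamma c_kappa G,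
      spread (dat_ends (V := V) (1 / 2 + eps / 2)) (1 / 2 + eps) (1 / 2 + eps / 2)
        (1 / 6) c_gamma c_kappa G,
      spread (@dat_sets V) (1 / 2 + eps) (1 / 2 + eps / 2) c_c 0 c_kappa' G &
      sparse_sets G].

Theorem good_resilient (G : graph V) : (2 < n)%N -> c_r0 <= #|G|%:R / n%:R -> good G ->
  separated G [set v | c_delta * (#|G|%:R / n%:R) <= (degree G v)%:R] ->
  (2 <= min_degree G)%N ->
  resiliently_hamiltonian (1 / 2 - eps) G /\ ~ resiliently_hamiltonian (1 / 2 + eps) G.
Proof.
move=> n3 hr [sp1 sp2 sp3 hsparse] hsep hmin.
have /andP[e0 e1] := heps; have /andP[g0 g1] := c_gamma_bounds.
have al0 := c_alpha_gt0; have be0 := c_beta_gt0; have /andP[c0 c1] := c_c_bounds.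
have kb := c_kappa_bounds; have kb' := c_kappa'_bounds.
have /andP[k0 k1] := kb; have /andP[k0' k1'] := kb'.
set r := #|G|%:R / n%:R in hr hsep hsparse.
have n0 : 0 < n%:R :> R by rewrite ltr0n ltnW // ltnW.
have rn : r * n%:R = #|G|%:R by rewrite mulfVK // gt_eqF.
have i1 : 0 <= 2 / c_alpha by rewrite divr_ge0 // ltW.
have i4 : 0 <= 4 / c_kappa by rewrite divr_ge0 // ltW.
have i5 : 0 <= 4 / c_kappa' by rewrite divr_ge0 // ltW.
have i2 : 0 <= 2 / c_gamma * (7 + 4 / c_kappa + 4 / c_kappa').
  by apply: mulr_ge0; [rewrite divr_ge0 // ltW|lra].
have i3 : 0 <= 200 * 100 / eps by rewrite divr_ge0 ?mulr_ge0 // ltW.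
have r1 : 2 / c_alpha <= r by move: hr; rewrite /c_r0; lra.
have r2 : 2 / c_gamma * (7 + 4 / c_kappa + 4 / c_kappa') <= r by move: hr; rewrite /c_r0; lra.
have r3 : 200 * 100 / eps <= r by move: hr; rewrite /c_r0; lra.
have r0 : 0 <= r by lra.
have ar2 : 2 <= c_alpha * r by rewrite mulrC -ler_pdivrMr.
have gr : 7 + 4 / c_kappa + 4 / c_kappa' <= c_gamma / 2 * r.
  have : c_gamma / 2 * (2 / c_gamma * (7 + 4 / c_kappa + 4 / c_kappa')) <= c_gamma / 2 * r.
    by apply: ler_wpM2l => //; lra.
  by apply: le_trans; rewrite mulrA (_ : c_gamma / 2 * (2 / c_gamma) = 1) ?mul1r //; field; rewrite gt_eqF.
have er : 200 * 100 <= eps * r by rewrite [eps * r]mulrC -ler_pdivrMr.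
have G0 : (0 < #|G|)%N.
  rewrite -(ltr0n R) -rn; apply: mulr_gt0 => //.
  have : 0 < c_alpha * r by lra.
  by rewrite pmulr_rgt0.
set L := [set v | _] in hsep.
have hL v : v \in L -> c_delta * r <= (degree G v)%:R by rewrite inE.
have hom : 1 / 2 <= 1 / 2 + eps / 2 :> R by lra.
split; last first.
  apply: (@not_resilient_core R V G eps (1 / 2 + eps / 2) c_kappa' c_c L) => //; first lra.
  move=> v /hL hv; have : eps * (c_delta * r) <= eps * (degree G v)%:R by apply: ler_wpM2l => //; lra.
  rewrite /c_delta; lra.
move=> H sHG hH.
have hD v : (1 / 2 + eps) * #|nb G v|%:R <= #|nb (G :\: H) v|%:R.
  rewrite -!degree_nb; have := hH v; rewrite (degree_setD v sHG) natrD; lra.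
have ar0 : 0 <= c_alpha * r by lra.
pose k := Num.truncn (c_alpha * r); have [kl ku] := truncn_bounds ar0; rewrite -/k in kl ku.
have cn0 : 0 <= c_c * n%:R by rewrite mulr_ge0 // ltW.
pose m := Num.truncn (c_c * n%:R); have [ml mu] := truncn_bounds cn0; rewrite -/m in ml mu.
pose K := (Num.truncn (4 * n%:R / c_kappa)).+1.
pose K' := (Num.truncn (4 * n%:R / c_kappa')).+1.
have card2 : #|{: {set V}}| = (2 ^ n)%N by rewrite -[LHS]cardsT -powersetT card_powerset cardsT.
have nn : (n <= 2 ^ n)%N by exact/ltnW/ltn_expl.
apply: (@resilient_core R V G _ (1 / 2 + eps) (1 / 2 + eps / 2) c_gamma c_kappa c_kappa'
  c_c L k m K K') => //.
- exact: subsetDl.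
- by rewrite -(natr1 m); lra.
- by rewrite -(ltr0n R); lra.
- move=> v /hL hv; rewrite -(ler_nat R); apply: le_trans (hD v); rewrite -degree_nb.
  apply: le_trans kl _.
  have h1 : 1 / 2 * (c_delta * r) <= (1 / 2 + eps) * (degree G v)%:R.
    apply: ler_pM => //; first lra; last lra.
    by rewrite mulr_ge0 // /c_delta; lra.
  apply: le_trans h1; have : c_alpha * r <= 1 / 2 * c_delta * r.
    by apply: ler_wpM2r => //; rewrite /c_alpha /c_delta; lra.
  by rewrite -[1 / 2 * c_delta * r]mulrA.
(* D keeps strictly more than half of at least two edges, hence two. *)
- move=> v _; have hv : (2 <= degree G v)%N by exact: leq_trans (min_degree_le G v).
  have hv' : 2 <= (degree G v)%:R :> R by rewrite (ler_nat R 2).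
  have h1 : 1 < #|nb (G :\: H) v|%:R :> R.
    apply: lt_le_trans (hD v); rewrite -degree_nb.
    have : 0 < eps * (degree G v)%:R by apply: mulr_gt0 => //; lra.
    lra.
  by move: h1; rewrite (ltr_nat R 1).
- move=> U U0 hU.
  have u0 : 0 < #|U|%:R :> R by rewrite ltr0n card_gt0.
  have hU' : #|U|%:R <= c_two * n%:R.
    have : #|U|%:R <= (7 * m)%:R :> R by rewrite ler_nat.
    by rewrite natrM; move: ml; rewrite /c_c; lra.
  have h1 : #|edges_in G U|%:R <= c_beta * r * #|U|%:R := hsparse U U0 hU'.
  rewrite -(ltr_nat R) !natrM.
  have h2 : c_beta * r * #|U|%:R * 14 < k%:R * #|U|%:R.
    by rewrite mulrAC; rewrite ltr_pM2r //; rewrite /c_beta; lra.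
  lra.
- rewrite !natrD natrM natrD -rn.
  have [Kl _] := @truncn_bounds (4 * n%:R / c_kappa) (divr_ge0 (mulr_ge0 (ler0n _ _) (ltW n0)) (ltW k0)).
  have [Kl' _] := @truncn_bounds (4 * n%:R / c_kappa') (divr_ge0 (mulr_ge0 (ler0n _ _) (ltW n0)) (ltW k0')).
  rewrite /K /K' -(natr1 (Num.truncn (4 * n%:R / c_kappa))) -(natr1 (Num.truncn (4 * n%:R / c_kappa'))).
  have n1 : 1 <= n%:R :> R by rewrite (ler_nat R 1) ltnW // ltnW.
  have hk : n%:R * k%:R <= n%:R * (c_alpha * r) by apply: ler_wpM2l => //; exact: ltW.
  have hg : n%:R * (7 + 4 / c_kappa + 4 / c_kappa') <= n%:R * (c_gamma / 2 * r).
    by apply: ler_wpM2l => //; exact: ltW.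
  have -> : c_gamma * (r * n%:R) = n%:R * (c_alpha * r) + n%:R * (c_gamma / 2 * r).
    by rewrite /c_alpha; field.
  rewrite !mulrDr in hg |- *.
  have q1 : 4 * n%:R / c_kappa = n%:R * (4 / c_kappa) by rewrite mulrAC mulrC.
  have q2 : 4 * n%:R / c_kappa' = n%:R * (4 / c_kappa') by rewrite mulrAC mulrC.
  rewrite q1 in Kl *; rewrite q2 in Kl' *.
  lra.
- apply: hit_bound => //; rewrite card_prod card2.
  by rewrite (_ : 4 = 2 * 2)%N // expnMn leq_mul2r nn orbT.
- by apply: hit_bound => //; rewrite card_prod card2 (_ : 4 = 2 * 2)%N // expnMn.
Qed.

End Good.
End Constants.

(** * Failure probabilities *)

Section Failure.
Variables (R : realType) (n : nat) (L : R).
Hypotheses (hnL : n%:R = expR L :> R) (hL : 200 <= L).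
Local Notation V := 'I_n.
Local Notation T := (edge V).
Local Notation N := #|{: T}|.

(** Here L = log n. A time x n log n has isolated vertices for x < 1/2, and pairs of close
    low-degree vertices disappear for x > 1/4; 3/8 lies midway. At [M1] all degrees are already of
    order log n. *)
Definition M0 : nat := (Num.truncn (3 / 8 * (n%:R * L))).+1.
Definition M1 : nat := (Num.truncn (8 * (n%:R * L))).+1.

Let L0 : 0 < L. Proof. by apply: lt_le_trans hL; rewrite ltr0n. Qed.

Lemma n_ge_sqr : L * L <= 2 * n%:R.
Proof.
have := @expR_ge1Dxn R L 1 (ltW L0); rewrite -hnL expr2 (_ : 2`!%:R = 2 :> R) //; lra.
Qed.

Lemma n_ge : 100 * L <= n%:R.
Proof. have := n_ge_sqr; have : 200 * L <= L * L by apply: ler_wpM2r => //; exact: ltW.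
lra. Qed.

Lemma n_gt0 : 0 < n%:R :> R. Proof. by have := hL; have := n_ge; lra. Qed.

Lemma n_gt2 : (2 < n)%N.
Proof. by rewrite -(ltr_nat R); have := hL; have := n_ge; lra. Qed.

Lemma nL_ge : 200 * n%:R <= n%:R * L.
Proof. by rewrite mulrC; apply: ler_wpM2l => //; exact/ltW/n_gt0. Qed.

Let nL0 : 0 <= n%:R * L. Proof. by rewrite mulr_ge0 ?ltW ?n_gt0. Qed.

Lemma M0_bounds : 3 / 8 * (n%:R * L) <= M0%:R /\ M0%:R <= 3 / 8 * (n%:R * L) + 1.
Proof.
have [|h1 h2] := @truncn_bounds R (3 / 8 * (n%:R * L)); first by have := nL0; lra.
by rewrite /M0 -(natr1 (Num.truncn _)); split; lra.
Qed.

Lemma M1_bounds : 8 * (n%:R * L) <= M1%:R /\ M1%:R <= 8 * (n%:R * L) + 1.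
Proof.
have [|h1 h2] := @truncn_bounds R (8 * (n%:R * L)); first by have := nL0; lra.
by rewrite /M1 -(natr1 (Num.truncn _)); split; lra.
Qed.

Let cardV : #|V| = n. Proof. exact: card_ord. Qed.

Lemma N_eq : 2 * N%:R = n%:R * (n%:R - 1) :> R.
Proof. by have := @card_edge_eq R V; rewrite cardV; apply; exact: ltnW n_gt2. Qed.

Lemma N1_le : N.+1%:R <= expR (2 * L).
Proof.
rewrite mulrC expRM_natr -hnL -(natr1 N) expr2; have := N_eq.
have : 2 * n%:R <= n%:R * n%:R :> R by apply: ler_wpM2r; rewrite ?ler0n // (ler_nat R 2) ltnW // n_gt2.
by have := hL; have := n_ge; lra.
Qed.

(* [p = x L / n] *)
Lemma pN_eq (x : R) : x * (L / n%:R) * N%:R = x / 2 * (n%:R * L - L).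
Proof.
have h : N%:R = n%:R * (n%:R - 1) / 2 :> R by rewrite -N_eq; field.
by rewrite h; field; rewrite gt_eqF // n_gt0.
Qed.

Lemma Ln_le : L / n%:R <= 2 / L.
Proof. by rewrite ler_pdivrMr ?n_gt0 // mulrAC ler_pdivlMr // n_ge_sqr. Qed.

Lemma Ln_small : 0 <= L / n%:R <= 1 / 100.
Proof.
rewrite divr_ge0 ?(ltW L0) ?(ltW n_gt0) //= ler_pdivrMr ?n_gt0 //; have := hL; have := n_ge; lra.
Qed.

Lemma expRN_quarter (x : R) : 3 <= x -> expR (- x) <= 1 / 4.
Proof.
move=> h; rewrite expRN -div1r ler_pdivrMr ?expR_gt0 //; have := expR_ge1Dx x; lra.
Qed.

Lemma early_dense : pr R (fun s : {perm T} => [forall v, (0 < degree (first s M0) v)%N]) <=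
  48 / L.
Proof.
(* [M0] corresponds to the density 3/4 L / n. At 9/10 L / n there are at least [M0] edges with
   probability 1/2 or more, while the expected number of isolated vertices is still large. *)
have hL' := hL; have L0' := L0; have /andP[l0 l1] := Ln_small; set p := 9 / 10 * (L / n%:R).
have p01 : 0 <= p < 1 by rewrite /p; apply/andP; split; lra.
have p01' : 0 <= p <= 1 by rewrite /p; apply/andP; split; lra.
have b0 := bern_ge0 p01'.
have htail : 1 / 2 <= prl (bern p) (fun f : {ffun T -> bool} =>
    (#|label (fun=> false) f| <= M0)%N && (M0 <= #|label id f|)%N).
  set A := fun f => _.
  have -> : prl (bern p) A = 1 - prl (bern p) (predC A).
    by rewrite (prl_predC (bern_sum1 p)) opprB addrC subrK.
  suff : prl (bern p) (predC A) <= 1 / 4 by lra.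
  apply: (@le_trans _ _ (prl (bern p) (fun f : {ffun T -> bool} =>
     - (1 / 20) * M0%:R <= - (1 / 20) * #|label id f|%:R :> R))).
    apply: (prl_le b0) => f; rewrite /A /= (_ : label _ f = set0).
      rewrite cards0 /= -ltnNge => h; have : #|label id f|%:R <= M0%:R :> R by rewrite ler_nat ltnW.
      lra.
    by apply/setP => e; rewrite !inE.
  apply: le_trans (@prl_card_tail R T _ (bern p) b0 (bern_sum1 p) id (- (1 / 20)) M0%:R) _.
  rewrite big_mkcond big_bool /bern /= addr0.
  apply: le_trans (@expRN_quarter 3 _) => //; rewrite ler_expR.
  have hq : expR (- (1 / 20)) - 1 <= - (9 / 200) :> R.
    by have := @expR_le_quad R (- (1 / 20)); rewrite sqrrN expr2; lra.
  have hpN := pN_eq (9 / 10); rewrite -/p in hpN; rewrite -mulrA hpN.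
  have [_ hM] := M0_bounds; have h1 := nL_ge; have h2 := n_ge.
  have : (expR (- (1 / 20)) - 1) * (9 / 10 / 2 * (n%:R * L - L)) <=
      - (9 / 200) * (9 / 10 / 2 * (n%:R * L - L)).
    by apply: ler_wpM2r => //; lra.
  lra.
have hmono := @transfer_mono R T _ _ b0 (fun=> false) id
  (fun _ E1 : {set T} => [forall v, (0 < degree E1 v)%N]) M0 M0.
have {}hmono := hmono _ _.
set P := pr R _; set P2 := prl (bern p) _ in htail hmono *.
have hP : P * P2 <= prl (bern p) (fun f : {ffun T -> bool} => [forall v, (0 < degree (label id f) v)%N]).
  apply: hmono => // E0 E0' E1 E1' _ sE /forallP h; apply/forallP => v.
  by apply: leq_trans (h v) _; rewrite !degreeE; apply/subset_leq_card/setSI.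
set P3 := prl (bern p) _ in hP.
pose mu : R := n%:R * (1 - p) ^+ n.-1.
have hiso : P3 * mu ^+ 2 <= mu + mu ^+ 2 * (p / (1 - p)).
  by apply: (@no_isolated_prob R V p p01 mu); rewrite cardV //; exact: ltnW n_gt2.
have q2 : 1 / 2 <= 1 - p by rewrite /p; lra.
have hq : expR (- (21 / 20 * p)) <= 1 - p.
  have /andP[p0 _] := p01.
  have := @expR_le_quad R (- (21 / 20 * p)); rewrite sqrrN expr2.
  have : p * p <= p * (9 / 1000) by apply: ler_wpM2l => //; rewrite /p; lra.
  by move=> h1 h2; apply: le_trans (h2 _) _; lra.
have hmu : L / 20 <= mu.
  apply: (@le_trans _ _ (n%:R * expR (- (21 / 20 * p)) ^+ n.-1)); last first.
    by apply: ler_wpM2l; [exact/ltW/n_gt0|rewrite lerXn2r ?nnegrE ?expR_ge0 //; lra].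
  rewrite expr_expR hnL -expRD.
  have hn1 : n.-1%:R = n%:R - 1 :> R.
    by rewrite -subn1 natrB // ltnW // ltnW // n_gt2.
  have hpn : n.-1%:R * p = 9 / 10 * L - 9 / 10 * (L / n%:R).
    by rewrite hn1 /p; field; rewrite gt_eqF // n_gt0.
  have := expR_ge1Dx (L + n.-1%:R * - (21 / 20 * p)).
  have -> : L + n.-1%:R * - (21 / 20 * p) = L - 21 / 20 * (n.-1%:R * p) by ring.
  rewrite hpn; lra.
have mu0 : 0 < mu by apply: lt_le_trans hmu; rewrite divr_gt0.
have hP3 : P3 <= 24 / L.
  have h1 : P3 <= mu^-1 + p / (1 - p).
    rewrite -(ler_pM2r (exprn_gt0 2 mu0)); apply: le_trans hiso _.
    have mun : mu != 0 by rewrite gt_eqF.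
    rewrite mulrDl [p / _ * _]mulrC lerD2r // [in leRHS]expr2 mulrA.
    by rewrite mulVf // mul1r.
  have h2 : mu^-1 <= 20 / L.
    by rewrite -[20 / L]invf_div lef_pV2 ?posrE // divr_gt0.
  have h3 : p / (1 - p) <= 4 / L.
    rewrite ler_pdivrMr; last lra.
    have h4 := Ln_le.
    have : 4 / L * (1 / 2) <= 4 / L * (1 - p) by apply: ler_wpM2l => //; rewrite divr_ge0 // ltW.
    rewrite /p; lra.
  lra.
have P0 : 0 <= P by exact: pr_ge0.
have : P * (1 / 2) <= P * P2 by apply: ler_wpM2l.
lra.
Qed.

(** 5 path lengths, doubled for the transfer; 40^4 from four steps of n p1 = 40 L; e and 4 / 25 from
    the exponent 1 - 29/25 L; 120 = 5! from e^x >= x^5 / 5!. *)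
Definition c_sep : R := 10 * 40 ^+ 4 * expR 1 * 120 / (4 / 25) ^+ 5.

Lemma small_separated (t : R) : t = c_delta R * (M1%:R / n%:R) ->
  pr R (fun s : {perm T} => short_path t (first s M0) (first s M1)) <= c_sep / L.
Proof.
move=> ht; have hL' := hL; have L0' := L0; have /andP[l0 l1] := Ln_small.
have ng := n_ge; have nLg := nL_ge; have n0 := n_gt0.
(* Below the density 3/4 L / n of [M0] and above the density 16 L / n of [M1]. *)
set p0 := 13 / 20 * (L / n%:R); set p1 := 40 * (L / n%:R).
have h0 : 0 <= p0 by rewrite /p0; lra.
have h01 : p0 <= p1 by rewrite /p0 /p1; lra.
have h1 : p1 <= 1 by rewrite /p1; lra.
have wge0 := wt2_ge0 h0 h01 h1; have w1 := wt2_sum1 p0 p1.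
have htail : 1 / 2 <= prl (wt2 p0 p1) (fun f : {ffun T -> bool * bool} =>
    (#|label in_early f| <= M0)%N && (M1 <= #|label in_late f|)%N).
  set A := fun f => _.
  have -> : prl (wt2 p0 p1) A = 1 - prl (wt2 p0 p1) (predC A).
    by rewrite (prl_predC w1) opprB addrC subrK.
  suff : prl (wt2 p0 p1) (predC A) <= 1 / 4 + 1 / 4 by lra.
  apply: (@le_trans _ _ (prl (wt2 p0 p1) (fun f : {ffun T -> bool * bool} =>
     (1 / 20 * M0%:R <= 1 / 20 * #|label in_early f|%:R :> R) ||
     (- 1 * M1%:R <= - 1 * #|label in_late f|%:R :> R)))).
    apply: (prl_le wge0) => f; rewrite /A /= negb_and -!ltnNge => /orP[] h; apply/orP.
      left; have : M0%:R <= #|label in_early f|%:R :> R by rewrite ler_nat ltnW.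
      lra.
    right; have : #|label in_late f|%:R <= M1%:R :> R by rewrite ler_nat ltnW.
    lra.
  apply: le_trans (prl_or wge0 _ _) _; apply: lerD.
    apply: le_trans (@prl_card_tail R T _ _ wge0 w1 in_early (1 / 20) M0%:R) _.
    rewrite wt2_early; apply: le_trans (@expRN_quarter 3 _) => //; rewrite ler_expR.
    have hq : expR (1 / 20) - 1 <= 11 / 200 :> R.
      by have := @expR_le_quad R (1 / 20); rewrite expr2; lra.
    have hpN := pN_eq (13 / 20); rewrite -/p0 in hpN; rewrite -mulrA hpN.
    have [hM _] := M0_bounds.
    have : (expR (1 / 20) - 1) * (13 / 20 / 2 * (n%:R * L - L)) <=
        11 / 200 * (13 / 20 / 2 * (n%:R * L - L)).
      by apply: ler_wpM2r => //; lra.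
    lra.
  apply: le_trans (@prl_card_tail R T _ _ wge0 w1 in_late (- 1) M1%:R) _.
  rewrite wt2_late; apply: le_trans (@expRN_quarter 3 _) => //; rewrite ler_expR.
  have hq : expR (- 1) - 1 <= - (1 / 2) :> R.
    have : expR (- 1) <= 1 / 2 :> R.
      rewrite expRN -div1r ler_pdivrMr ?expR_gt0 //; have := expR_ge1Dx (1 : R); lra.
    lra.
  have hpN := pN_eq 40; rewrite -/p1 in hpN; rewrite -mulrA hpN.
  have [_ hM] := M1_bounds.
  have : (expR (- 1) - 1) * (40 / 2 * (n%:R * L - L)) <= - (1 / 2) * (40 / 2 * (n%:R * L - L)).
    by apply: ler_wpM2r => //; lra.
  lra.
set P := pr R _; set P2 := prl (wt2 p0 p1) _ in htail.
have hP : P * P2 <= prl (wt2 p0 p1) (fun f : {ffun T -> bool * bool} =>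
    short_path t (label in_early f) (label in_late f)).
  apply: (@transfer_mono R T _ _ wge0 in_early in_late (short_path t) M0 M1).
    by move=> k /andP[].
  exact: short_path_mono.
have hnp1 : n%:R * p1 = 40 * L by rewrite /p1; field; rewrite gt_eqF.
have := @short_path_prob R V p0 p1 9 t h0 h01 h1; rewrite cardV hnp1 => hsp.
have {hsp} hsp := hsp _ _; move: hsp; set X := prl _ _ => hsp.
have hX : X <= 5 * n%:R * (40 * L) ^+ 4 *
    expR (2 * 9 * t - p0 * (1 - expR (- 9)) * (2 * n%:R - 7)) by apply: hsp; lra.
(* The tilt 9 makes 1 - exp(-9) >= 9/10, and 18 t is below L / 100. Two ends of low degree then cost
   2 * 13/20 * 9/10 = 117/100 in units of L; the excess over 1 beats the choice of the first vertex,
   as the path itself contributes only powers of L. *)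
have hexp : 2 * 9 * t - p0 * (1 - expR (- 9)) * (2 * n%:R - 7) <= 1 - 29 / 25 * L.
  have ht' : t <= c_delta R * (8 * L + 1).
    rewrite ht; apply: ler_wpM2l; first by rewrite /c_delta; lra.
    rewrite ler_pdivrMr //; have [_ hM] := M1_bounds; lra.
  have e9 : expR (- 9) <= 1 / 10 :> R.
    rewrite expRN -div1r ler_pdivrMr ?expR_gt0 //; have := expR_ge1Dx (9 : R); lra.
  have hp : p0 * (9 / 10) * (2 * n%:R - 7) <= p0 * (1 - expR (- 9)) * (2 * n%:R - 7).
    apply: ler_wpM2r; first lra.
    by apply: ler_wpM2l => //; lra.
  have hpn : p0 * (9 / 10) * (2 * n%:R - 7) = 117 / 100 * L - 819 / 200 * (L / n%:R).
    by rewrite /p0; field; rewrite gt_eqF.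
  move: ht'; rewrite /c_delta; lra.
have hfin : X <= c_sep / L / 2.
  apply: le_trans hX _.
  apply: (@le_trans _ _ (5 * n%:R * (40 * L) ^+ 4 * expR (1 - 29 / 25 * L))).
    apply: ler_wpM2l; last by rewrite ler_expR.
    by rewrite !mulr_ge0 ?exprn_ge0 ?ler0n ?mulr_ge0 // ltW.
  have -> : 1 - 29 / 25 * L = - L + (1 + - (4 / 25 * L)) by field.
  rewrite !expRD !expRN -hnL.
  have x0 : 0 < 4 / 25 * L by lra.
  have hx : (4 / 25 * L) ^+ 5 / 120 <= expR (4 / 25 * L).
    have := @expR_ge1Dxn R (4 / 25 * L) 4 (ltW x0); rewrite (_ : 5`!%:R = 120 :> R) //; lra.
  have hx' : (expR (4 / 25 * L))^-1 <= 120 / (4 / 25 * L) ^+ 5.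
    by rewrite -[120 / _]invf_div lef_pV2 ?posrE ?expR_gt0 // divr_gt0 // exprn_gt0.
  have hc : 0 <= 5 * (40 * L) ^+ 4 * expR 1.
    by rewrite !mulr_ge0 ?exprn_ge0 ?expR_ge0 ?mulr_ge0 // ltW.
  have -> : 5 * n%:R * (40 * L) ^+ 4 * (n%:R^-1 * (expR 1 * (expR (4 / 25 * L))^-1)) =
     5 * (40 * L) ^+ 4 * expR 1 * (expR (4 / 25 * L))^-1.
    set A := (40 * L) ^+ 4; set B := (expR (4 / 25 * L))^-1.
    by field; rewrite gt_eqF.
  apply: le_trans (ler_wpM2l hc hx') _.
  rewrite /c_sep [(40 * L) ^+ 4]exprMn [(4 / 25 * L) ^+ 5]exprMn le_eqVlt; apply/orP; left; apply/eqP.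
  set z := 40 ^+ 4; set w := (4 / 25) ^+ 5; set y := expR 1.
  have wn : w != 0 by rewrite expf_neq0 // mulf_neq0 ?invr_eq0 // pnatr_eq0.
  by field; rewrite wn gt_eqF.
have P0 : 0 <= P by exact: pr_ge0.
have hP' : P * P2 <= X := hP.
have : P * (1 / 2) <= P * P2 by apply: ler_wpM2l.
lra.
Qed.

Lemma late_mindeg M : (M1 <= M)%N -> (M <= N)%N ->
  pr R (fun s : {perm T} => [exists v, (degree (first s M) v)%:R < c_delta R * (M%:R / n%:R)]) <=
  expR (- (5 * L)).
Proof.
move=> hM1 hM; have n2 : (1 < #|V|)%N by rewrite cardV; exact: ltnW n_gt2.
have N0 : (0 < N)%N by rewrite card_edge bin_gt0.
apply: le_trans (@transfer_binomial R T (fun E => [exists v,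
   (degree E v)%:R < c_delta R * (M%:R / n%:R)]) M N0 hM) _.
have hd : c_delta R <= 1 / 6 by rewrite /c_delta; lra.
have := @mindeg_prob R V M _ n2 hM erefl _ hd; rewrite cardV => hp.
apply: (@le_trans _ _ (expR (2 * L) * (n%:R * expR (- (M%:R / n%:R))))).
  by apply: ler_pM => //; [exact/prl_ge0/bern_ge0/(density01 n2 hM erefl)|exact: N1_le].
rewrite hnL -!expRD ler_expR.
have : 8 * L <= M%:R / n%:R.
  rewrite ler_pdivlMr ?n_gt0 // -mulrA [L * _]mulrC.
  by apply: le_trans M1_bounds.1 _; rewrite ler_nat.
by rewrite -hnL; lra.
Qed.

End Failure.

(** * Union over all times *)

Section Assembly.
Variables (R : realType) (eps : R) (n : nat) (L : R).
Hypotheses (heps : 0 < eps <= 1 / 4) (hnL : n%:R = expR L :> R) (hL : 200 <= L).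
Hypotheses (hL1 : 3 <= c_c eps * eps ^+ 2 / 512 * (3 / 8) * L) (hL2 : 4 / eps <= L).
Hypothesis hL3 : c_r0 eps <= 3 / 8 * L.
Local Notation V := 'I_n.
Local Notation T := (edge V).
Local Notation N := #|{: T}|.
Local Notation M0 := (M0 n L).
Local Notation M1 := (M1 n L).

Let cardV : #|V| = n. Proof. exact: card_ord. Qed.

Let e0 : 0 < eps. Proof. by case/andP: heps. Qed.

(** The indices cost 4^n <= exp(2 n), and [hL1] makes the exponent of the single event at least 3 n
    from [M0] on. *)
Lemma spread_fail (I : finType) (dat : graph V -> I -> {set V} * (V -> {set V}))
    (c gamma ell : R) M : (M0 <= M)%N -> (M <= N)%N -> (#|I| <= 4 ^ n)%N ->
  c_c eps <= c -> 0 <= ell -> gamma * ell + expR (1 - ell) <= c * eps ^+ 2 / 512 ->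
  prl (bern (M%:R / N%:R)) (fun f : {ffun T -> bool} => (#|label id f| == M) &&
    ~~ `[< spread dat (1 / 2 + eps) (1 / 2 + eps / 2) c gamma (c * eps / 8) (label id f) >])
  <= expR (- (7 * L)).
Proof.
move=> hM0 hM hI hc ell0 hgl; have hL' := hL; have ng := n_ge hnL hL; have e0' := e0.
have n2 : (1 < #|V|)%N by rewrite cardV; exact: ltnW (n_gt2 hnL hL).
have N0 : (0 < N)%N by rewrite card_edge bin_gt0.
have /andP[cc0 _] := c_c_bounds heps.
have hen : 4 <= eps * #|V|%:R.
  have : 4 / eps <= n%:R by have := hL2; lra.
  by rewrite ler_pdivrMr // cardV mulrC.
apply: le_trans (@spread_prob R V I dat eps c gamma ell _ M heps hen hM N0 erefl _ ell0 hgl) _.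
  by lra.
apply: (@le_trans _ _ (expR (2 * n%:R) * expR (- (3 * n%:R)))); last first.
  by rewrite -expRD ler_expR; lra.
apply: ler_pM; rewrite ?expR_ge0 ?ler0n //.
  by apply: le_trans (pow4_expR R n); rewrite ler_nat.
rewrite ler_expR lerN2.
have hM0' : 3 / 8 * (n%:R * L) <= M%:R.
  by apply: le_trans (M0_bounds hnL hL).1 _; rewrite ler_nat.
have n0 := n_gt0 hnL hL.
apply: (@le_trans _ _ (c * eps ^+ 2 / 512 * (3 / 8 * (n%:R * L)))); last first.
  by apply: ler_wpM2l => //; rewrite !mulr_ge0 ?sqr_ge0 //; lra.
have h1 : c_c eps * (eps ^+ 2 / 512 * (3 / 8 * (n%:R * L))) <=
    c * (eps ^+ 2 / 512 * (3 / 8 * (n%:R * L))).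
  by apply: ler_wpM2r => //; rewrite !mulr_ge0 ?sqr_ge0 ?invr_ge0 //; lra.
have h2 : 3 * n%:R <= c_c eps * eps ^+ 2 / 512 * (3 / 8) * L * n%:R.
  by apply: ler_wpM2r; [exact: ltW|exact: hL1].
lra.
Qed.

(** The four properties fail with probability at most (1 + 1 + 1 + 2) exp(-7 L) under independent
    labels; fixing the number of edges costs a factor of at most exp(2 L). *)
Lemma good_fail M : (M0 <= M)%N -> (M <= N)%N ->
  pr R (fun s : {perm T} => ~~ `[< good eps (first s M) >]) <= 5 * expR (- (5 * L)).
Proof.
move=> hM0 hM; have hL' := hL; have e0' := e0.
have n2 : (1 < #|V|)%N by rewrite cardV; exact: ltnW (n_gt2 hnL hL).
have N0 : (0 < N)%N by rewrite card_edge bin_gt0.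
set p : R := M%:R / N%:R; have b0 := bern_ge0 (density01 n2 hM (erefl p)).
have /andP[eta0 _] := c_eta_bounds heps; have /andP[c0 c1] := c_c_bounds heps.
have hgl : c_gamma eps * (2 / c_eta eps) + expR (1 - 2 / c_eta eps) <= 1 / 6 * eps ^+ 2 / 512.
  have := ell_bound eta0; rewrite -/(c_eta eps).
  have -> : c_gamma eps * (2 / c_eta eps) = c_eta eps / 2.
    by rewrite /c_gamma; field; rewrite gt_eqF.
  lra.
have ell0 : 0 <= 2 / c_eta eps by rewrite divr_ge0 // ltW.
set eta' := c_c eps * eps ^+ 2 / 512.
have eta'0 : 0 < eta' by rewrite /eta' divr_gt0 // mulr_gt0 // exprn_gt0.
have hgl' : 0 * (2 / eta') + expR (1 - 2 / eta') <= c_c eps * eps ^+ 2 / 512.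
  by rewrite mul0r add0r; apply: le_trans (ell_bound eta'0) _; rewrite -/eta'; lra.
have ell0' : 0 <= 2 / eta' by rewrite divr_ge0 // ltW.
have card2 : #|{: {set V}}| = (2 ^ n)%N by rewrite -[LHS]cardsT -powersetT card_powerset cardsT cardV.
have four : (4 ^ n = 2 ^ n * 2 ^ n)%N by rewrite (_ : 4 = 2 * 2)%N // expnMn.
have c16 : c_c eps <= 1 / 6 by lra.
have f1 := @spread_fail _ (@dat_pre V) (1 / 6) (c_gamma eps) (2 / c_eta eps) M hM0 hM _ c16 ell0 hgl.
have f2 := @spread_fail _ (dat_ends (V := V) (1 / 2 + eps / 2)) (1 / 6) (c_gamma eps)
  (2 / c_eta eps) M hM0 hM _ c16 ell0 hgl.
have f3 := @spread_fail _ (@dat_sets V) (c_c eps) 0 (2 / eta') M hM0 hM _ (lexx _) ell0' hgl'.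
have {}f1 := f1 _; have {}f2 := f2 _; have {}f3 := f3 _.
have r8 : 3 / 8 * L <= M%:R / n%:R.
  rewrite ler_pdivlMr ?(n_gt0 hnL hL) // (_ : _ * n%:R = 3 / 8 * (n%:R * L)); last by ring.
  by apply: le_trans (M0_bounds hnL hL).1 _; rewrite ler_nat.
have f4 := @sparse_prob R V M p n2 hM (erefl p) (c_beta eps) (c_a eps) (c_two eps) (8 * L)
  (ltW (c_beta_gt0 heps)).
have {}f4 : prl (bern p) (fun f : {ffun T -> bool} => [exists U : {set V},
   [&& U != set0, #|U|%:R <= c_two eps * #|V|%:R &
     c_beta eps * (M%:R / #|V|%:R) * #|U|%:R < #|edges_in (label id f) U|%:R]]) <=
     2 * expR (- (7 * L)).
  have hn7 : n%:R * expR (- (8 * L)) = expR (- (7 * L)).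
    by rewrite hnL -expRD; congr expR; ring.
  have := f4; rewrite cardV hn7; apply.
  - by rewrite c_two_exp.
  - by have := c_a_ge1 heps; lra.
  - have -> : c_a eps - 1 = 22 / c_beta eps by rewrite /c_a addrAC subrr add0r.
    rewrite mulrA mulfVK ?gt_eqF ?c_beta_gt0 //; lra.
  - by apply: le_trans (@expRN_quarter R (7 * L) _) _; lra.
set F1 := (X in prl _ X <= _) in f1; set F2 := (X in prl _ X <= _) in f2.
set F3 := (X in prl _ X <= _) in f3; set F4 := (X in prl _ X <= _) in f4.
apply: (@le_trans _ _ (pr R (fun s : {perm T} => (#|first s M| == M) &&
    ~~ `[< good eps (first s M) >]))).
  by apply: pr_le => s ->; rewrite card_first ?eqxx.
apply: le_trans (@transfer_binomial R T
  (fun E => (#|E| == M) && ~~ `[< good eps E >]) M N0 hM) _.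
rewrite -/p.
have hsum : prl (bern p) (fun f : {ffun T -> bool} =>
    (#|label id f| == M) && ~~ `[< good eps (label id f) >]) <= 5 * expR (- (7 * L)).
  apply: (@le_trans _ _ (prl (bern p) (fun f => (F1 f || F2 f) || (F3 f || F4 f)))).
    apply: (prl_le b0) => f /andP[/eqP hf]; apply: contraR.
    rewrite !negb_or /F1 /F2 /F3 hf eqxx !andTb.
    move=> /andP[/andP[/negbNE/asboolP g1 /negbNE/asboolP g2]].
    move=> /andP[/negbNE/asboolP g3 g4]; apply/asboolP; split=> // U U0 hU; rewrite leNgt.
    apply/negP => h; case/negP: g4; rewrite /F4; apply/existsP; exists U; rewrite U0 hU /=.
    by rewrite -hf.
  apply: le_trans (prl_or b0 _ _) _.
  have o1 := prl_or b0 F1 F2; have o2 := prl_or b0 F3 F4.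
  have q1 : prl (bern p) F1 <= expR (- (7 * L)).
    by apply: f1; rewrite card_prod card2 four cardV leq_mul2r ltnW ?orbT // ltn_expl.
  have q2 : prl (bern p) F2 <= expR (- (7 * L)).
    by apply: f2; rewrite card_unit expn_gt0.
  have q3 : prl (bern p) F3 <= expR (- (7 * L)).
    by apply: f3; rewrite card_prod card2 four.
  lra.
apply: (@le_trans _ _ (expR (2 * L) * (5 * expR (- (7 * L))))).
  by apply: ler_pM => //; [exact: prl_ge0|exact: (N1_le hnL hL)].
by rewrite mulrCA -expRD (_ : 2 * L + - (7 * L) = - (5 * L)) //; ring.
Qed.

Lemma pr_seq_le (r : seq nat) (A : nat -> pred {perm T}) (b : R) :
  (forall M, M \in r -> pr R (A M) <= b) ->
  pr R (fun s => has (fun M => A M s) r) <= (size r)%:R * b.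
Proof.
move=> h; apply: le_trans (pr_exists _ _ _) _.
elim: r h => [|M r IH] h; first by rewrite big_nil mul0r.
rewrite big_cons -[(size _)%:R](natr1 (size r)) mulrDl mul1r addrC; apply: lerD.
  by apply: IH => M' hM'; apply: h; rewrite in_cons hM' orbT.
by apply: h; exact: mem_head.
Qed.

(** 54 = 48 + 5 + 1: isolated vertices at [M0], then [good_fail] and [late_mindeg], each summed over
    at most exp(2 L) times and bounded through exp(-3 L) <= 1 / L. *)
Theorem resilient_process_bound (A : trajectory n -> Prop) :
  (forall G : trajectory n, (forall M : 'I_('C(n, 2)).+1, (2 <= min_degree (G M))%N ->
      resiliently_hamiltonian (1 / 2 - eps) (G M) /\
      ~ resiliently_hamiltonian (1 / 2 + eps) (G M)) -> A G) ->
  1 - (54 + c_sep R) / L <= process_prob R A.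
Proof.
move=> hA; rewrite process_probE.
have hL' := hL; have L0 : 0 < L by lra.
have n0 := n_gt0 hnL hL.
pose t : R := c_delta R * (M1%:R / n%:R).
pose B1 (s : {perm T}) := [forall v, (0 < degree (first s M0) v)%N].
pose B2 (s : {perm T}) := short_path t (first s M0) (first s M1).
pose B3 M (s : {perm T}) := ~~ `[< good eps (first s M) >].
pose B4 M (s : {perm T}) := [exists v, (degree (first s M) v)%:R < c_delta R * (M%:R / n%:R)].
pose r3 := [seq M <- iota 0 N.+1 | (M0 <= M)%N].
pose r4 := [seq M <- iota 0 N.+1 | (M1 <= M)%N].
have sz (P : pred nat) : (size [seq M <- iota 0 N.+1 | P M])%:R <= expR (2 * L).
  apply: le_trans (N1_le hnL hL); rewrite ler_nat size_filter.
  by apply: leq_trans (count_size _ _) _; rewrite size_iota.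
pose bad s := (B1 s || B2 s) || (has (fun M => B3 M s) r3 || has (fun M => B4 M s) r4).
have hbad : pr R bad <= (54 + c_sep R) / L.
  apply: le_trans (pr_or R _ _) _.
  have h12 := le_trans (pr_or R B1 B2) (lerD (early_dense hnL hL) (small_separated hnL hL (erefl t))).
  have h3 : pr R (fun s => has (fun M => B3 M s) r3) <= expR (2 * L) * (5 * expR (- (5 * L))).
    apply: le_trans (@pr_seq_le r3 B3 (5 * expR (- (5 * L))) _) _.
      by move=> M; rewrite mem_filter mem_iota add0n ltnS => /andP[h1 h2]; exact: good_fail.
    by apply: ler_wpM2r; [rewrite mulr_ge0 // expR_ge0|exact: sz].
  have h4 : pr R (fun s => has (fun M => B4 M s) r4) <= expR (2 * L) * expR (- (5 * L)).
    apply: le_trans (@pr_seq_le r4 B4 (expR (- (5 * L))) _) _.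
      by move=> M; rewrite mem_filter mem_iota add0n ltnS => /andP[h1 h2]; exact: late_mindeg.
    by apply: ler_wpM2r; [exact: expR_ge0|exact: sz].
  have h34 := le_trans (pr_or R _ _) (lerD h3 h4).
  have e3 : expR (2 * L) * expR (- (5 * L)) <= 1 / L.
    rewrite -expRD (_ : 2 * L + - (5 * L) = - (3 * L)); last by ring.
    rewrite expRN div1r lef_pV2 ?posrE ?expR_gt0 //; have := expR_ge1Dx (3 * L); lra.
  apply: le_trans (lerD h12 h34) _; rewrite mulrCA.
  have -> : (54 + c_sep R) / L = 48 / L + c_sep R / L + 6 * (1 / L) by field; rewrite gt_eqF.
  lra.
apply: (@le_trans _ _ (pr R (predC bad))); first by rewrite pr_predC; lra.
apply: pr_le => s /=; rewrite !negb_or => /andP[/andP[/forallPn[v0 hv0] hB2] /andP[hB3 hB4]].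
apply/asboolP; apply: hA => M; rewrite ffunE => hmin.
have hMN : (M <= N)%N by rewrite card_T -ltnS.
have cM : #|first s M| = M by rewrite card_first.
have hM0 : (M0 <= M)%N.
  rewrite leqNgt; apply/negP => hlt; case/negP: hv0.
  apply: (@leq_trans (degree (first s M) v0)).
    by apply: leq_trans (min_degree_le _ v0); exact: ltnW hmin.
  by rewrite !degreeE; apply/subset_leq_card/setSI/first_sub/ltnW.
have hgood : good eps (first s M).
  apply/asboolP; have := hasPn hB3 M; rewrite mem_filter mem_iota hM0 add0n ltnS hMN => /(_ isT).
  by rewrite /B3 negbK.
have n3 : (2 < #|V|)%N by rewrite cardV; exact: (n_gt2 hnL hL).
apply: good_resilient => //.
  rewrite cM cardV; apply: le_trans hL3 _; rewrite ler_pdivlMr //.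
  rewrite (_ : _ * n%:R = 3 / 8 * (n%:R * L)); last by ring.
  by apply: le_trans (M0_bounds hnL hL).1 _; rewrite ler_nat.
rewrite cM cardV; apply: separated_uniq => x y q; rewrite !inE -!ltNge => hx hy hq hp uq q0 hl.
(* From [M1] on no vertex has low degree. Before [M1], a short path between low-degree vertices of
   G_M persists in the graph at [M1], and its ends have at most the same degrees at [M0], below the
   larger threshold [t]. *)
have [hM1|hM1] := leqP M1 M.
  have := hasPn hB4 M; rewrite mem_filter mem_iota hM1 add0n ltnS hMN => /(_ isT).
  by case/negP; apply/existsP; exists x.
case/negP: hB2; apply/existsP; exists x.
have hq5 : (size q < 5)%N by rewrite ltnS.
apply/existsP; exists (Ordinal hq5); apply/existsP; exists (in_tuple q) => /=.
have hdeg z : (degree (first s M) z)%:R < c_delta R * (M%:R / n%:R) ->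
    (degree (first s M0) z)%:R < t.
  move=> hz; apply: (@le_lt_trans _ _ (degree (first s M) z)%:R).
    by rewrite ler_nat !degreeE; apply/subset_leq_card/setSI/first_sub.
  apply: lt_le_trans hz _; rewrite /t; apply: ler_wpM2l; first by rewrite /c_delta; lra.
  by apply: ler_wpM2r; rewrite ?invr_ge0 ?ler0n // ler_nat ltnW.
rewrite q0 hdeg // hl hdeg //= !andbT; move: uq; rewrite cons_uniq => /andP[-> ->] /=.
by apply: sub_path hp => u v; apply/adj_sub/first_sub/ltnW.
Qed.

End Assembly.

Lemma resiliently_hamiltonian_le (R : realType) (V : finType) (G : graph V) (a b : R) :
  a <= b -> resiliently_hamiltonian b G -> resiliently_hamiltonian a G.
Proof.
move=> hab hb H sH hH; apply: hb => // v; apply: le_trans (hH v) _.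
by apply: ler_wpM2r.
Qed.

Lemma c_sep_ge0 (R : realType) : 0 <= c_sep R.
Proof.
rewrite /c_sep divr_ge0 //; last by rewrite exprn_ge0 // divr_ge0.
by rewrite !mulr_ge0 // ?exprn_ge0 // expR_ge0.
Qed.

Lemma c_r0_ge0 (R : realType) (eps : R) : 0 < eps <= 1 / 4 -> 0 <= c_r0 eps.
Proof.
move=> h; have /andP[g0 _] := c_gamma_bounds h; have a0 := c_alpha_gt0 h.
have /andP[k0 _] := c_kappa_bounds h; have /andP[k0' _] := c_kappa'_bounds h.
have /andP[e0 _] := h; rewrite /c_r0.
have i4 : 0 <= 4 / c_kappa eps by rewrite divr_ge0 // ltW.
have i5 : 0 <= 4 / c_kappa' eps by rewrite divr_ge0 // ltW.
apply: addr_ge0; last by rewrite divr_ge0 ?mulr_ge0 // ltW.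
apply: addr_ge0; first by rewrite divr_ge0 // ltW.
apply: mulr_ge0; first by rewrite divr_ge0 // ltW.
by rewrite !addr_ge0.
Qed.

From mathcomp Require Import all_classical all_reals all_analysis.

Theorem theorem1p2 (R : realType) (eps : R) (heps : 0 < eps) :
  almost_every_process R (fun (n : nat) (G : trajectory n) =>
    forall M : 'I_('C(n, 2)).+1,
      (2 <= min_degree (G M))%N ->
      resiliently_hamiltonian (1 / 2 - eps) (G M) /\
      ~ resiliently_hamiltonian (1 / 2 + eps) (G M)).
Proof.
(* Resilience is antitone in its parameter, so both assertions for [d] imply those for [eps]. *)
pose d := Num.min eps (1 / 4); pose C : R := 54 + c_sep R.
have hd : 0 < d <= 1 / 4.
  by rewrite lt_min heps divr_gt0 //= ge_min lexx orbT.
have hde : d <= eps by rewrite ge_min lexx.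
have /andP[d0 _] := hd; have /andP[c0 _] := c_c_bounds hd.
have hC : 0 < C by have := c_sep_ge0 R; rewrite /C; lra.
pose kap := c_c d * d ^+ 2 / 512 * (3 / 8).
have kap0 : 0 < kap by have := mulr_gt0 c0 (exprn_gt0 2 d0); rewrite /kap; lra.
apply/cvgrPdist_le => e e0; near=> n.
pose L : R := ln n%:R.
(* The summands provide, in this order, [200 <= L], the hypotheses [hL1], [hL2] and [hL3] of the
   section, and C / L <= e. *)
have hn : expR (200 + 3 / kap + 4 / d + 8 / 3 * c_r0 d + C / e) <= n%:R.
  by near: n; exact: nbhs_infty_ger.
have n0 : 0 < n%:R :> R by apply: lt_le_trans hn; exact: expR_gt0.
have hnL : n%:R = expR L by rewrite /L lnK.
have := hn; rewrite hnL ler_expR => hL.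
have r0 := c_r0_ge0 hd.
have i1 : 0 <= 3 / kap by rewrite divr_ge0 // ltW.
have i2 : 0 <= 4 / d by rewrite divr_ge0 // ltW.
have i3 : 0 <= C / e by rewrite divr_ge0 // ltW.
have L200 : 200 <= L by lra.
have hlow := @resilient_process_bound R d n L hd hnL L200.
set P := process_prob R _.
have P1 : P <= 1 by rewrite /P process_probE; exact: pr_le1.
have P0 : 1 - C / L <= P.
  apply: hlow.
  - by rewrite -/kap -ler_pdivrMl // [kap^-1 * 3]mulrC; lra.
  - lra.
  - lra.
  - move=> G hG M hM; have [h1 h2] := hG M hM; split.
      by apply: resiliently_hamiltonian_le h1; lra.
    by apply: contra_not h2; apply: resiliently_hamiltonian_le; lra.
rewrite ger0_norm ?subr_ge0 //; apply: (@le_trans _ _ (C / L)); first lra.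
have Ce : C / e <= L by lra.
rewrite ler_pdivrMr; last lra.
by rewrite ler_pdivrMr // mulrC in Ce.
Unshelve. all: by end_near.
Qed.
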